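(* Let $\Gamma(z)=Cz-D$ ($z\in\mathbb{C}^n$) for some invertible matrix $C\in\mathcal{M}(n)$ with $\|C\|\le 1$ and $D\in\mathbb{C}^n$, and let $U$ be a holomorphic function on $\mathbb{C}^n$ such that $C_{U,\Gamma}$ is bounded on $F_\psi^2$. If $C_{U,\Gamma}$ is a co-isometry on $F_\psi^2$, then for all $z\in\mathbb{C}^n$ $$U(z)=\beta\,\frac{K_{C^{-1}D,\psi}(z)}{\|K_{C^{-1}D,\psi}\|},$$ where $\beta=\dfrac{1}{\overline{U(0)}\,\|K_{C^{-1}D,\psi}\|}$, $|\beta|=\sqrt{c_{n-1}}$ and $|C^{-1}D|=|D|$.
   Context: Let $n\ge 1$. On $\mathbb{C}^n$ write $\langle w,z\rangle=\sum_{j=1}^n w_j\overline{z_j}$ and $|w|^2=\langle w,w\rangle$. $\mathcal{M}(n)$ is the set of complex $n\times n$ matrices and $\|C\|$ is the operator norm of a matrix $C$ induced by $|\cdot|$. Weight: $\psi:[0,\infty)\to[0,\infty)$ is a $C^3$ function with $\psi'(y)>0$, $\psi''(y)\ge 0$, $\psi'''(y)\ge 0$ for all $y\ge 0$. Moreover there is a real number $l<\tfrac12$ such that, with $\phi(y)=y\psi'(y)$, $\phi''(y)=O\big(y^{-1/2}[\phi'(y)]^{1+l}\big)$ as $y\to\infty$; when $n>1$ it is also assumed that $\psi''(y)=O\big(y^{-1/2}[\psi'(y)]^{1+l}\big)$ as $y\to\infty$. Put $c_r=\int_0^\infty s^re^{-\psi(s)}\,ds$ for $r\ge 0$. Space: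 $F_\psi^2$ is the Hilbert space of holomorphic functions $g:\mathbb{C}^n\to\mathbb{C}$ with $\int_{\mathbb{C}^n}|g(z)|^2e^{-\psi(|z|^2)}\,d\mu(z)<\infty$, with inner product $\langle g,h\rangle_\psi=\int_{\mathbb{C}^n} g(z)\overline{h(z)}e^{-\psi(|z|^2)}\,d\mu(z)$ and norm $\|\cdot\|$, where $\mu$ is $\frac{(n-1)!}{\pi^n}$ times standard Lebesgue measure on $\mathbb{C}^n$. Its reproducing kernel at $p\in\mathbb{C}^n$ (so $f(p)=\langle f,K_{p,\psi}\rangle_\psi$ for all $f\in F_\psi^2$) is $$K_{p,\psi}(z)=\frac{1}{(n-1)!}\sum_{r=n-1}^\infty\frac{r(r-1)\cdots(r-n+2)}{c_r}\langle z,p\rangle^{r-n+1}$$ (the product in the numerator is $1$ when $n=1$). For holomorphic $U:\mathbb{C}^n\to\mathbb{C}$ and $\Gamma:\mathbb{C}^n\to\mathbb{C}^n$, the weighted composition operator is $C_{U,\Gamma}f=U\cdot(f\circ\Gamma)$. ''Bounded on $F_\psi^2$'' means that the operator maps $F_\psi^2$ into itself and is a bounded linear operator. A bounded operator $S$ on a Hilbert space $H$ is a co-isometry if $S^*$ is an isometry, equivalently $SS^*=I_H$. *)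

(* Defs.v *)
From HB Require Import structures.
From mathcomp Require Import all_boot all_order all_algebra.
From mathcomp Require Import all_classical all_reals all_analysis.
From mathcomp Require Import complex.

Set Implicit Arguments.
Unset Strict Implicit.
Unset Printing Implicit Defensive.

Import Order.TTheory GRing.Theory Num.Theory.
Import numFieldNormedType.Exports.

Local Open Scope classical_set_scope.
Local Open Scope ring_scope.
Local Open Scope complex_scope.

Section Euclidean.
Context {R : realType} {n : nat}.
Implicit Types (w z : 'cV[R[i]]_n) (C : 'M[R[i]]_n).

Definition cdot w z : R[i] := \sum_(j < n) w j 0 * (z j 0)^*.

Definition sqnorm w : R := complex.Re (cdot w w).

Definition eucl w : R := Num.sqrt (sqnorm w).

Definition opnorm C : R := sup [set eucl (C *m w) | w in [set w | eucl w <= 1]].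

(* The normed-module structure of R[i] over itself is carried by the regular
   module R[i]^o (R[i] is an R-module), so [differentiable] is Fréchet
   differentiability with an R[i]-linear differential. *)
Definition holomorphic (g : 'cV[R[i]]_n -> R[i]) :=
  forall z : ('cV[R[i]]_n : normedModType R[i]),
    differentiable (g : 'cV[R[i]]_n -> R[i]^o) z.

End Euclidean.

Section Weight.
Context {R : realType}.
Implicit Types (f psi : R -> R).

(* Functions on [0, +oo[ are represented by functions on R whose values at
   negative arguments are never used: derivatives are taken within [0, +oo[, so
   that the derivative at 0 is one-sided. *)
Definition ray_quot f (y x : R) : R := (f x - f y) / (x - y).

Definition ray_derivable f := forall y, 0 <= y ->
  cvg (ray_quot f y x @[x --> within `[0, +oo[ y^']).

Definition ray_derive f (y : R) : R :=
  lim (ray_quot f y x @[x --> within `[0, +oo[ y^']).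

Local Notation "f ^'1" := (ray_derive f) (at level 1).
Local Notation "f ^'2" := (ray_derive (ray_derive f)) (at level 1).
Local Notation "f ^'3" := (ray_derive (ray_derive (ray_derive f))) (at level 1).

Canonical pinfty_filter_on : filter_on R :=
  FilterType (+oo_R) _.

Definition ray_phi psi (y : R) : R := y * psi^'1 y.

Record admissible_weight (n : nat) psi : Prop := AdmissibleWeight {
  weight_ge0 : forall y : R, 0 <= y -> 0 <= psi y ;
  weight_derivable1 : ray_derivable psi ;
  weight_derivable2 : ray_derivable psi^'1 ;
  weight_derivable3 : ray_derivable psi^'2 ;
  weight_continuous3 : {within `[0, +oo[, continuous psi^'3} ;
  weight_derive1_gt0 : forall y : R, 0 <= y -> 0 < psi^'1 y ;
  weight_derive2_ge0 : forall y : R, 0 <= y -> 0 <= psi^'2 y ;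
  weight_derive3_ge0 : forall y : R, 0 <= y -> 0 <= psi^'3 y ;
  weight_growth : exists2 l : R, l < 2^-1 &
    (ray_phi psi)^'2 =O_ (+oo_R)
      (fun y => y `^ (- 2^-1) * (ray_phi psi)^'1 y `^ (1 + l)) /\
    ((1 < n)%N ->
      psi^'2 =O_ (+oo_R) (fun y => y `^ (- 2^-1) * psi^'1 y `^ (1 + l)))
}.

Definition moment psi (r : nat) : R :=
  \int[lebesgue_measure]_(s in `[0, +oo[) (s ^+ r * expR (- psi s)).

End Weight.

Section LebesgueCn.
Context {R : realType}.

Local Notation plane := (measurableTypeR R * measurableTypeR R)%type.

Definition tuple_cons (n : nat)
    (q : n.-tuple plane * measurableTypeR R * measurableTypeR R) :
  n.+1.-tuple plane := [the n.+1.-tuple plane of (q.1.2, q.2) :: q.1.1].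

Lemma measurable_tuple_cons n : measurable_fun setT (@tuple_cons n).
Proof.
apply: measurable_cons.
  apply: measurable_fun_pair; last exact: measurable_snd.
  exact: measurableT_comp measurable_snd measurable_fst.
exact: measurableT_comp measurable_fst measurable_fst.
Qed.

Section TupleConsMeasure.
Variables (n : nat) (m : {measure set (n.-tuple plane) -> \bar R}).

Definition tuple_cons_measure : set (n.+1.-tuple plane) -> \bar R :=
  pushforward (m \x @lebesgue_measure R \x @lebesgue_measure R)%E
    (@tuple_cons n).

HB.instance Definition _ := Measure.copy tuple_cons_measure
  (measure_function_pushforward__canonical__measure_function_Measure
    (m \x @lebesgue_measure R \x @lebesgue_measure R)%E
    (@measurable_tuple_cons n)).

End TupleConsMeasure.

(* Lebesgue measure on (R * R)^n, i.e. on C^n read in real coordinates. *)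
Fixpoint lebesgue_Cn (n : nat) : {measure set (n.-tuple plane) -> \bar R} :=
  match n with
  | 0 => \d_([tuple] : 0.-tuple plane)
  | m.+1 => tuple_cons_measure (lebesgue_Cn m)
  end.

Definition vec_of_plane (n : nat) (t : n.-tuple plane) : 'cV[R[i]]_n :=
  \col_(j < n) ((tnth t j).1 +i* (tnth t j).2).

Lemma mu_factor_ge0 (n : nat) : 0 <= (n.-1)`!%:R / pi ^+ n :> R.
Proof. by rewrite divr_ge0// exprn_ge0// pi_ge0. Qed.

Definition mu_Cn (n : nat) : {measure set (n.-tuple plane) -> \bar R} :=
  mscale (NngNum (mu_factor_ge0 n)) (lebesgue_Cn n).

End LebesgueCn.

Section FockSpace.
Context {R : realType} {n : nat}.
Variable psi : R -> R.
Local Notation fct := ('cV[R[i]]_n -> R[i]).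
Implicit Types (g h U : fct) (S T : fct -> fct) (p z : 'cV[R[i]]_n).

Definition fock_weight z : R := expR (- psi (sqnorm z)).

Definition integral_Cn (F : fct) : R[i] :=
  (\int[mu_Cn n]_t complex.Re (F (vec_of_plane t))) +i*
  (\int[mu_Cn n]_t complex.Im (F (vec_of_plane t))).

Definition fock g : Prop := holomorphic g /\
  (\int[mu_Cn n]_t
     (Normc.normc (g (vec_of_plane t)) ^+ 2 * fock_weight (vec_of_plane t))%:E
   < +oo)%E.

Definition fock_inner g h : R[i] :=
  integral_Cn (fun z => g z * (h z)^* * (fock_weight z)%:C).

Definition fock_norm g : R := Num.sqrt (complex.Re (fock_inner g g)).

(* [r ^_ n.-1] is the product r (r - 1) ... (r - n + 2), and the exponent
   r - n.-1 is r - n + 1. *)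
Definition fock_kernel p : fct := fun z =>
  ((n.-1)`!%:R)^-1 *
  limn (fun N : nat => \sum_(n.-1 <= r < N)
    ((r ^_ n.-1)%:R / (moment psi r)%:C * cdot z p ^+ (r - n.-1)) : R[i]^o).

Definition weighted_composition U (G : 'cV[R[i]]_n -> 'cV[R[i]]_n) : fct -> fct :=
  fun f z => U z * f (G z).

Definition bounded_on_fock S : Prop :=
  [/\ forall f, fock f -> fock (S f),
      forall (a : R[i]) f g, fock f -> fock g ->
        S (fun z => a * f z + g z) = (fun z => a * S f z + S g z) &
      exists M : R, forall f, fock f -> fock_norm (S f) <= M * fock_norm f].

Definition fock_adjoint S T : Prop :=
  (forall f, fock f -> fock (T f)) /\
  (forall f g, fock f -> fock g -> fock_inner (S f) g = fock_inner f (T g)).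

(* Only the values of T on the space matter; there T is determined by S, since
   elements of the space that are orthogonal to it vanish. *)
Definition coisometry_on_fock S : Prop := exists2 T : fct -> fct,
  fock_adjoint S T & forall f, fock f -> fock_norm (T f) = fock_norm f.

End FockSpace.

(* Main.v *)
(** Let [S] be the weighted composition operator, [T] its adjoint, [G z = C z - D]
    and [K_p] the reproducing kernel. Then [T K_w z = <K_w, S K_z> =
    conj (U w) K_(G w) z], and [T] preserves inner products by polarization, so
    that [conj (U w) U z K_(G w) (G z) = K_w z] for all [w] and [z]. At
    [w = p = C^-1 D] one has [G p = 0], and [K_0] is the constant [1 / c_(n-1)]:
    hence [U] is a multiple of [K_p], and taking also [z = 0] and [z = p] gives
    the constants. At [w = z = 0] the identity becomes [K_D D = K_p p], whence
    [|D| = |p|] because [K_q q] is a strictly increasing function of [|q|].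

    The reproducing property itself is proved as follows. A unitary change of
    variables, written as a product of shears (which preserve Lebesgue measure),
    moves [p] to the first coordinate axis. Averaging over rotations of the other
    coordinates and then of the first one shows that the integral of
    [g(z) conj(z_0)^k e^-psi(|z|^2)] is [a_k gamma_k], where [a_k] is the [k]-th
    Taylor coefficient of [g] along the axis and [gamma_k] is the integral of
    [|z_0|^2k e^-psi(|z|^2)]. Polar coordinates give [gamma_k] in terms of the
    moments, so that [K_p z] is the sum of [<z, p>^k / gamma_k], and dominated
    convergence sums the Taylor series of [g] at [p]. *)

(* The integrals over [C^n] are iterated integrals over the line, where the elementary changes of
   variables are the translations and dilations of a single real coordinate. Tonelli's theorem turns
   translations into shears, and every rotation used below, real or complex, is a product of shears;
   this is why the map that moves [p] to an axis comes as an explicit product and not as an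
   arbitrary unitary matrix with a prescribed column. Taylor's theorem is needed for functions known
   only to be complex differentiable, and its proof uses a difference quotient that is merely
   continuous at one point. Hence Goursat's lemma is proved first and then extended across such a
   point. Series are handled with explicit errors [B / 2 ^+ N]. They are available because the
   moments outgrow every geometric sequence, so that the kernel coefficients decay faster than any
   such sequence. Dominated convergence asks for one square-integrable bound on all truncations of
   the kernel at once: it is the kernel series evaluated at moduli. *)
Require Import Defs.
From HB Require Import structures.
From mathcomp Require Import all_boot all_order all_algebra.
From mathcomp Require Import all_classical all_reals all_analysis.
From mathcomp Require Import measurable_realfun complex ring lra.

Set Implicit Arguments.
Unset Strict Implicit.
Unset Printing Implicit Defensive.

Import Order.TTheory GRing.Theory Num.Theory.
Import numFieldNormedType.Exports.

Local Open Scope classical_set_scope.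
Local Open Scope ring_scope.
Local Open Scope complex_scope.

Local Notation normc := (@Normc.normc _).
Local Notation Re := (@complex.Re _).
Local Notation Im := (@complex.Im _).
Local Notation conj := (@Num.conj _).

(** * Complex analysis on circles *)

Section ComplexNorm.
Context {R : realType}.
Implicit Types (z w : R[i]) (x y : R).

Lemma normc_ge0 z : 0 <= normc z.
Proof. by case: z => a b; rewrite /= sqrtr_ge0. Qed.

Lemma normc_inv z : normc z^-1 = (normc z)^-1.
Proof. exact: Normc.normcV. Qed.

Lemma normc_eq0 z : (normc z == 0) = (z == 0).
Proof.
by apply/eqP/eqP => [/Normc.eq0_normc//|->]; rewrite Normc.normc0.
Qed.

Lemma normc_gt0 z : (0 < normc z) = (z != 0).
Proof. by rewrite lt_neqAle normc_ge0 eq_sym normc_eq0 andbT. Qed.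

Lemma normcX z k : normc (z ^+ k) = normc z ^+ k.
Proof. by elim: k => [|k IH]; rewrite ?expr0 ?Normc.normc1// !exprS Normc.normcM IH. Qed.

Lemma normcR x : normc x%:C = `|x|.
Proof. by rewrite /= expr0n addr0 sqrtr_sqr. Qed.

Lemma normc_conjc z : normc (conj z) = normc z.
Proof. by case: z => a b /=; rewrite sqrrN. Qed.

Lemma normci : normc ('i : R[i]) = 1.
Proof. by rewrite /= expr0n/= add0r expr1n sqrtr1. Qed.

Lemma normcB z w : normc (z - w) = normc (w - z).
Proof. by rewrite -normcN opprB. Qed.

Lemma normc_triB z w : normc (z - w) <= normc z + normc w.
Proof. by rewrite -(normcN w) le_normcD. Qed.

Lemma normc_dist z w : `|normc z - normc w| <= normc (z - w).
Proof.
rewrite ler_norml; apply/andP; split.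
  rewrite lerNl opprB lerBlDr normcB.
  by rewrite -[X in normc X <= _](subrK z) le_normcD.
by rewrite lerBlDr -[X in normc X <= _](subrK w) le_normcD.
Qed.

Lemma normc_geRe z : `|Re z| <= normc z.
Proof.
case: z => a b /=; rewrite -sqrtr_sqr ler_sqrt ?sqr_ge0//.
  by rewrite lerDl sqr_ge0.
by rewrite addr_ge0 ?sqr_ge0.
Qed.

Lemma normc_geIm z : `|Im z| <= normc z.
Proof.
case: z => a b /=; rewrite -sqrtr_sqr ler_sqrt ?sqr_ge0//.
  by rewrite lerDr sqr_ge0.
by rewrite addr_ge0 ?sqr_ge0.
Qed.

Lemma normc_le_ReIm z : normc z <= `|Re z| + `|Im z|.
Proof.
case: z => a b /=.
rewrite -(ger0_norm (addr_ge0 (normr_ge0 a) (normr_ge0 b))) -sqrtr_sqr.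
rewrite ler_sqrt ?sqr_ge0// sqrrD !real_normK ?num_real//.
by rewrite lerD2r lerDl mulrn_wge0// mulr_ge0.
Qed.

Lemma sqr_normcE z : normc z ^+ 2 = Re z ^+ 2 + Im z ^+ 2.
Proof. by case: z => a b /=; rewrite sqr_sqrtr// addr_ge0 ?sqr_ge0. Qed.

Lemma mulc_conjc z : z * conj z = (normc z ^+ 2)%:C.
Proof.
rewrite sqr_normcE; case: z => a b /=; apply/eqP; rewrite eq_complex/=.
by apply/andP; split; apply/eqP; ring.
Qed.

Lemma conjM z w : conj (z * w) = conj z * conj w.
Proof. exact: rmorphM. Qed.

Lemma conjD z w : conj (z + w) = conj z + conj w.
Proof. exact: rmorphD. Qed.

Lemma conjB z w : conj (z - w) = conj z - conj w.
Proof. exact: rmorphB. Qed.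

Lemma conjX z k : conj (z ^+ k) = conj z ^+ k.
Proof. exact: rmorphXn. Qed.

Lemma conjV z : conj z^-1 = (conj z)^-1.
Proof. exact: conjc_inv. Qed.

Lemma conj_real x : conj x%:C = x%:C.
Proof. exact: conjc_real. Qed.

Lemma Re_conjE z : Re (conj z) = Re z.
Proof. by case: z. Qed.

Lemma Im_conjE z : Im (conj z) = - Im z.
Proof. by case: z. Qed.

Lemma Re_mulc z w : Re (z * w) = Re z * Re w - Im z * Im w.
Proof. by case: z w => a b [c d]. Qed.

Lemma Im_mulc z w : Im (z * w) = Re z * Im w + Im z * Re w.
Proof. by case: z w => a b [c d]. Qed.

Lemma Re_addc z w : Re (z + w) = Re z + Re w.
Proof. by case: z w => a b [c d]. Qed.

Lemma Im_addc z w : Im (z + w) = Im z + Im w.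
Proof. by case: z w => a b [c d]. Qed.

Lemma Re_oppc z : Re (- z) = - Re z.
Proof. by case: z. Qed.

Lemma Im_oppc z : Im (- z) = - Im z.
Proof. by case: z. Qed.

Lemma eqc z w : Re z = Re w -> Im z = Im w -> z = w.
Proof. by case: z w => a b [c d] /= -> ->. Qed.

End ComplexNorm.

Section RectangleFunction.
Context {R : realType}.
Variable E : R -> R -> R -> R -> R[i].
Hypothesis Ex : forall x1 x2 x3 t1 t2, x1 <= x2 -> x2 <= x3 -> t1 <= t2 ->
  E x1 x3 t1 t2 = E x1 x2 t1 t2 + E x2 x3 t1 t2.
Hypothesis Et : forall x1 x2 t1 t2 t3, x1 <= x2 -> t1 <= t2 -> t2 <= t3 ->
  E x1 x2 t1 t3 = E x1 x2 t1 t2 + E x1 x2 t2 t3.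

Let half_pow (a : R) k : a / 2 ^+ k = a / 2 ^+ k.+1 + a / 2 ^+ k.+1.
Proof. by rewrite exprS invfM; field; rewrite expf_neq0// pnatr_eq0. Qed.

(** Pigeonhole: by additivity the value is the sum over four quarters, so one of them carries at
    least a fourth of the modulus; [q] is the lower left corner of that quarter. *)
Let quarter a b x t : 0 <= a -> 0 <= b ->
  exists q : R * R, [/\ x <= q.1, q.1 + a <= x + (a + a),
     t <= q.2, q.2 + b <= t + (b + b) &
     normc (E x (x + (a + a)) t (t + (b + b))) / 4 <=
     normc (E q.1 (q.1 + a) q.2 (q.2 + b))].
Proof.
move=> a0 b0.
have eE : E x (x + (a + a)) t (t + (b + b)) =
    (E x (x + a) t (t + b) + E (x + a) (x + a + a) t (t + b)) +
    (E x (x + a) (t + b) (t + b + b) +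
     E (x + a) (x + a + a) (t + b) (t + b + b)).
  have xa : x <= x + a by rewrite lerDl.
  have xaa : x + a <= x + a + a by rewrite lerDl.
  have tb : t <= t + b by rewrite lerDl.
  have tbb : t + b <= t + b + b by rewrite lerDl.
  have xab : x <= x + a + a by exact: le_trans xaa.
  by rewrite !addrA (Et xab tb tbb) (Ex xa xaa tb) (Ex xa xaa tbb) !addrA.
have : normc (E x (x + (a + a)) t (t + (b + b))) <=
  normc (E x (x + a) t (t + b)) + normc (E (x + a) (x + a + a) t (t + b)) +
  (normc (E x (x + a) (t + b) (t + b + b)) +
     normc (E (x + a) (x + a + a) (t + b) (t + b + b))).
  by rewrite eE; apply: le_trans (le_normcD _ _) _; rewrite lerD// le_normcD.
set n0 := normc (E x (x + (a + a)) _ _).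
set n1 := normc (E x (x + a) t _); set n2 := normc (E _ _ t (t + b)).
set n3 := normc (E x _ (t + b) _); set n4 := normc (E (x + a) _ (t + b) _).
move=> H.
have [h1|h1] := leP (n0 / 4) n1.
  by exists (x, t) => /=; split => //; lra.
have [h2|h2] := leP (n0 / 4) n2.
  by exists (x + a, t) => /=; split => //; lra.
have [h3|h3] := leP (n0 / 4) n3.
  by exists (x, t + b) => /=; split => //; lra.
exists (x + a, t + b) => /=; split => //; try lra.
by rewrite -/n4; lra.
Qed.

(** [quarter] at scale [2 ^- k], made into data so that the nested rectangles can be defined by
    recursion. *)
Let bisect a b (k : nat) (p : R * R) : 0 <= a -> 0 <= b ->
  {q : R * R | [/\ p.1 <= q.1, q.1 + a / 2 ^+ k.+1 <= p.1 + a / 2 ^+ k,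
     p.2 <= q.2, q.2 + b / 2 ^+ k.+1 <= p.2 + b / 2 ^+ k &
     normc (E p.1 (p.1 + a / 2 ^+ k) p.2 (p.2 + b / 2 ^+ k)) / 4 <=
     normc (E q.1 (q.1 + a / 2 ^+ k.+1) q.2 (q.2 + b / 2 ^+ k.+1))]}.
Proof.
move=> a0 b0; apply: cid.
have ak : 0 <= a / 2 ^+ k.+1 by rewrite divr_ge0// exprn_ge0.
have bk : 0 <= b / 2 ^+ k.+1 by rewrite divr_ge0// exprn_ge0.
by rewrite (half_pow a k) (half_pow b k); exact: quarter.
Qed.

(* Bisection: the value on one quarter is at least a fourth of the total. *)
Lemma rectangle_function_eq0 x1 x2 t1 t2 : x1 <= x2 -> t1 <= t2 ->
  (forall x t, x1 <= x <= x2 -> t1 <= t <= t2 ->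
     forall e, 0 < e -> exists2 d, 0 < d & forall y1 y2 u1 u2,
     y1 <= x <= y2 -> u1 <= t <= u2 -> y2 - y1 < d -> u2 - u1 < d ->
     normc (E y1 y2 u1 u2) <= e * ((y2 - y1) + (u2 - u1)) ^+ 2) ->
  E x1 x2 t1 t2 = 0.
Proof.
move=> x12 t12 small; apply: contrapT => /eqP; rewrite -normc_gt0.
set eta := normc _ => eta0.
pose a := x2 - x1; pose b := t2 - t1.
have a0 : 0 <= a by rewrite subr_ge0.
have b0 : 0 <= b by rewrite subr_ge0.
pose q := fix q k := if k is k'.+1 then sval (bisect k' (q k') a0 b0) else (x1, t1).
have qS k := svalP (bisect k (q k) a0 b0).
have big k : eta / 4 ^+ k <= normc (E (q k).1 ((q k).1 + a / 2 ^+ k) (q k).2 ((q k).2 + b / 2 ^+ k)).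
  elim: k => [|k IH]; first by rewrite !expr0 !divr1 /= /a /b !(addrC _ (_ - _)) !subrK.
  have [_ _ _ _] := qS k; apply: le_trans.
  by rewrite exprSr invfM mulrA ler_pM2r// invr_gt0.
have mono j k : (j <= k)%N -> [/\ (q j).1 <= (q k).1,
    (q k).1 + a / 2 ^+ k <= (q j).1 + a / 2 ^+ j,
    (q j).2 <= (q k).2 & (q k).2 + b / 2 ^+ k <= (q j).2 + b / 2 ^+ j].
  elim: k => [|k IH]; first by rewrite leqn0 => /eqP ->; split.
  rewrite leq_eqVlt => /predU1P[->|]; first by split.
  rewrite ltnS => /IH[h1 h2 h3 h4]; have [g1 g2 g3 g4 _] := qS k.
  by split; [exact: le_trans h1 g1|exact: le_trans g2 h2|
             exact: le_trans h3 g3|exact: le_trans g4 h4].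
have ab0 k : 0 <= a / 2 ^+ k /\ 0 <= b / 2 ^+ k.
  by rewrite !divr_ge0 ?exprn_ge0.
have cross j k : (q j).1 <= (q k).1 + a / 2 ^+ k /\ (q j).2 <= (q k).2 + b / 2 ^+ k.
  have [jk|/ltnW kj] := leqP j k.
    have [h1 _ h3 _] := mono _ _ jk; have [? ?] := ab0 k; split.
      by apply: le_trans h1 _; rewrite lerDl.
    by apply: le_trans h3 _; rewrite lerDl.
  have [_ h2 _ h4] := mono _ _ kj; have [? ?] := ab0 j; split.
    by apply: le_trans h2; rewrite lerDl.
  by apply: le_trans h4; rewrite lerDl.
(* The suprema of the lower left corners are the coordinates of a point common to all the nested
   rectangles. *)
pose X := [set (q k).1 | k in setT]; pose T := [set (q k).2 | k in setT].
have X0 : X !=set0 by exists (q 0).1; exists 0%N.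
have T0 : T !=set0 by exists (q 0).2; exists 0%N.
have Xub k : (ubound X) ((q k).1 + a / 2 ^+ k).
  by move=> _ [j _ <-]; have [] := cross j k.
have Tub k : (ubound T) ((q k).2 + b / 2 ^+ k).
  by move=> _ [j _ <-]; have [] := cross j k.
have hX k : (q k).1 <= sup X <= (q k).1 + a / 2 ^+ k.
  rewrite ge_sup// andbT; apply: ub_le_sup; last by exists k.
  by exists ((q k).1 + a / 2 ^+ k).
have hT k : (q k).2 <= sup T <= (q k).2 + b / 2 ^+ k.
  rewrite ge_sup// andbT; apply: ub_le_sup; last by exists k.
  by exists ((q k).2 + b / 2 ^+ k).
have hX0 : x1 <= sup X <= x2 by have := hX 0%N; rewrite expr0 divr1 /= /a addrC subrK.
have hT0 : t1 <= sup T <= t2 by have := hT 0%N; rewrite expr0 divr1 /= /b addrC subrK.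
(* At scale [k] the smallness hypothesis bounds the value by this constant times
   [(a + b) ^+ 2 / 4 ^+ k], which is less than [eta / 4 ^+ k]. The added 1 covers the case
   [a = b = 0]. *)
have e0 : 0 < eta / (2 * ((a + b) ^+ 2 + 1)).
  by rewrite divr_gt0// mulr_gt0// ltr_pwDr ?sqr_ge0.
have [d d0 Hd] := small _ _ hX0 hT0 _ e0.
pose k := (Num.truncn ((a + b) / d)).+1.
have k1 : (a + b) / 2 ^+ k < d.
  rewrite ltr_pdivrMr ?exprn_gt0// mulrC -ltr_pdivrMr//.
  apply: (@lt_trans _ _ k%:R); first by rewrite truncnS_gt.
  by rewrite -natrX ltr_nat ltn_expl.
have ak : a / 2 ^+ k < d.
  by apply: le_lt_trans k1; rewrite ler_pM2r ?invr_gt0 ?exprn_gt0// lerDl.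
have bk : b / 2 ^+ k < d.
  by apply: le_lt_trans k1; rewrite ler_pM2r ?invr_gt0 ?exprn_gt0// lerDr.
have := Hd (q k).1 ((q k).1 + a / 2 ^+ k) (q k).2 ((q k).2 + b / 2 ^+ k) (hX k) (hT k).
have addK' (x y : R) : x + y - x = y by ring.
rewrite !addK' => /(_ ak bk) /(le_trans (big k)).
rewrite -mulrDl expr_div_n -exprM mulnC exprM (_ : 2 ^+ 2 = 4); last by ring.
rewrite mulrA ler_pM2r ?invr_gt0 ?exprn_gt0//.
rewrite mulrAC ler_pdivlMr; last by have := sqr_ge0 (a + b); lra.
have := sqr_ge0 (a + b); move: ((a + b) ^+ 2) => z z0.
rewrite leNgt => /negP; apply; rewrite ltr_pM2l//; lra.
Qed.

End RectangleFunction.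

(** * Integrals of complex functions over an interval *)

Section IntervalIntegral.
Context {R : realType}.
Implicit Types (f g : R -> R[i]) (a b : R).

Definition ccont f := continuous (Re \o f) /\ continuous (Im \o f).

Definition cint a b f : R[i] :=
  (\int[lebesgue_measure]_(x in `[a, b]) Re (f x)) +i*
  (\int[lebesgue_measure]_(x in `[a, b]) Im (f x)).

Lemma ccont_cst c : ccont (fun=> c).
Proof. by split => x; apply: cvg_cst. Qed.

Lemma ccontD f g : ccont f -> ccont g -> ccont (fun x => f x + g x).
Proof.
move=> [f1 f2] [g1 g2]; split.
  rewrite (_ : _ \o _ = (fun x => Re (f x) + Re (g x))); last by apply/funext => x /=; rewrite Re_addc.
  by move=> x; apply: cvgD; [exact: f1|exact: g1].
rewrite (_ : _ \o _ = (fun x => Im (f x) + Im (g x))); last by apply/funext => x /=; rewrite Im_addc.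
by move=> x; apply: cvgD; [exact: f2|exact: g2].
Qed.

Lemma ccontM f g : ccont f -> ccont g -> ccont (fun x => f x * g x).
Proof.
move=> [f1 f2] [g1 g2]; split.
  rewrite (_ : _ \o _ = (fun x => Re (f x) * Re (g x) - Im (f x) * Im (g x))); last first.
    by apply/funext => x /=; rewrite Re_mulc.
  by move=> x; apply: cvgB; apply: cvgM; [exact: f1|exact: g1|exact: f2|exact: g2].
rewrite (_ : _ \o _ = (fun x => Re (f x) * Im (g x) + Im (f x) * Re (g x))); last first.
  by apply/funext => x /=; rewrite Im_mulc.
by move=> x; apply: cvgD; apply: cvgM; [exact: f1|exact: g2|exact: f2|exact: g1].
Qed.

Lemma ccontN f : ccont f -> ccont (fun x => - f x).
Proof.
move=> cf; rewrite (_ : (fun _ => _) = (fun x => (- 1) * f x)).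
  exact: (ccontM (ccont_cst _)).
by apply/funext => x; rewrite mulN1r.
Qed.

Lemma ccontB f g : ccont f -> ccont g -> ccont (fun x => f x - g x).
Proof. by move=> cf cg; apply: ccontD => //; apply: ccontN. Qed.

Lemma ccontX f k : ccont f -> ccont (fun x => f x ^+ k).
Proof.
move=> cf; elim: k => [|k IH].
  by rewrite (_ : (fun _ => _) = (fun=> 1)) //; exact: ccont_cst.
rewrite (_ : (fun _ => _) = (fun x => f x * f x ^+ k)); first exact: ccontM.
by apply/funext => x; rewrite exprS.
Qed.

Lemma ccont_sum (I : Type) (s : seq I) (F : I -> R -> R[i]) :
  (forall i, ccont (F i)) -> ccont (fun x => \sum_(i <- s) F i x).
Proof.
move=> cF; elim: s => [|i s IH].
  rewrite (_ : (fun _ => _) = (fun=> 0)); first exact: ccont_cst.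
  by apply/funext => x; rewrite big_nil.
rewrite (_ : (fun _ => _) = (fun x => F i x + \sum_(i <- s) F i x)).
  exact: ccontD.
by apply/funext => x; rewrite big_cons.
Qed.

Lemma ccontP f : (forall x e, 0 < e -> exists2 d, 0 < d & forall y, `|y - x| < d ->
  normc (f y - f x) < e) -> ccont f.
Proof.
move=> H; split => x; apply/cvgrPdist_lt => e e0; have [d d0 Hd] := H x e e0;
  near=> y; rewrite /= distrC.
- rewrite -Re_oppc -Re_addc; apply: le_lt_trans (normc_geRe _) _; apply: Hd.
  near: y; apply/nbhs_ballP; exists d => // y /=; rewrite /ball/= distrC//.
- rewrite -Im_oppc -Im_addc; apply: le_lt_trans (normc_geIm _) _; apply: Hd.
  near: y; apply/nbhs_ballP; exists d => // y /=; rewrite /ball/= distrC//.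
Unshelve. all: by end_near. Qed.

Lemma ccont_normc f : ccont f -> continuous (normc \o f).
Proof.
move=> [f1 f2]; rewrite (_ : _ \o _ = (fun x => Num.sqrt (Re (f x) ^+ 2 + Im (f x) ^+ 2))).
  move=> x; apply: (@continuous_comp _ _ _ (fun x => Re (f x) ^+ 2 + Im (f x) ^+ 2) Num.sqrt).
    by apply: cvgD; rewrite expr2; apply: cvgM; [exact: f1|exact: f1|exact: f2|exact: f2].
  exact: sqrt_continuous.
by apply/funext => x /=; rewrite -sqr_normcE sqrtr_sqr ger0_norm// normc_ge0.
Qed.

Let int_cont (h : R -> R) a b : continuous h ->
  lebesgue_measure.-integrable `[a, b] (EFin \o h).
Proof.
move=> ch; apply: continuous_compact_integrable; first exact: segment_compact.
by apply: continuous_subspaceT.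
Qed.

Lemma cintD f g a b : ccont f -> ccont g ->
  cint a b (fun x => f x + g x) = cint a b f + cint a b g.
Proof.
move=> [f1 f2] [g1 g2]; apply: eqc; rewrite /cint/=.
  rewrite -RintegralD//; [|exact: (int_cont _ _ f1)|exact: (int_cont _ _ g1)].
  by apply: eq_Rintegral => x _; rewrite Re_addc.
rewrite -RintegralD//; [|exact: (int_cont _ _ f2)|exact: (int_cont _ _ g2)].
by apply: eq_Rintegral => x _; rewrite Im_addc.
Qed.

Lemma cintZ c f a b : ccont f -> cint a b (fun x => c * f x) = c * cint a b f.
Proof.
move=> [f1 f2]; apply: eqc; rewrite /cint ?(Re_mulc,Im_mulc)/=.
  transitivity (\int[lebesgue_measure]_(x in `[a, b]) (Re c * Re (f x) - Im c * Im (f x)))%R.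
    by apply: eq_Rintegral => x _; rewrite Re_mulc.
  rewrite RintegralB ?RintegralZl//.
  - exact: (int_cont _ _ f2).
  - exact: (int_cont _ _ f1).
  - by apply: (@int_cont (fun x => _ * Re (f x))) => x; apply: cvgM; [exact: cvg_cst|exact: f1].
  - by apply: (@int_cont (fun x => _ * Im (f x))) => x; apply: cvgM; [exact: cvg_cst|exact: f2].
transitivity (\int[lebesgue_measure]_(x in `[a, b]) (Re c * Im (f x) + Im c * Re (f x)))%R.
  by apply: eq_Rintegral => x _; rewrite Im_mulc.
rewrite RintegralD ?RintegralZl//.
- exact: (int_cont _ _ f1).
- exact: (int_cont _ _ f2).
- by apply: (@int_cont (fun x => _ * Im (f x))) => x; apply: cvgM; [exact: cvg_cst|exact: f2].
- by apply: (@int_cont (fun x => _ * Re (f x))) => x; apply: cvgM; [exact: cvg_cst|exact: f1].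
Qed.

Lemma cintB f g a b : ccont f -> ccont g ->
  cint a b (fun x => f x - g x) = cint a b f - cint a b g.
Proof.
move=> cf cg; rewrite cintD//; last exact: ccontN.
congr (_ + _); rewrite -mulN1r -cintZ//; congr cint.
by apply/funext => x; rewrite mulN1r.
Qed.

Lemma cint_sum (I : Type) (s : seq I) (F : I -> R -> R[i]) a b :
  (forall i, ccont (F i)) ->
  cint a b (fun x => \sum_(i <- s) F i x) = \sum_(i <- s) cint a b (F i).
Proof.
move=> cF; elim: s => [|i s IH].
  rewrite big_nil /cint; under eq_Rintegral do rewrite big_nil/=.
  rewrite Rintegral_cst// mul0r.
  by under eq_Rintegral do rewrite big_nil/=; rewrite Rintegral_cst// mul0r.
rewrite big_cons -IH -cintD//; last exact: ccont_sum.
by congr cint; apply/funext => x; rewrite big_cons.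
Qed.

Let len_itv a b : a <= b -> fine (@lebesgue_measure R `[a, b]) = b - a.
Proof.
move=> ab; rewrite lebesgue_measure_itv/= lte_fin.
by move: ab; rewrite le_eqVlt => /predU1P[->|->//]; rewrite ltxx subrr.
Qed.

Lemma cint_cst c a b : a <= b -> cint a b (fun=> c) = (b - a)%:C * c.
Proof.
move=> ab; rewrite /cint !Rintegral_cst// len_itv//.
by apply: eqc; rewrite ?(Re_mulc, Im_mulc)/=; ring.
Qed.

Lemma cint_cat f a b c : ccont f -> a <= b -> b <= c ->
  cint a c f = cint a b f + cint b c f.
Proof.
move=> [f1 f2] ab bc; have key (h : R -> R) : continuous h ->
   (\int[lebesgue_measure]_(x in `[a, c]) h x =
   \int[lebesgue_measure]_(x in `[a, b]) h x +
   \int[lebesgue_measure]_(x in `[b, c]) h x)%R.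
  move=> ch; rewrite -[X in _ = _ + X]Rintegral_itv_obnd_cbnd; last first.
    by apply: integrableS (int_cont b c ch) => //; apply: subset_itvr; rewrite bnd_simp.
  rewrite -(@Rintegral_itvB _ h (BLeft a) (BRight c) b)//.
  - by rewrite addrCA subrr addr0.
  - exact: int_cont.
by apply: eqc; rewrite ?(Re_addc, Im_addc)/=; apply: key.
Qed.

(** The factor 2 comes from bounding the real and the imaginary part separately; only the order of
    magnitude of the bound matters later. *)
Lemma normc_cint_le f a b M : ccont f -> a <= b ->
  (forall x, a <= x <= b -> normc (f x) <= M) ->
  normc (cint a b f) <= 2 * M * (b - a).
Proof.
move=> [f1 f2] ab fM; apply: le_trans (normc_le_ReIm _) _.
have key (h : R -> R) : continuous h -> (forall x, a <= x <= b -> `|h x| <= M) ->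
   `|\int[lebesgue_measure]_(x in `[a, b]) h x| <= M * (b - a).
  move=> ch hM; apply: le_trans (le_normr_Rintegral _ _) _ => //; first exact: int_cont.
  have -> : M * (b - a) = (\int[lebesgue_measure]_(x in `[a, b]) M)%R.
    by rewrite Rintegral_cst// len_itv.
  apply: le_Rintegral => //.
  - apply: (@int_cont (fun x => `|h x|)) => x; apply: cvg_norm; exact: ch.
  - by apply: (@int_cont (fun=> M)) => x; apply: cvg_cst.
rewrite -mulrA mulr_natl mulr2n; apply: lerD; apply: key => // x /fM.
  exact: le_trans (normc_geRe _).
exact: le_trans (normc_geIm _).
Qed.

End IntervalIntegral.

(** * Goursat's lemma on rectangles *)

Section Goursat.
Context {R : realType}.

Definition rdiff (G : R -> R -> R[i]) x t := exists d : R[i],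
  forall e, 0 < e -> exists2 dl, 0 < dl & forall y u, `|y - x| < dl -> `|u - t| < dl ->
  normc (G y u - G x t - d * ((y - x) +i* (u - t))) <= e * (`|y - x| + `|u - t|).

(** The integral of [G dz] along the boundary of the rectangle, counterclockwise. *)
Definition bdint (G : R -> R -> R[i]) x1 x2 t1 t2 : R[i] :=
  cint x1 x2 (G ^~ t1) - cint x1 x2 (G ^~ t2) +
  (0 +i* 1) * (cint t1 t2 (G x2) - cint t1 t2 (G x1)).

Lemma bdint_catx G x1 x2 x3 t1 t2 : (forall t, ccont (G ^~ t)) ->
  x1 <= x2 -> x2 <= x3 -> t1 <= t2 ->
  bdint G x1 x3 t1 t2 = bdint G x1 x2 t1 t2 + bdint G x2 x3 t1 t2.
Proof.
move=> cG x12 x23 t12; rewrite /bdint.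
rewrite (cint_cat (cG t1) x12 x23) (cint_cat (cG t2) x12 x23); ring.
Qed.

Lemma bdint_catt G x1 x2 t1 t2 t3 : (forall x, ccont (G x)) ->
  x1 <= x2 -> t1 <= t2 -> t2 <= t3 ->
  bdint G x1 x2 t1 t3 = bdint G x1 x2 t1 t2 + bdint G x1 x2 t2 t3.
Proof.
move=> cG x12 t12 t23; rewrite /bdint.
rewrite (cint_cat (cG x1) t12 t23) (cint_cat (cG x2) t12 t23); ring.
Qed.

(** Near each point [G] is affine up to a term of smaller order. An affine function has boundary
    integral 0, and what remains is small compared with the square of the size of the rectangle. *)
Lemma goursat G x1 x2 t1 t2 : (forall t, ccont (G ^~ t)) -> (forall x, ccont (G x)) ->
  x1 <= x2 -> t1 <= t2 ->
  (forall x t, x1 <= x <= x2 -> t1 <= t <= t2 -> rdiff G x t) ->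
  bdint G x1 x2 t1 t2 = 0.
Proof.
move=> cx ct x12 t12 dG; apply: (rectangle_function_eq0 _ _ x12 t12).
- by move=> *; apply: bdint_catx.
- by move=> *; apply: bdint_catt.
move=> x t xx tt e e0; have [d Hd] := dG x t xx tt.
(* With [M] the error bound on one side, the two pairs of sides contribute at most
   [4 * M * (al + be)], that is [e / 2 * (al + be) ^+ 2]. *)
have e8 : 0 < e / 8 by rewrite divr_gt0.
have [dl dl0 Hdl] := Hd _ e8; exists dl => //.
move=> y1 y2 u1 u2 /andP[y1x xy2] /andP[u1t tu2] ydl udl.
pose al := y2 - y1; pose be := u2 - u1.
have y12 : y1 <= y2 by exact: le_trans xy2.
have u12 : u1 <= u2 by exact: le_trans tu2.
pose rho y u := G y u - G x t - d * ((y - x) +i* (u - t)).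
have rhoP y u : y1 <= y <= y2 -> u1 <= u <= u2 -> normc (rho y u) <= e / 8 * (al + be).
  move=> /andP[h1 h2] /andP[h3 h4].
  have a1 : `|y - x| <= al by rewrite ler_norml /al; apply/andP; split; lra.
  have a2 : `|u - t| <= be by rewrite ler_norml /be; apply/andP; split; lra.
  apply: le_trans (Hdl _ _ _ _) _.
  - exact: le_lt_trans a1 ydl.
  - exact: le_lt_trans a2 udl.
  - by rewrite ler_pM2l// lerD.
have c1 : ccont (fun s => G s u1 - G s u2 - d * (0 +i* (u1 - u2))).
  by apply: ccontB; [exact: ccontB|exact: ccont_cst].
have c2 : ccont (fun u => G y2 u - G y1 u - d * (y2 - y1)%:C).
  by apply: ccontB; [exact: ccontB|exact: ccont_cst].
(* Opposite sides are paired: the linear part then has a constant difference on each pair, and the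
   two contributions cancel. *)
have -> : bdint G y1 y2 u1 u2 =
   cint y1 y2 (fun s => G s u1 - G s u2 - d * (0 +i* (u1 - u2))) +
   (0 +i* 1) * cint u1 u2 (fun u => G y2 u - G y1 u - d * (y2 - y1)%:C).
  rewrite !cintB//; try exact: ccont_cst; try exact: ccontB.
  rewrite !cint_cst// /bdint.
  have -> : (y2 - y1)%:C * (d * (0 +i* (u1 - u2))) =
     - ((0 +i* 1) * ((u2 - u1)%:C * (d * (y2 - y1)%:C))).
    by case: d {Hd Hdl rho rhoP c1 c2} => a b; apply/eqP; rewrite eq_complex/=; apply/andP; split; apply/eqP; ring.
  ring.
set M := e / 8 * (al + be).
have y12' : y1 <= y2 <= y2 by rewrite y12 lexx.
have y11' : y1 <= y1 <= y2 by rewrite y12 lexx.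
have u12' : u1 <= u2 <= u2 by rewrite u12 lexx.
have u11' : u1 <= u1 <= u2 by rewrite u12 lexx.
have b1 : normc (cint y1 y2 (fun s => G s u1 - G s u2 - d * (0 +i* (u1 - u2)))) <= 2 * (M + M) * al.
  apply: normc_cint_le => // s hs.
  rewrite (_ : _ - _ = rho s u1 - rho s u2).
    by apply: le_trans (normc_triB _ _) _; rewrite lerD ?rhoP.
  rewrite /rho (_ : (0 +i* (u1 - u2)) = ((s - x) +i* (u1 - t)) - ((s - x) +i* (u2 - t))); first by ring.
  by apply/eqP; rewrite eq_complex/=; apply/andP; split; apply/eqP; ring.
have b2 : normc (cint u1 u2 (fun u => G y2 u - G y1 u - d * (y2 - y1)%:C)) <= 2 * (M + M) * be.
  apply: normc_cint_le => // s hs.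
  rewrite (_ : _ - _ = rho y2 s - rho y1 s).
    by apply: le_trans (normc_triB _ _) _; rewrite lerD ?rhoP.
  rewrite /rho (_ : (y2 - y1)%:C = ((y2 - x) +i* (s - t)) - ((y1 - x) +i* (s - t))); first by ring.
  by apply/eqP; rewrite eq_complex/=; apply/andP; split; apply/eqP; ring.
apply: le_trans (le_normcD _ _) _.
rewrite Normc.normcM (_ : normc (0 +i* 1) = 1) ?mul1r; last exact: normci.
apply: le_trans (lerD b1 b2) _; rewrite -mulrDr -/al -/be /M.
have : 0 <= e * (al + be) ^+ 2 by rewrite mulr_ge0 ?sqr_ge0// ltW.
by rewrite expr2; lra.
Qed.

End Goursat.

(** * Complex differentiability in one variable *)

Section ComplexDifferentiable.
Context {R : realType}.
Implicit Types (h g : R[i] -> R[i]) (z w : R[i]).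

Definition cdiff h z := exists d : R[i],
  forall e, 0 < e -> exists2 dl, 0 < dl & forall w, normc (w - z) < dl ->
  normc (h w - h z - d * (w - z)) <= e * normc (w - z).

Definition cctn h z := forall e, 0 < e -> exists2 dl, 0 < dl &
  forall w, normc (w - z) < dl -> normc (h w - h z) < e.

Lemma cdiff_cctn h z : cdiff h z -> cctn h z.
Proof.
move=> [d Hd] e e0; have [dl dl0 H] := Hd 1 ltr01.
exists (Num.min dl (e / (2 + normc d))).
  by rewrite lt_min dl0 divr_gt0// ltr_wpDr ?normc_ge0.
move=> w; rewrite lt_min => /andP[h1 h2].
rewrite -[h w - h z](subrK (d * (w - z))).
apply: le_lt_trans (le_normcD _ _) _; rewrite Normc.normcM.
apply: (@le_lt_trans _ _ ((1 + normc d) * normc (w - z))).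
  by rewrite mulrDl lerD// H.
move: h2; rewrite ltr_pdivlMr; last by rewrite ltr_wpDr ?normc_ge0.
by move: (normc_ge0 d) (normc_ge0 (w - z)) => ? ?; nra.
Qed.

Lemma cdiff_local h g z r : 0 < r -> (forall w, normc (w - z) < r -> h w = g w) ->
  cdiff h z -> cdiff g z.
Proof.
move=> r0 hg [d Hd]; exists d => e e0; have [dl dl0 H] := Hd e e0.
exists (Num.min dl r); first by rewrite lt_min dl0.
move=> w; rewrite lt_min => /andP[h1 h2]; rewrite -!hg ?H//.
by rewrite subrr Normc.normc0.
Qed.

(** The expansion form [cdiff] suits the estimates; this equivalence hands it the closure rules of
    [differentiable]. *)
Lemma cdiffP h z : cdiff h z <-> differentiable (h : R[i]^o -> R[i]^o) (z : R[i]^o).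
Proof.
have cE (e : R[i]) : 0 < e -> e = (Re e)%:C /\ 0 < Re e.
  by rewrite ltcE => /andP[/eqP + e0]; case: e e0 => ? ? /= ? ->.
split=> [[d Hd]|/derivable1_diffP/cvg_ex[d /cvgrPdist_le Hd]].
  apply/derivable1_diffP/cvg_ex; exists d; apply/cvgrPdist_le => e /cE[eE e0].
  have [dl dl0 H] := Hd _ e0; apply/nbhs_ballP; exists dl%:C; first by rewrite /= ltcR.
  move=> b; rewrite /ball/= sub0r normrN -[X in X < _]/((normc b)%:C) ltcR => bd b0.
  have := H (b + z); rewrite addrK => /(_ bd) {}H.
  rewrite [leRHS]eE /GRing.scale/= mulr1 -[X in X <= _]/((normc (d - b^-1 * (h (b + z) - h z)))%:C) lecR.
  have n0 : 0 < normc b by rewrite normc_gt0.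
  rewrite -(ler_pM2r n0) -Normc.normcM -normcN.
  have -> : - ((d - b^-1 * (h (b + z) - h z)) * b) = h (b + z) - h z - d * b.
    by rewrite mulrBl opprB; congr (_ - _); rewrite mulrAC mulVf// mul1r.
  exact: H.
exists d => e e0; have e0' : 0 < e%:C :> R[i] by rewrite ltcR.
have /nbhs_ballP[r /= /cE[rE r0] Hr] := Hd _ e0'; exists (Re r) => // w wz.
have [->|wn] := eqVneq w z; first by rewrite !subrr mulr0 subrr Normc.normc0 mulr0.
have b0 : w - z != 0 by rewrite subr_eq0.
have := Hr (w - z); rewrite /ball/= sub0r normrN {1}rE -[X in X < _]/((normc (w - z))%:C) ltcR => /(_ wz b0).
rewrite /GRing.scale/= mulr1 subrK -[X in X <= _]/((normc (d - (w - z)^-1 * (h w - h z)))%:C) lecR => H.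
have n0 : 0 < normc (w - z) by rewrite normc_gt0.
rewrite -(ler_pM2r n0) -Normc.normcM -normcN in H.
rewrite (_ : h w - h z - d * (w - z) = - ((d - (w - z)^-1 * (h w - h z)) * (w - z)))//.
by rewrite mulrBl opprB; congr (_ - _); rewrite mulrAC mulVf// mul1r.
Qed.

Lemma cdiff_cst c z : cdiff (fun=> c) z.
Proof. exact/cdiffP/differentiable_cst. Qed.

Lemma cdiff_id z : cdiff id z.
Proof. exact/cdiffP/derivable1_diffP/derivable_id. Qed.

Lemma cdiffD h g z : cdiff h z -> cdiff g z -> cdiff (fun w => h w + g w) z.
Proof. by move=> /cdiffP ch /cdiffP cg; exact/cdiffP/differentiableD. Qed.

Lemma cdiffM h g z : cdiff h z -> cdiff g z -> cdiff (fun w => h w * g w) z.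
Proof. by move=> /cdiffP ch /cdiffP cg; exact/cdiffP/differentiableM. Qed.

Lemma cdiff_inv z : z != 0 -> cdiff (fun w => w^-1) z.
Proof.
by move=> z0; apply/cdiffP/derivable1_diffP/derivableV => //; exact: derivable_id.
Qed.

Lemma cdiff_comp h g z : cdiff g z -> cdiff h (g z) -> cdiff (h \o g) z.
Proof.
move=> /cdiffP cg /cdiffP ch; apply/cdiffP.
exact: (differentiable_comp (f := g : R[i]^o -> R[i]^o) (g := h : R[i]^o -> R[i]^o) cg ch).
Qed.

Lemma cdiffX h z k : cdiff h z -> cdiff (fun w => h w ^+ k) z.
Proof.
move=> ch; elim: k => [|k IH]; first exact: (cdiff_cst 1).
rewrite (_ : (fun _ => _) = (fun w => h w * h w ^+ k)); first exact: cdiffM.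
by apply/funext => w; rewrite exprS.
Qed.

End ComplexDifferentiable.

(** * The exponential as a change of variables *)

Section ComplexExponential.
Context {R : realType}.
Implicit Types (x y t u : R).

Definition cis t : R[i] := cos t +i* sin t.
Definition cexp x t : R[i] := (expR x)%:C * cis t.

Lemma normc_cis t : normc (cis t) = 1.
Proof. by rewrite /= cos2Dsin2 sqrtr1. Qed.

Lemma cis_neq0 t : cis t != 0.
Proof. by rewrite -normc_gt0 normc_cis. Qed.

Lemma cisD t u : cis (t + u) = cis t * cis u.
Proof. by rewrite /cis cosD sinD; apply: eqc; rewrite ?(Re_mulc,Im_mulc)/=; ring. Qed.

Lemma cisJ t : conj (cis t) = (cis t)^-1.
Proof.
apply: (mulfI (cis_neq0 t)); rewrite divff ?cis_neq0//.
by rewrite mulc_conjc normc_cis expr1n.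
Qed.

Lemma cis_pi : cis pi = -1.
Proof. by rewrite /cis cospi sinpi; apply: eqc => /=; rewrite ?oppr0. Qed.

Lemma cis_Npi : cis (- pi) = -1.
Proof. by rewrite /cis cosN sinN cospi sinpi; apply: eqc => /=; rewrite ?oppr0. Qed.

Lemma cis2pi t : cis (t + pi + pi) = cis t.
Proof. by rewrite (cisD _ pi) (cisD t pi) cis_pi !mulrN1 opprK. Qed.

Lemma ccont_cis : ccont cis.
Proof. by split => x; [exact: continuous_cos|exact: continuous_sin]. Qed.

Lemma cexpD x y t u : cexp (x + y) (t + u) = cexp x t * cexp y u.
Proof. by rewrite /cexp expRD cisD rmorphM/= mulrACA. Qed.

Lemma normc_cexp x t : normc (cexp x t) = expR x.
Proof. by rewrite Normc.normcM normc_cis mulr1 normcR ger0_norm ?expR_ge0. Qed.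

Lemma cexp_neq0 x t : cexp x t != 0.
Proof. by rewrite -normc_gt0 normc_cexp expR_gt0. Qed.

Lemma is_derive_lin (f : R -> R) x l : is_derive x 1 f l ->
  forall e, 0 < e -> exists2 d, 0 < d & forall y, `|y| < d ->
    `|f (x + y) - f x - l * y| <= e * `|y|.
Proof.
move=> [df lE] e e0; move: df => /cvg_ex[l' Hl'].
have El : l' = l by rewrite -lE; apply/esym/cvg_lim.
move: Hl'; rewrite El => /cvgrPdist_le /(_ _ e0).
move=> /nbhs_ballP[d /= d0 Hd]; exists d => // y yd.
have [->|y0] := eqVneq y 0; first by rewrite addr0 subrr mulr0 subrr normr0 mulr0.
have /= := Hd y; rewrite /ball/= sub0r normrN => /(_ yd y0).
rewrite /GRing.scale/= mulr1 [y + x]addrC => H.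
rewrite (_ : _ - _ = - (l - y^-1 * (f (x + y) - f x)) * y); last by field.
by rewrite normrM normrN ler_wpM2r.
Qed.

Lemma cexp_lin0 e : 0 < e -> exists2 d, 0 < d & forall x t, `|x| < d -> `|t| < d ->
  normc (cexp x t - 1 - (x +i* t)) <= e * (`|x| + `|t|).
Proof.
(* The estimates add up to [e1 * |x| + 5 * (e1 * |t|)], hence the 5; [e1 <= 1] ensures [expR x <= 2]
   and [|sin t| <= 2 * |t|]. *)
move=> e0; pose e1 := Num.min 1 (e / 5).
have e10 : 0 < e1 by rewrite lt_min ltr01 divr_gt0.
have e11 : e1 <= 1 by rewrite ge_min lexx.
have e1e : e1 <= e / 5 by rewrite ge_min lexx orbT.
have [d1 d10 H1] := is_derive_lin (is_derive_expR (0 : R)) e10.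
have [d2 d20 H2] := is_derive_lin (is_derive_cos (0 : R)) e10.
have [d3 d30 H3] := is_derive_lin (is_derive_sin (0 : R)) e10.
exists (Num.min (Num.min d1 d2) (Num.min d3 (e1 / 2))).
  by rewrite !lt_min d10 d20 d30 divr_gt0.
move=> x t; rewrite !lt_min => /andP[/andP[/H1 + _] /andP[_ hx]].
move=> + /andP[/andP[_ /H2 +] /andP[/H3 + _]].
rewrite !add0r expR0 cos0 sin0 oppr0 mul0r !mul1r !subr0 addr0 => h1 h2 h3.
apply: le_trans (normc_le_ReIm _) _ => /=.
rewrite !mul0r !(subr0,addr0,oppr0).
have x0 := normr_ge0 x; have t0 := normr_ge0 t.
have ex : e1 * `|x| <= `|x| by rewrite ler_piMl.
have et : e1 * `|t| <= `|t| by rewrite ler_piMl.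
have c1 : `|cos t| <= 1 by rewrite ler_norml cos_geN1 cos_le1.
have e2 : `|expR x - 1| <= e1.
  rewrite (_ : _ - 1 = (expR x - 1 - x) + x); last by ring.
  apply: le_trans (ler_normD _ _) _; lra.
have s2 : `|sin t| <= 2 * `|t|.
  rewrite -[sin t](subrK t).
  apply: le_trans (ler_normD _ _) _; lra.
have x2 : `|expR x| <= 2.
  rewrite -[expR x](subrK 1); apply: le_trans (ler_normD _ _) _.
  rewrite normr1; lra.
rewrite (_ : _ - 1 - x = (expR x - 1 - x) * 1 + expR x * (cos t - 1)); last by ring.
rewrite (_ : expR x * sin t - t = (expR x - 1) * sin t + (sin t - t)); last by ring.
apply: (@le_trans _ _ ((e1 * `|x| + 2 * (e1 * `|t|)) + (e1 * (2 * `|t|) + e1 * `|t|))).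
  apply: lerD; apply: le_trans (ler_normD _ _) _; rewrite !normrM ?normr1 ?mulr1;
    apply: lerD => //; apply: ler_pM => //.
have : e1 * `|x| <= e / 5 * `|x| by rewrite ler_wpM2r.
have : e1 * `|t| <= e / 5 * `|t| by rewrite ler_wpM2r.
have : 0 <= e * `|x| by rewrite mulr_ge0// ltW.
by lra.
Qed.

(** Chain rule. Since [cexp y u] is [cexp x t] times [cexp (y - x) (u - t)], the expansion of [cexp]
    at the origin is enough. *)
Lemma cdiff_cexp h x t : cdiff h (cexp x t) -> rdiff (fun y u => h (cexp y u)) x t.
Proof.
move=> [d Hd]; set E := cexp x t in Hd *; exists (d * E) => e e0.
pose A := normc E; have A0 : 0 < A by rewrite normc_gt0 cexp_neq0.
pose B := normc (d * E) + 1; have B0 : 0 < B by rewrite ltr_wpDl ?normc_ge0.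
have e1 : 0 < e / 2 / (2 * A) by rewrite !divr_gt0// mulr_gt0.
have [d1 d10 H1] := Hd _ e1.
have e20 : 0 < e / 2 / B by rewrite !divr_gt0.
have [d2 d20 H2] := cexp_lin0 e20.
have [d3 d30 H3] := cexp_lin0 (ltr01 : 0 < (1 : R)).
(* The increment of [cexp] is at most [2 * A * m] with [m < 2 * d1 / (5 * A)], so it stays below
   [d1]. *)
exists (Num.min d2 (Num.min d3 (d1 / (5 * A)))).
  by rewrite !lt_min d20 d30 divr_gt0// mulr_gt0.
move=> y u; rewrite !lt_min => /andP[y2 /andP[y3 y4]] /andP[u2 /andP[u3 u4]].
have -> : cexp y u = E * cexp (y - x) (u - t) by rewrite /E -cexpD !subrKC.
have h2 := H2 _ _ y2 u2; have h3 := H3 _ _ y3 u3.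
set v := (y - x) +i* (u - t) in h2 h3 *.
set F := cexp _ _ in h2 h3 *; set m := `|y - x| + `|u - t| in h2 h3 *.
have m0 : 0 <= m by rewrite addr_ge0.
have vm : normc v <= m by exact: normc_le_ReIm.
have Fm : normc (E * F - E) <= 2 * A * m.
  rewrite -[X in _ - X]mulr1 -mulrBr Normc.normcM -/A mulrAC mulrC ler_pM2r//.
  rewrite -[F - 1](subrK v); apply: le_trans (le_normcD _ _) _; rewrite mul1r in h3.
  by rewrite mulr_natl mulr2n lerD.
have md : m < 2 * d1 / (5 * A).
  by rewrite -mulrA mulr_natl mulr2n ltrD.
have Fd : normc (E * F - E) < d1.
  apply: le_lt_trans Fm _.
  move: md; rewrite ltr_pdivlMr ?mulr_gt0// => md; nra.
have := H1 _ Fd; rewrite (_ : _ - _ = h (E * F) - h E - d * E * v - d * E * (F - 1 - v)); last by ring.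
set p := _ - d * E * v => hp.
rewrite -[p](subrK (d * E * (F - 1 - v))).
apply: le_trans (le_normcD _ _) _.
rewrite [e]splitr mulrDl; apply: lerD.
  apply: le_trans hp _; apply: le_trans (ler_wpM2l (ltW e1) Fm) _.
  by rewrite mulrA divfK// gt_eqF// mulr_gt0.
rewrite Normc.normcM; apply: (@le_trans _ _ (B * (e / 2 / B * m))).
  by apply: ler_pM; rewrite ?normc_ge0// /B lerDl.
by rewrite mulrA [B * _]mulrC divfK// gt_eqF.
Qed.

Lemma cctn_ccont (h : R[i] -> R[i]) (g : R -> R[i]) :
  ccont g -> (forall t, cctn h (g t)) -> ccont (h \o g).
Proof.
move=> [g1 g2] ch; apply: ccontP => x e e0; have [d d0 Hd] := ch x e e0.
have d2 : 0 < d / 2 by rewrite divr_gt0.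
move: (g1 x) => /cvgrPdist_lt /(_ _ d2) /nbhs_ballP[r1 /= r10 H1].
move: (g2 x) => /cvgrPdist_lt /(_ _ d2) /nbhs_ballP[r2 /= r20 H2].
exists (Num.min r1 r2); first by rewrite lt_min r10.
move=> y; rewrite lt_min => /andP[y1 y2]; apply: Hd.
apply: le_lt_trans (normc_le_ReIm _) _; rewrite [d]splitr.
rewrite Re_addc Re_oppc Im_addc Im_oppc.
have /= := H1 y; rewrite /ball/= distrC => /(_ y1); rewrite distrC => {}H1.
have /= := H2 y; rewrite /ball/= distrC => /(_ y2); rewrite distrC => {}H2.
exact: ltrD.
Qed.

Lemma ccont_cexpl t : ccont (cexp ^~ t).
Proof.
split.
  rewrite (_ : _ \o _ = fun x => expR x * cos t); last by apply/funext => x /=; ring.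
  by move=> x; apply: cvgM; [exact: continuous_expR|exact: cvg_cst].
rewrite (_ : _ \o _ = fun x => expR x * sin t); last by apply/funext => x /=; ring.
by move=> x; apply: cvgM; [exact: continuous_expR|exact: cvg_cst].
Qed.

Lemma ccont_cexpr x : ccont (cexp x).
Proof. exact: (ccontM (ccont_cst _) ccont_cis). Qed.

End ComplexExponential.

(** * Integrals over circles *)

Section CircleMean.
Context {R : realType}.
Implicit Types (h q : R[i] -> R[i]) (r : R) (z : R[i]).

(** An integral in the angle, that is, of [q(z) dz / (i z)]; it becomes the integral of [G dz] on a
    vertical segment once [z] is written as an exponential. *)
Definition circ q r : R[i] := cint (- pi) pi (fun t => q (r%:C * cis t)).

Let pi2 : - pi <= pi :> R.
Proof. by rewrite ge0_cp// pi_ge0. Qed.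

(** In logarithmic coordinates the annulus is a rectangle whose horizontal sides, at angles [- pi]
    and [pi], cancel by periodicity; Goursat's lemma then equates the vertical sides. *)
Lemma circ_annulus q r1 r2 : 0 < r1 -> r1 <= r2 ->
  (forall z, z != 0 -> cctn q z) ->
  (forall z, r1 <= normc z <= r2 -> cdiff q z) ->
  circ q r1 = circ q r2.
Proof.
move=> r10 r12 cq dq; have r20 : 0 < r2 by exact: lt_le_trans r12.
pose G x t := q (cexp x t).
have cx t : ccont (G ^~ t).
  by apply: (cctn_ccont (ccont_cexpl t)) => x; apply: cq; exact: cexp_neq0.
have ct x : ccont (G x).
  by apply: (cctn_ccont (ccont_cexpr x)) => t; apply: cq; exact: cexp_neq0.
have l12 : ln r1 <= ln r2 by rewrite ler_ln.
have dG x t : ln r1 <= x <= ln r2 -> - pi <= t <= pi -> rdiff G x t.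
  move=> /andP[x1 x2] _; apply: cdiff_cexp; apply: dq; rewrite normc_cexp.
  have e1 : expR (ln r1) = r1 by rewrite lnK.
  have e2 : expR (ln r2) = r2 by rewrite lnK.
  by rewrite -e1 -e2 !ler_expR x1.
have := goursat cx ct l12 pi2 dG; rewrite /bdint.
rewrite (_ : G ^~ (- pi) = G ^~ pi); last first.
  by apply/funext => x; rewrite /G /cexp cis_pi cis_Npi.
rewrite subrr add0r => /eqP; rewrite mulf_eq0 => /orP[/eqP[] /eqP|].
  by rewrite oner_eq0.
by rewrite subr_eq0 /G /cexp !lnK// => /eqP.
Qed.

End CircleMean.

(** * Cauchy's formula and Taylor expansion *)

Section CauchyTaylor.
Context {R : realType}.
Implicit Types (h q : R[i] -> R[i]) (r : R) (z : R[i]).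

Let pi2 : - pi <= pi :> R.
Proof. by rewrite ge0_cp// pi_ge0. Qed.

Let I0 : (0 +i* 1 : R[i]) != 0.
Proof. by rewrite eq_complex/= oner_eq0 andbF. Qed.

(** In the strip of angles between [- pi] and [pi], a singular point on the positive axis is met at
    angle 0 only. *)
Lemma cis_real_pos t (c : R) : cis t = c%:C -> 0 < c -> `|t| <= pi -> t = 0.
Proof.
move=> [ct st] c0 tpi.
have key u : 0 < u <= pi -> sin u = 0 -> cos u = c -> False.
  move=> /andP[u0]; rewrite le_eqVlt => /predU1P[->|upi] su cu.
    by move: cu c0; rewrite cospi => <-; rewrite ltrNr oppr0 ltr10.
  by have := @sin_gt0_pi _ u; rewrite u0 upi su ltxx => /(_ isT).
have [t0|t0|//] := ltgtP t 0; exfalso.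
  apply: (key (- t)); rewrite ?sinN ?cosN ?st ?oppr0//.
  by rewrite oppr_gt0 t0/=; move: tpi; rewrite ltr0_norm.
by apply: (key t); rewrite ?t0//=; move: tpi; rewrite gtr0_norm.
Qed.

(* In the coordinates [z = e^(s + i t)] the circles bound a rectangle. The part
   of it away from the singular point contributes nothing, and [q] is bounded on
   the remaining square of side [2 eta]. *)
Lemma circ_singular q r0 r1 r2 : 0 < r1 -> r1 < r0 -> r0 < r2 ->
  (forall z, cctn q z) -> (forall z, z != r0%:C -> cdiff q z) ->
  circ q r1 = circ q r2.
Proof.
move=> r10 r1r0 r0r2 cq dq; have r00 : 0 < r0 by exact: lt_trans r1r0.
pose s0 := ln r0; pose G x t := q (cexp x t).
have es0 : expR s0 = r0 by rewrite lnK.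
have r20 : 0 < r2 by exact: lt_trans r0r2.
have l10 : ln r1 < s0 by rewrite ltr_ln.
have l02 : s0 < ln r2 by rewrite ltr_ln.
have cx t : ccont (G ^~ t) by apply: (cctn_ccont (ccont_cexpl t)).
have ct x : ccont (G x) by apply: (cctn_ccont (ccont_cexpr x)).
pose M := 1 + normc (q r0%:C).
have M0 : 0 < M by rewrite ltr_wpDr ?normc_ge0.
have [d d0 Hd] := cq r0%:C _ ltr01.
have [d1 d10 H1] := cexp_lin0 (ltr01 : 0 < (1 : R)).
apply/eqP; rewrite eq_sym -subr_eq0 -normc_eq0; apply/eqP/le_anti; rewrite normc_ge0 andbT.
apply/ler_addgt0Pl => e e0; rewrite addr0.
(* In turn: the square stays between the two circles; the expansion of [cexp] is valid on it; its
   image is within [d] of [r0], where [q] is bounded by [M]; its boundary integral, at most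
   [16 * M * eta], is at most [e]; it fits in the strip of angles. *)
pose eta := Num.min (Num.min (s0 - ln r1) (ln r2 - s0))
  (Num.min (Num.min (d1 / 2) (d / (5 * r0))) (Num.min (e / (16 * M)) pi)).
have eta0 : 0 < eta.
  rewrite !lt_min !subr_gt0 l10 l02/=.
  by rewrite !divr_gt0 ?mulr_gt0 ?pi_gt0.
have : eta <= eta by []; rewrite {2}/eta !le_min.
move=> /andP[/andP[eta1 eta2] /andP[/andP[eta3 eta4] /andP[eta5 eta6]]].
have e1 : expR (ln r1) = r1 by rewrite lnK.
have e2 : expR (ln r2) = r2 by rewrite lnK.
have -> : circ q r1 = cint (- pi) pi (G (s0 - eta)).
  rewrite -[RHS]/(circ q (expR (s0 - eta))); apply: circ_annulus => //.
    by rewrite -[leLHS]e1 ler_expR; lra.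
  move=> z /andP[_ zl]; apply: dq; apply: contraTneq zl => ->.
  by rewrite normcR gtr0_norm// -ltNge -es0 ltr_expR ltrBlDr ltrDl.
have -> : circ q r2 = cint (- pi) pi (G (s0 + eta)).
  rewrite -[RHS]/(circ q (expR (s0 + eta))); apply/esym/circ_annulus => //.
  - exact: expR_gt0.
  - by rewrite -[leRHS]e2 ler_expR; lra.
  move=> z /andP[zl _]; apply: dq; apply: contraTneq zl => ->.
  by rewrite normcR gtr0_norm// -ltNge -es0 ltr_expR ltrDl.
have x12 : s0 - eta <= s0 + eta by lra.
have t1 : - pi <= - eta by lra.
have t2 : - eta <= eta by lra.
have t3 : - eta <= pi by lra.
(* Away from angle 0 the singular point is avoided, so only the small square contributes. *)
have edge u1 u2 : u1 <= u2 -> - pi <= u1 -> u2 <= pi -> (u2 < 0 \/ 0 < u1) ->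
    bdint G (s0 - eta) (s0 + eta) u1 u2 = 0.
  move=> u12 u1pi u2pi u0; apply: goursat => // x t _ /andP[ut tu].
  apply: cdiff_cexp; apply: dq; apply/eqP => /(congr1 (fun z => ((expR x)^-1)%:C * z)).
  rewrite /cexp mulrA -!rmorphM/= mulVf ?gt_eqF ?expR_gt0// mul1r => /cis_real_pos t0.
  have tz : t = 0.
    apply: t0; first by rewrite mulr_gt0// invr_gt0 expR_gt0.
    by rewrite ler_norml; apply/andP; split; lra.
  by move: ut tu; rewrite tz => ? ?; case: u0 => ?; lra.
have : bdint G (s0 - eta) (s0 + eta) (- pi) pi = bdint G (s0 - eta) (s0 + eta) (- eta) eta.
  rewrite (bdint_catt ct x12 t1 t3) (bdint_catt ct x12 t2 eta6).
  have -> : bdint G (s0 - eta) (s0 + eta) (- pi) (- eta) = 0.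
    by apply: edge => //; left; rewrite oppr_lt0.
  have -> : bdint G (s0 - eta) (s0 + eta) eta pi = 0.
    by apply: edge => //; [lra|right].
  by rewrite add0r addr0.
rewrite {1}/bdint (_ : G ^~ (- pi) = G ^~ pi); last first.
  by apply/funext => x; rewrite /G /cexp cis_pi cis_Npi.
rewrite subrr add0r => /(congr1 normc).
rewrite Normc.normcM (_ : normc (0 +i* 1) = 1) ?mul1r; last exact: normci.
move=> ->.
have GM x t : s0 - eta <= x <= s0 + eta -> - eta <= t <= eta -> normc (G x t) <= M.
  move=> xx tt; rewrite /G /M.
  have hx : `|x - s0| <= eta by rewrite ler_norml; move: xx => /andP[? ?]; apply/andP; split; lra.
  have ht : `|t| <= eta by rewrite ler_norml.
  have dl : normc (cexp x t - r0%:C) < d.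
    have -> : cexp x t = r0%:C * cexp (x - s0) t.
      by rewrite -es0 /cexp mulrA -rmorphM -expRD subrKC.
    rewrite -[X in _ - X]mulr1 -mulrBr Normc.normcM normcR gtr0_norm//.
    rewrite -[_ - 1](subrK ((x - s0) +i* t)).
    have n1 : normc (cexp (x - s0) t - 1 - ((x - s0) +i* t)) <= eta + eta.
      apply: le_trans (H1 _ _ _ _) _; rewrite ?mul1r ?lerD//.
        by apply: le_lt_trans hx _; lra.
      by apply: le_lt_trans ht _; lra.
    have n2 : normc ((x - s0) +i* t) <= eta + eta.
      by apply: le_trans (normc_le_ReIm _) _; rewrite lerD.
    apply: (@le_lt_trans _ _ (r0 * (eta + eta + (eta + eta)))).
      by rewrite ler_pM2l//; apply: le_trans (le_normcD _ _) _; rewrite lerD.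
    move: eta4; rewrite ler_pdivlMr ?mulr_gt0//.
    have : 0 < eta * r0 by rewrite mulr_gt0.
    by move=> ? ?; lra.
  have := Hd _ dl => /ltW h1.
  by rewrite -[q _](subrK (q r0%:C)); apply: le_trans (le_normcD _ _) _; rewrite lerD2r.
have x12' : s0 - eta <= s0 + eta <= s0 + eta by rewrite x12 lexx.
have x11' : s0 - eta <= s0 - eta <= s0 + eta by rewrite x12 lexx.
have t12' : - eta <= eta <= eta by rewrite t2 lexx.
have t11' : - eta <= - eta <= eta by rewrite t2 lexx.
have w1 : s0 + eta - (s0 - eta) = 2 * eta by ring.
have w2 : eta - - eta = 2 * eta by ring.
have b1 : normc (cint (s0 - eta) (s0 + eta) (G^~ (- eta)) - cint (s0 - eta) (s0 + eta) (G^~ eta)) <= 8 * M * eta.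
  apply: le_trans (normc_triB _ _) _.
  rewrite (_ : 8 * M * eta = 2 * M * (2 * eta) + 2 * M * (2 * eta)); last by ring.
  by apply: lerD; rewrite -w1; apply: normc_cint_le => // x hx; apply: GM.
have b2 : normc (cint (- eta) eta (G (s0 + eta)) - cint (- eta) eta (G (s0 - eta))) <= 8 * M * eta.
  apply: le_trans (normc_triB _ _) _.
  rewrite (_ : 8 * M * eta = 2 * M * (2 * eta) + 2 * M * (2 * eta)); last by ring.
  by apply: lerD; rewrite -w2; apply: normc_cint_le => // x hx; apply: GM.
apply: le_trans (le_normcD _ _) _.
rewrite Normc.normcM (_ : normc (0 +i* 1) = 1) ?mul1r; last exact: normci.
apply: le_trans (lerD b1 b2) _.
by move: eta5; rewrite ler_pdivlMr ?mulr_gt0// => ?; lra.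
Qed.

Lemma realc_neq0 r : 0 < r -> r%:C != 0 :> R[i].
Proof. by move=> r0; rewrite eq_complex/= eqxx andbT gt_eqF. Qed.

(* Locked because [ring] and [field] unfold [pi]. *)
Definition twopi : R[i] := locked (pi + pi)%:C.

Lemma twopiE : twopi = (pi + pi)%:C.
Proof. by rewrite /twopi -lock. Qed.

Lemma twopi_neq0 : twopi != 0.
Proof. by rewrite twopiE; apply: realc_neq0; rewrite addr_gt0// pi_gt0. Qed.

(** The radius can shrink without changing the integral, across the exceptional circle if [r > r0];
    continuity at 0 identifies the limit. *)
Lemma circ_mean q r0 r : (forall z, cctn q z) -> (forall z, z != r0%:C -> cdiff q z) ->
  0 < r -> 0 < r0 -> r != r0 -> circ q r = twopi * q 0.
Proof.
move=> cq dq r0' r00 rr0.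
have small s : 0 < s -> s < r -> s < r0 -> circ q s = circ q r.
  move=> s0 sr sr0; have [rr|rr|/eqP rr] := ltgtP r r0; last by rewrite (negPf rr0) in rr.
    apply: circ_annulus => //; first exact: ltW.
    move=> z /andP[_ zr]; apply: dq; apply: contraTneq zr => ->.
    by rewrite normcR gtr0_norm// -ltNge.
  exact: (circ_singular s0 sr0 rr).
apply/eqP; rewrite -subr_eq0 -normc_eq0; apply/eqP/le_anti; rewrite normc_ge0 andbT.
apply/ler_addgt0Pl => e e0; rewrite addr0.
have pp : 0 < pi :> R by exact: pi_gt0.
have e4 : 0 < e / (4 * pi) by rewrite divr_gt0// mulr_gt0.
have [d d0 Hd] := cq 0 _ e4.
pose s := Num.min (d / 2) (Num.min (r / 2) (r0 / 2)).
have s0 : 0 < s by rewrite !lt_min !divr_gt0.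
have : s <= s by []; rewrite {2}/s !le_min => /andP[s1 /andP[s2 s3]].
have sd : s < d by lra.
have sr : s < r by lra.
have sr0 : s < r0 by lra.
rewrite -(small s)//.
have cc : ccont (fun t => q (s%:C * cis t)).
  by apply: (@cctn_ccont _ q) => //; apply: ccontM; [exact: ccont_cst|exact: ccont_cis].
have -> : twopi * q 0 = cint (- pi) pi (fun=> q 0).
  by rewrite cint_cst// opprK -twopiE.
rewrite -cintB//; last exact: ccont_cst.
rewrite (_ : e = 2 * (e / (4 * pi)) * (pi - - pi)); last first.
  by move: (pi : R) pp => p p0; field; rewrite gt_eqF.
apply: normc_cint_le => //; first by apply: ccontB => //; exact: ccont_cst.
move=> t _; apply/ltW/Hd; rewrite subr0 Normc.normcM normc_cis mulr1 normcR gtr0_norm//.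
Qed.

Definition entire h := forall z, cdiff h z.

Lemma entire_cctn h : entire h -> forall z, cctn h z.
Proof. by move=> eh z; apply: cdiff_cctn. Qed.

(** The [k]-th Taylor coefficient at 0, given by Cauchy's formula on the unit circle instead of by
    iterated derivatives. *)
Definition coef h k : R[i] :=
  twopi^-1 * cint (- pi) pi (fun t => h (cis t) / cis t ^+ k).

Lemma ccont_circle h r k : (forall z, cctn h z) -> ccont (fun t => h (r%:C * cis t) / cis t ^+ k).
Proof.
move=> ch; apply: ccontM.
  by apply: (@cctn_ccont _ h) => //; apply: ccontM; [exact: ccont_cst|exact: ccont_cis].
rewrite (_ : (fun _ => _) = (fun t => (cis (- t)) ^+ k)).
  apply: ccontX; split => t /=.
    by apply: (@continuous_comp _ _ _ (@GRing.opp R) cos); [exact: opp_continuous|exact: continuous_cos].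
  by apply: (@continuous_comp _ _ _ (@GRing.opp R) sin); [exact: opp_continuous|exact: continuous_sin].
apply/funext => t; rewrite -exprVn; congr (_ ^+ _).
by rewrite -cisJ /cis cosN sinN.
Qed.

(** [h z / z ^+ k] is holomorphic off 0, so its integral over the circle of radius [r] is the one
    over the unit circle. *)
Lemma coef_circle h k r : entire h -> 0 < r ->
  cint (- pi) pi (fun t => h (r%:C * cis t) / cis t ^+ k) = twopi * (coef h k * r%:C ^+ k).
Proof.
move=> eh r0; pose q z := h z / z ^+ k.
have ch := entire_cctn eh.
have dq z : z != 0 -> cdiff q z.
  move=> z0; apply: cdiffM => //.
  apply: (@cdiff_comp _ (fun w => w^-1) (fun w => w ^+ k)).
    by apply: cdiffX; exact: cdiff_id.
  by apply: cdiff_inv; rewrite expf_neq0.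
have eqc1 : circ q r = circ q 1.
  have key a b : 0 < a -> a <= b -> circ q a = circ q b.
    move=> a0 ab; apply: circ_annulus => //.
      by move=> z z0; apply: cdiff_cctn; exact: dq.
    move=> z /andP[az _]; apply: dq; rewrite -normc_gt0; exact: lt_le_trans az.
  by case: (leP r 1) => [|/ltW] rr; [exact: key|exact/esym/key].
have rk : r%:C ^+ k != 0 :> R[i] by apply: expf_neq0; exact: realc_neq0.
have E1 : circ q r = (r%:C ^+ k)^-1 * cint (- pi) pi (fun t => h (r%:C * cis t) / cis t ^+ k).
  rewrite -cintZ; last exact: ccont_circle.
  congr cint; apply/funext => t; by rewrite /q exprMn invfM mulrCA.
have E2 : circ q 1 = cint (- pi) pi (fun t => h (cis t) / cis t ^+ k).
  by rewrite /circ; congr cint; apply/funext => t; rewrite mul1r.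
move: eqc1; rewrite E1 E2 /coef; move: (cint _ _ _) (cint _ _ _) (r%:C ^+ k) rk => a b c c0 <-.
by rewrite -mulrA (mulVKf twopi_neq0) mulrAC (mulVf c0) mul1r.
Qed.

Lemma coef0 h : entire h -> coef h 0 = h 0.
Proof.
move=> eh; rewrite /coef.
(* An entire function has no exceptional point: [2] is an arbitrary radius other than 1. *)
have := @circ_mean h 2 1 (entire_cctn eh) (fun z _ => eh z) ltr01.
rewrite ltr0n lt_eqF ?ltr1n// => /(_ isT isT) H.
rewrite (_ : (fun t => _) = (fun t => h (1%:C * cis t))); last first.
  by apply/funext => t; rewrite expr0 divr1 mul1r.
rewrite -[cint _ _ _]/(circ h 1) H; move: (h 0) => y; exact: (mulKf twopi_neq0).
Qed.

(** For a constant the integral in [coef_circle] does not depend on [r], whereas the right-hand side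
    scales by [2 ^+ k.+1] from [r = 1] to [r = 2]. *)
Lemma coef_cst c k : coef (fun=> c) k.+1 = 0.
Proof.
have e : entire (fun=> c) by move=> z; exact: cdiff_cst.
have := coef_circle k.+1 e (ltr0n _ 2 : 0 < 2%:R :> R).
have := coef_circle k.+1 e (ltr01 : 0 < 1 :> R).
move=> -> /(mulfI twopi_neq0)/eqP; rewrite eq_sym -subr_eq0 -mulrBr mulf_eq0 => /orP[/eqP//|].
rewrite subr_eq0 => /eqP/(congr1 normc); rewrite !normcX !normcR => /eqP.
have k2 : (1 : R) < 2%:R ^+ k.+1 by rewrite exprn_egt1// ltr1n.
by rewrite normr1 expr1n ger0_norm ?ler0n// (gt_eqF k2).
Qed.

Lemma coefB h g k : (forall z, cctn h z) -> (forall z, cctn g z) ->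
  coef (fun z => h z - g z) k = coef h k - coef g k.
Proof.
move=> ch cg; rewrite /coef -mulrBr -cintB; first last.
- by have := @ccont_circle g 1 k cg; congr ccont; apply/funext => t; rewrite mul1r.
- by have := @ccont_circle h 1 k ch; congr ccont; apply/funext => t; rewrite mul1r.
by congr (_ * cint _ _ _); apply/funext => t; rewrite mulrBl.
Qed.

(* The mean over [|z| = 2 r] of the difference quotient [q] of [h] at [r] is
   [q 0]; there [1 / (z - r)] is expanded in powers of [r / z]. *)
Lemma taylor_pos h r : entire h -> 0 < r -> exists B : R, forall N : nat,
  normc (h r%:C - \sum_(k < N.+1) coef h k * r%:C ^+ k) <= B / 2 ^+ N.
Proof.
move=> eh r0; set c := h r%:C.
have [d Hd] := eh r%:C.
pose q z := if z == r%:C then d else (h z - c) / (z - r%:C).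
have dq z : z != r%:C -> cdiff q z.
  move=> zr; have n0 : 0 < normc (z - r%:C) by rewrite normc_gt0 subr_eq0.
  apply: (@cdiff_local _ (fun w => (h w - c) * (w - r%:C)^-1) _ _ _ n0).
    move=> w wz; rewrite /q ifF//; apply/eqP => wr.
    by move: wz; rewrite wr normcB ltxx.
  apply: cdiffM; first by apply: cdiffD; [exact: eh|exact: cdiff_cst].
  apply: (@cdiff_comp _ (fun w => w^-1) (fun w => w - r%:C)).
    by apply: cdiffD; [exact: cdiff_id|exact: cdiff_cst].
  by apply: cdiff_inv; rewrite subr_eq0.
have cq z : cctn q z.
  have [->|/dq/cdiff_cctn//] := eqVneq z r%:C.
  move=> e e0; have e2 : 0 < e / 2 by rewrite divr_gt0.
  have [dl dl0 H] := Hd _ e2; exists dl => // w wd.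
  rewrite /q eqxx; case: eqVneq => [_|wr]; first by rewrite subrr Normc.normc0.
  have wr0 : w - r%:C != 0 by rewrite subr_eq0.
  rewrite (_ : _ - d = (h w - h r%:C - d * (w - r%:C)) / (w - r%:C)); last by rewrite /c; field.
  rewrite Normc.normcM normc_inv; apply: (@le_lt_trans _ _ (e / 2)).
    by rewrite ler_pdivrMr ?normc_gt0// H.
  by rewrite ltr_pdivrMr// mulr_natr mulr2n ltrDl.
(* With this radius [r / z] has modulus 1/2 on the circle, whence the rate [2 ^- N]. *)
pose rho := r + r; have rho0 : 0 < rho by rewrite addr_gt0.
have rhor : rho != r by rewrite gt_eqF// ltrDl.
have mean := circ_mean cq dq rho0 r0 rhor.
have rC0 : r%:C != 0 :> R[i] by exact: realc_neq0.
have q0 : q 0 = (c - h 0) / r%:C.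
  by rewrite /q eq_sym (negPf rC0) sub0r invrN mulrN -mulNr opprB.
pose z t := rho%:C * cis t.
have z0 t : z t != 0.
  by rewrite -normc_gt0 Normc.normcM normc_cis mulr1 normcR normr_gt0 gt_eqF.
have nz t : normc (z t) = rho by rewrite Normc.normcM normc_cis mulr1 normcR gtr0_norm//.
have zr t : z t != r%:C.
  by apply/eqP => /(congr1 normc)/eqP; rewrite nz normcR gtr0_norm// (negPf rhor).
(* The finite geometric expansion of [1 / (z - r)]: the remainder is again a multiple of [q], which
   is bounded on the circle. *)
have qE N t : q (z t) = \sum_(k < N) (r%:C ^+ k / rho%:C ^+ k.+1) * ((h (z t) - c) / cis t ^+ k.+1)
    + (r%:C / z t) ^+ N * q (z t).
  elim: N => [|N IH]; first by rewrite big_ord0 add0r expr0 mul1r.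
  rewrite {1}IH big_ord_recr/= -addrA; congr (_ + _).
  have zrt : z t - r%:C != 0 by rewrite subr_eq0.
  have zz : rho%:C * cis t = z t by [].
  rewrite mulrACA -invfM -exprMn zz /q (negPf (zr t)) !exprSr expr_div_n invfM.
  have zN : z t ^+ N != 0 by rewrite expf_neq0.
  by field; rewrite zN zrt z0.
have cqz : ccont (fun t => q (z t)).
  by apply: (@cctn_ccont _ q) => //; apply: ccontM; [exact: ccont_cst|exact: ccont_cis].
have eh' : entire (fun w => h w - c).
  by move=> w; apply: cdiffD; [exact: eh|exact: cdiff_cst].
have [M HM] : exists M, forall t, - pi <= t <= pi -> normc (q (z t)) <= M.
  have cn := ccont_normc cqz.
  have [t0 _ Ht0] := @EVT_max R (normc \o (q \o z)) (- pi) pi pi2 (continuous_subspaceT cn).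
  by exists (normc (q (z t0))) => t tt; apply: Ht0; rewrite in_itv.
have crest N : ccont (fun t => (r%:C / z t) ^+ N * q (z t)).
  apply: ccontM => //; apply: ccontX; apply: ccontM; first exact: ccont_cst.
  have := @ccont_circle (fun=> (rho%:C)^-1) 1 1 (fun z => cdiff_cctn (cdiff_cst _ z)).
  by congr ccont; apply/funext => t; rewrite expr1 -invfM.
exists (r * (2 * M * (pi - - pi)) / (pi + pi)) => N.
have csum k : ccont (fun t => (r%:C ^+ k / rho%:C ^+ k.+1) * ((h (z t) - c) / cis t ^+ k.+1)).
  by apply: ccontM; [exact: ccont_cst|exact: (ccont_circle rho k.+1 (entire_cctn eh'))].
have mE : twopi * q 0 = twopi * (\sum_(k < N) coef h k.+1 * r%:C ^+ k) +
   cint (- pi) pi (fun t => (r%:C / z t) ^+ N * q (z t)).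
  rewrite -mean /circ (_ : (fun t => q _) = (fun t => \sum_(k < N)
    (r%:C ^+ k / rho%:C ^+ k.+1) * ((h (z t) - c) / cis t ^+ k.+1)
    + (r%:C / z t) ^+ N * q (z t))); last by apply/funext => t; exact: qE.
  rewrite cintD//; last by apply: ccont_sum => k; exact: csum.
  congr (_ + _); rewrite cint_sum; last by move=> k; exact: csum.
  rewrite mulr_sumr; apply: eq_bigr => k _; rewrite cintZ; last first.
    exact: (ccont_circle rho k.+1 (entire_cctn eh')).
  rewrite (coef_circle k.+1 eh' rho0) coefB; first last.
  - by move=> w; apply: cdiff_cctn; exact: cdiff_cst.
  - exact: entire_cctn.
  rewrite coef_cst subr0.
  have : rho%:C ^+ k.+1 != 0 :> R[i] by apply: expf_neq0; exact: realc_neq0.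
  by move: (rho%:C ^+ k.+1) => y y0; field.
have restM : normc (cint (- pi) pi (fun t => (r%:C / z t) ^+ N * q (z t))) <=
    2 * (M / 2 ^+ N) * (pi - - pi).
  apply: normc_cint_le => // t tt; rewrite Normc.normcM normcX Normc.normcM normc_inv nz normcR gtr0_norm//.
  rewrite (_ : r / rho = 2^-1); last by rewrite /rho; field; rewrite gt_eqF// addr_gt0.
  by rewrite exprVn mulrC ler_pM2r ?invr_gt0 ?exprn_gt0// HM.
have -> : c - \sum_(k < N.+1) coef h k * r%:C ^+ k =
   r%:C / twopi * cint (- pi) pi (fun t => (r%:C / z t) ^+ N * q (z t)).
  have -> : cint (- pi) pi (fun t => (r%:C / z t) ^+ N * q (z t)) =
    twopi * q 0 - twopi * (\sum_(k < N) coef h k.+1 * r%:C ^+ k).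
    by rewrite mE addrC addKr.
  rewrite big_ord_recl/= coef0// expr0 mulr1 q0.
  under eq_bigr do rewrite /bump/= add1n exprS mulrCA.
  rewrite -mulr_sumr.
  have alg (a b S p y : R[i]) : y != 0 -> p != 0 ->
      b - (a + y * S) = y / p * (p * ((b - a) / y) - p * S).
    by move=> y0 p0; field; rewrite y0 p0.
  exact: (alg _ _ _ _ _ rC0 twopi_neq0).
rewrite Normc.normcM Normc.normcM normc_inv twopiE !normcR.
have pp : 0 < pi + pi :> R by apply: addr_gt0; exact: pi_gt0.
rewrite (gtr0_norm r0) (gtr0_norm pp).
have rp : 0 <= r / (pi + pi) by apply: divr_ge0; [exact: ltW|apply: addr_ge0; exact: pi_ge0].
apply: le_trans (ler_wpM2l rp restM) _.
by rewrite le_eqVlt; apply/orP; left; apply/eqP; ring.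
Qed.

End CauchyTaylor.

(** * Taylor expansion at an arbitrary complex point *)

Section Translation.
Context {R : realType}.
Implicit Types (f : R -> R) (a b c : R).

Lemma Rintegral_translate f a b c : continuous f -> a <= b ->
  (\int[lebesgue_measure]_(x in `[a, b]) f (x + c) =
   \int[lebesgue_measure]_(x in `[(a + c), (b + c)]) f x)%R.
Proof.
move=> cf ab; pose F (x : R) := x + c.
have dF x : is_derive x (1 : R) F 1.
  by rewrite -[X in is_derive _ _ _ X]addr0; exact: is_deriveD.
have F1 : derive1 F = cst 1.
  by apply/funext => x; rewrite derive1E; exact: derive_val.
rewrite /Rintegral; congr fine.
rewrite -[a + c]/(F a) -[b + c]/(F b) (@integration_by_substitution_increasing _ F f a b) ?F1//.
- by apply: eq_integral => x _ /=; rewrite mulr1.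
- by move=> x y _ _ xy; rewrite /F ltrD2r.
- by move=> x _; exact: cvg_cst.
- exact: is_cvg_cst.
- exact: is_cvg_cst.
- split => [x _| |]; first exact: (@ex_derive _ _ _ _ _ _ _ (dF x)).
  + apply: cvg_at_right_filter; apply: differentiable_continuous.
    by apply/derivable1_diffP; exact: (@ex_derive _ _ _ _ _ _ _ (dF a)).
  + apply: cvg_at_left_filter; apply: differentiable_continuous.
    by apply/derivable1_diffP; exact: (@ex_derive _ _ _ _ _ _ _ (dF b)).
- exact: continuous_subspaceT.
Qed.

Lemma ccont_translate (g : R -> R[i]) c : ccont g -> ccont (fun x => g (x + c)).
Proof.
have key f : continuous f -> continuous (fun x => f (x + c)).
  move=> cf x; apply: (@continuous_comp _ _ _ (fun x => x + c) f); last exact: cf.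
  by apply: cvgD; [exact: cvg_id|exact: cvg_cst].
by move=> [g1 g2]; split; [exact: (key (Re \o g))|exact: (key (Im \o g))].
Qed.

Lemma cint_translate (g : R -> R[i]) a b c : ccont g -> a <= b ->
  cint a b (fun x => g (x + c)) = cint (a + c) (b + c) g.
Proof.
move=> [g1 g2] ab; apply: eqc; rewrite /cint/=.
  by rewrite -(Rintegral_translate c g1 ab).
by rewrite -(Rintegral_translate c g2 ab).
Qed.

Lemma cint_periodic (g : R -> R[i]) c : ccont g -> (forall t, g (t + (pi + pi)) = g t) ->
  0 <= c <= pi + pi -> cint (- pi) pi (fun t => g (t + c)) = cint (- pi) pi g.
Proof.
move=> cg per /andP[c0 c2].
have p1 : - pi <= pi :> R by rewrite ge0_cp// pi_ge0.
have p2 : - pi + c <= pi by move: c2; lra.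
have p3 : - pi <= - pi + c by rewrite lerDl.
have p4 : pi <= pi + c by rewrite lerDl.
rewrite cint_translate// (cint_cat cg p2 p4) (cint_cat cg p3 p2) addrC; congr (_ + _).
have -> : cint pi (pi + c) g = cint (- pi + (pi + pi)) (- pi + c + (pi + pi)) g.
  have alg1 (p : R) : p = - p + (p + p) by ring.
  have alg2 (p : R) : p + c = - p + c + (p + p) by ring.
  by rewrite -alg1 -alg2.
rewrite -cint_translate//; congr (cint _ _ _).
by apply/funext => t; rewrite per.
Qed.

End Translation.

Section ComplexTaylor.
Context {R : realType}.
Implicit Types (h : R[i] -> R[i]) (z : R[i]).

Lemma polar_form z : exists2 t, 0 <= t <= pi + pi & z = (normc z)%:C * cis t.
Proof.
have [->|z0] := eqVneq z 0.
  exists 0; last by rewrite Normc.normc0 mul0r.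
  by rewrite lexx addr_ge0 ?pi_ge0.
have n0 : 0 < normc z by rewrite normc_gt0.
pose x := Re z / normc z.
have x1 : -1 <= x <= 1.
  rewrite -ler_norml normrM normfV (ger0_norm (ltW n0)).
  by rewrite ler_pdivrMr// mul1r normc_geRe.
have sx : 1 - x ^+ 2 = (Im z / normc z) ^+ 2.
  have := sqr_normcE z; rewrite !expr_div_n => H.
  have nn : normc z ^+ 2 != 0 by rewrite expf_neq0// gt_eqF.
  by apply: (mulIf nn); rewrite mulrBl mul1r !divfK// H addrC addKr.
pose t := acos x.
have ct : cos t = x by rewrite acosK// in_itv.
have st : sin t = `|Im z| / normc z.
  rewrite sin_acos// sx sqrtr_sqr normrM normfV (ger0_norm (ltW n0))//.
have t0 : 0 <= t by exact: acos_ge0.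
have tp : t <= pi by exact: acos_lepi.
have [i0|i0] := leP 0 (Im z).
  exists t; first by rewrite t0/= (le_trans tp)// lerDl pi_ge0.
  rewrite /cis ct st ger0_norm//; apply: eqc; rewrite ?(Re_mulc,Im_mulc)/= !mul0r.
    by rewrite subr0 mulrC divfK// gt_eqF.
  by rewrite addr0 mulrC divfK// gt_eqF.
exists (- t + pi + pi).
  have := pi_ge0 R => p0; apply/andP; split; lra.
rewrite cis2pi /cis cosN sinN ct st ltr0_norm//; apply: eqc; rewrite ?(Re_mulc,Im_mulc)/= !mul0r.
  by rewrite subr0 mulrC divfK// gt_eqF.
by rewrite addr0 mulNr opprK mulrC divfK// gt_eqF.
Qed.

Lemma ccont_circleC h z k : (forall w, cctn h w) -> ccont (fun t => h (z * cis t) / cis t ^+ k).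
Proof.
move=> ch; apply: ccontM.
  by apply: (@cctn_ccont _ h) => //; apply: ccontM; [exact: ccont_cst|exact: ccont_cis].
have := @ccont_circle _ (fun=> 1) 1 k (fun z => cdiff_cctn (cdiff_cst _ z)).
by congr ccont; apply/funext => t; rewrite mul1r.
Qed.

(** The argument of [z] shifts the angle of integration. Periodicity absorbs the shift, which leaves
    the factor [cis t0 ^+ k] that turns [normc z] into [z]. *)
Lemma coef_circleC h k z : entire h ->
  cint (- pi) pi (fun t => h (z * cis t) / cis t ^+ k) = twopi * (coef h k * z ^+ k).
Proof.
move=> eh; have [->|z0] := eqVneq z 0.
  have -> : (fun t => h (0 * cis t) / cis t ^+ k) = (fun t => h 0 / cis t ^+ k).
    by apply/funext => t; rewrite mul0r.
  have -> : cint (- pi) pi (fun t => h 0 / cis t ^+ k) = twopi * coef (fun=> h 0) k.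
    by rewrite /coef; move: (cint _ _ _) => c; rewrite (mulVKf twopi_neq0).
  congr (_ * _); case: k => [|k]; last by rewrite coef_cst exprS mul0r mulr0.
  by rewrite expr0 mulr1 !coef0//; move=> w; exact: cdiff_cst.
have [t0 tt zE] := polar_form z.
have n0 : 0 < normc z by rewrite normc_gt0.
pose g t := h ((normc z)%:C * cis t) / cis t ^+ k.
have cg : ccont g by apply: ccont_circleC; exact: entire_cctn.
have -> : (fun t => h (z * cis t) / cis t ^+ k) = (fun t => cis t0 ^+ k * g (t + t0)).
  apply/funext => t; rewrite /g cisD.
  have -> : z * cis t = (normc z)%:C * (cis t * cis t0).
    by rewrite {1}zE -mulrA [cis t0 * _]mulrC.
  rewrite exprMn invfM; have b0 : cis t0 ^+ k != 0 by rewrite expf_neq0// cis_neq0.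
  move: (h _) (cis t ^+ k) (cis t0 ^+ k) b0 => H a b b0.
  by rewrite mulrCA [a^-1 * _]mulrC (mulVKf b0).
rewrite cintZ; last exact: ccont_translate.
have per t : g (t + (pi + pi)) = g t by rewrite /g addrA cis2pi.
rewrite (cint_periodic cg per tt).
have -> : cint (- pi) pi g = twopi * (coef h k * (normc z)%:C ^+ k).
  exact: coef_circle.
have -> : z ^+ k = (normc z)%:C ^+ k * cis t0 ^+ k by rewrite {1}zE exprMn.
move: (cis t0 ^+ k) (_ ^+ k) (coef h k) => a b c.
by rewrite mulrCA; congr (_ * _); rewrite mulrCA; congr (_ * _); rewrite mulrC.
Qed.

(** Rotating the variable moves [z] to the positive axis and multiplies the [k]-th coefficient by
    [cis t0 ^+ k], which reduces the claim to [taylor_pos]. *)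
Lemma taylorC h z : entire h -> exists B : R, forall N : nat,
  normc (h z - \sum_(k < N.+1) coef h k * z ^+ k) <= B / 2 ^+ N.
Proof.
move=> eh; have [->|z0] := eqVneq z 0.
  exists 0 => N; rewrite big_ord_recl/= expr0 mulr1 coef0// big1 ?addr0.
    by rewrite subrr Normc.normc0 mul0r.
  by move=> k _; rewrite exprS mul0r mulr0.
have [t0 tt zE] := polar_form z.
have n0 : 0 < normc z by rewrite normc_gt0.
pose g w := h (cis t0 * w).
have eg : entire g.
  move=> w; apply: (@cdiff_comp _ h (fun w => cis t0 * w)); last exact: eh.
  by apply: cdiffM; [exact: cdiff_cst|exact: cdiff_id].
have [B HB] := taylor_pos eg n0; exists B => N.
have -> : h z = g (normc z)%:C by rewrite /g {1}zE mulrC.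
suff -> : \sum_(k < N.+1) coef h k * z ^+ k =
  \sum_(k < N.+1) coef g k * (normc z)%:C ^+ k by exact: HB.
apply: eq_bigr => k _.
have -> : coef g k = coef h k * cis t0 ^+ k.
  rewrite /coef -[X in _ = X * _]/(coef h k).
  have -> : cint (- pi) pi (fun t => g (cis t) / cis t ^+ k) = twopi * (coef h k * cis t0 ^+ k).
    exact: (coef_circleC k (cis t0) eh).
  by move: (coef h k) (cis t0 ^+ k) => a b; exact: (mulKf twopi_neq0).
have -> : z ^+ k = (normc z)%:C ^+ k * cis t0 ^+ k by rewrite {1}zE exprMn.
by rewrite -mulrA [_ * cis t0 ^+ k]mulrC.
Qed.

End ComplexTaylor.

(** * Measurability and holomorphy in several variables *)

Section Measurability.
Context d {T : measurableType d} {R : realType}.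

Let measurable_countable (I : countType) (q : T -> I) (H : I -> R) :
  (forall i, measurable [set t | q t = i]) -> measurable_fun setT (H \o q).
Proof.
move=> mq _ Y mY; rewrite setTI.
have -> : (H \o q) @^-1` Y = \bigcup_(i in [set i | Y (H i)]) [set t | q t = i].
  apply/seteqP; split => t /=; first by move=> Yt; exists (q t).
  by move=> [i /= Yi ->].
rewrite bigcup_mkcond; apply: countable_bigcupT_measurable; first exact: countableP.
by move=> i; case: ifP.
Qed.

Let round_dist (k : nat) (a : R) :
  `|(Num.floor (k.+1%:R * a))%:~R / k.+1%:R - a| <= k.+1%:R^-1.
Proof.
have k0 : 0 < k.+1%:R :> R by [].
have := ge_floor (k.+1%:R * a); have := floorD1_gt (k.+1%:R * a).
rewrite intrD => h1 h2; rewrite ler_norml; apply/andP; split.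
  rewrite lerBrDr addrC ler_pdivlMr// mulrBl mulVf ?gt_eqF//; lra.
rewrite lerBlDr ler_pdivrMr// mulrDl mulVf ?gt_eqF//; lra.
Qed.

(* [F] is the pointwise limit of its values at the coordinates rounded down to
   multiples of [1 / (k + 1)], which take countably many values. *)
Lemma measurable_of_coords (I : finType) (x : I -> T -> R) (F : (I -> R) -> R) :
  (forall i, measurable_fun setT (x i)) ->
  (forall y e, 0 < e -> exists2 dl, 0 < dl & forall y',
    (forall i, `|y' i - y i| < dl) -> `|F y' - F y| < e) ->
  measurable_fun setT (fun t => F (x ^~ t)).
Proof.
move=> mx cF.
pose q k t := [ffun i => Num.floor (k.+1%:R * x i t)].
pose H k (f : {ffun I -> int}) := F (fun i => (f i)%:~R / k.+1%:R).
apply: (@measurable_fun_cvg _ _ _ setT (fun k t => H k (q k t))).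
  move=> k; apply: measurable_countable => f.
  have -> : [set t | q k t = f] =
    \big[setI/setT]_(i : I) (x i @^-1` `[(f i)%:~R / k.+1%:R, ((f i)%:~R + 1) / k.+1%:R[).
    have fE i t : (x i @^-1` `[(f i)%:~R / k.+1%:R, ((f i)%:~R + 1) / k.+1%:R[) t <->
        Num.floor (k.+1%:R * x i t) = f i.
      rewrite /= in_itv/= ler_pdivrMr// ltr_pdivlMr// [x i t * _]mulrC.
      split; first by move=> h; apply: floor_def; rewrite intrD.
      by move=> <-; rewrite ge_floor/= -intrD1 floorD1_gt.
    apply/seteqP; split => t /=.
      move=> qf; rewrite -bigcap_seq => i _.
      by apply/fE; rewrite -qf ffunE.
    by rewrite -bigcap_seq => h; apply/ffunP => i; rewrite ffunE; apply/fE/h => /=; rewrite mem_index_enum.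
  apply: bigsetI_measurable => i _; rewrite -[X in measurable X]setTI.
  by apply: mx => //; exact: measurable_itv.
move=> t _; apply/cvgrPdist_lt => e e0.
have [dl dl0 Hd] := cF (x ^~ t) e e0.
near=> k; rewrite distrC; apply: Hd => i; rewrite /q ffunE.
apply: le_lt_trans (round_dist _ _) _.
near: k.
have := near_infty_natSinv_lt (PosNum dl0); apply: filterS => k /=.
by [].
Unshelve. all: by end_near. Qed.

End Measurability.

Section VectorFunctions.
Context {R : realType} {n : nat}.
Implicit Types (g : 'cV[R[i]]_n -> R[i]) (z w v : 'cV[R[i]]_n).

Definition vcont g := forall z e, 0 < e -> exists2 dl, 0 < dl &
  forall w, (forall j, normc (w j 0 - z j 0) < dl) -> normc (g w - g z) < e.

Lemma measurable_vcont d (T : measurableType d) (Z : T -> 'cV[R[i]]_n) g :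
  (forall j, measurable_fun setT (fun t => Re (Z t j 0))) ->
  (forall j, measurable_fun setT (fun t => Im (Z t j 0))) -> vcont g ->
  measurable_fun setT (fun t => Re (g (Z t))) /\
  measurable_fun setT (fun t => Im (g (Z t))).
Proof.
move=> mR mI cg.
pose x (i : 'I_n * bool) t := if i.2 then Im (Z t i.1 0) else Re (Z t i.1 0).
pose V (y : 'I_n * bool -> R) : 'cV[R[i]]_n := \col_j (y (j, false) +i* y (j, true)).
have mx i : measurable_fun setT (x i) by case: i => j []; [exact: mI|exact: mR].
have VZ t : V (x ^~ t) = Z t.
  by apply/colP => j; rewrite mxE /x/=; case: (Z t j 0).
have cV y e : 0 < e -> exists2 dl, 0 < dl & forall y',
    (forall i, `|y' i - y i| < dl) -> normc (g (V y') - g (V y)) < e.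
  move=> e0; have [dl dl0 H] := cg (V y) e e0.
  exists (dl / 2); first by rewrite divr_gt0.
  move=> y' yy; apply: H => j; rewrite !mxE.
  apply: le_lt_trans (normc_le_ReIm _) _ => /=; rewrite [dl]splitr.
  by rewrite ltrD.
split.
  have -> : (fun t => Re (g (Z t))) = (fun t => (fun y => Re (g (V y))) (x ^~ t)).
    by apply/funext => t; rewrite VZ.
  apply: (measurable_of_coords (F := fun y => Re (g (V y)))) => // y e e0; have [dl dl0 H] := cV y e e0.
  exists dl => // y' yy; rewrite -Re_oppc -Re_addc.
  by apply: le_lt_trans (normc_geRe _) _; exact: H.
have -> : (fun t => Im (g (Z t))) = (fun t => (fun y => Im (g (V y))) (x ^~ t)).
  by apply/funext => t; rewrite VZ.
apply: (measurable_of_coords (F := fun y => Im (g (V y)))) => // y e e0; have [dl dl0 H] := cV y e e0.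
exists dl => // y' yy; rewrite -Im_oppc -Im_addc.
by apply: le_lt_trans (normc_geIm _) _; exact: H.
Qed.

Lemma vcontM g h : vcont g -> vcont h -> vcont (fun z => g z * h z).
Proof.
move=> cg ch z e e0.
pose A := 1 + normc (h z); pose B := 1 + normc (g z).
have A0 : 0 < A by rewrite ltr_wpDr ?normc_ge0.
have B0 : 0 < B by rewrite ltr_wpDr ?normc_ge0.
have e1 : 0 < e / 2 / A by rewrite !divr_gt0.
have e2 : 0 < e / 2 / B by rewrite !divr_gt0.
have [d1 d10 H1] := cg z _ e1; have [d2 d20 H2] := ch z _ e2.
have [d3 d30 H3] := ch z _ ltr01.
exists (Num.min d1 (Num.min d2 d3)); first by rewrite !lt_min d10 d20.
move=> w wz.
have /H1 h1 j : normc (w j 0 - z j 0) < d1 by have := wz j; rewrite !lt_min => /andP[].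
have /H2 h2 j : normc (w j 0 - z j 0) < d2 by have := wz j; rewrite !lt_min => /and3P[].
have /H3 h3 j : normc (w j 0 - z j 0) < d3 by have := wz j; rewrite !lt_min => /and3P[].
have -> : g w * h w - g z * h z = (g w - g z) * h w + g z * (h w - h z).
  by rewrite mulrBl mulrBr addrA subrK.
apply: le_lt_trans (le_normcD _ _) _; rewrite !Normc.normcM [e]splitr.
have hA : normc (h w) <= A.
  rewrite -[h w](subrK (h z)); apply: le_trans (le_normcD _ _) _.
  by rewrite /A lerD2r ltW.
have gB : normc (g z) <= B by rewrite /B lerDr.
apply: ltr_leD.
  apply: (@le_lt_trans _ _ (normc (g w - g z) * A)); first by rewrite ler_wpM2l ?normc_ge0.
  by rewrite -ltr_pdivlMr.
apply: (@le_trans _ _ (B * normc (h w - h z))); first by rewrite ler_wpM2r ?normc_ge0.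
by rewrite mulrC -ler_pdivlMr// ltW.
Qed.

Lemma vcontD g h : vcont g -> vcont h -> vcont (fun z => g z + h z).
Proof.
move=> cg ch z e e0; have e2 : 0 < e / 2 by rewrite divr_gt0.
have [d1 d10 H1] := cg z _ e2; have [d2 d20 H2] := ch z _ e2.
exists (Num.min d1 d2); first by rewrite !lt_min d10 d20.
move=> w wz.
have /H1 h1 j : normc (w j 0 - z j 0) < d1 by have := wz j; rewrite !lt_min => /andP[].
have /H2 h2 j : normc (w j 0 - z j 0) < d2 by have := wz j; rewrite !lt_min => /andP[].
by rewrite opprD addrACA [e]splitr; apply: le_lt_trans (le_normcD _ _) _; rewrite ltrD.
Qed.

Lemma vcont_cst c : vcont (fun=> c).
Proof. by move=> z e e0; exists 1 => // w _; rewrite subrr Normc.normc0. Qed.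

Lemma vcont_coord j : vcont (fun z => z j 0).
Proof. by move=> z e e0; exists e => // w; apply. Qed.

Lemma vcont_comp (h : R[i] -> R[i]) g : (forall a, cctn h a) -> vcont g -> vcont (h \o g).
Proof.
move=> ch cg z e e0; have [d1 d10 H1] := ch (g z) e e0.
have [d2 d20 H2] := cg z _ d10; exists d2 => // w wz; exact/H1/H2.
Qed.

Lemma vcontJ g : vcont g -> vcont (fun z => conj (g z)).
Proof.
move=> cg z e e0; have [d d0 H] := cg z e e0; exists d => // w /H.
by rewrite -conjB normc_conjc.
Qed.

Lemma vcont_sum (I : Type) (s : seq I) (F : I -> 'cV[R[i]]_n -> R[i]) :
  (forall i, vcont (F i)) -> vcont (fun z => \sum_(i <- s) F i z).
Proof.
move=> cF; elim: s => [|i s IH].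
  have -> : (fun z => \sum_(i <- [::]) F i z) = (fun=> 0).
    by apply/funext => z; rewrite big_nil.
  exact: vcont_cst.
have -> : (fun z => \sum_(i <- i :: s) F i z) = (fun z => F i z + \sum_(i <- s) F i z).
  by apply/funext => z; rewrite big_cons.
exact: vcontD.
Qed.

Lemma vcontX g k : vcont g -> vcont (fun z => g z ^+ k).
Proof.
move=> cg; elim: k => [|k IH].
  have -> : (fun z => g z ^+ 0) = (fun=> 1) by [].
  exact: vcont_cst.
have -> : (fun z => g z ^+ k.+1) = (fun z => g z * g z ^+ k).
  by apply/funext => z; rewrite exprS.
exact: vcontM.
Qed.

Lemma vcont_norm g : vcont g -> vcont (fun z => (normc (g z))%:C).
Proof.
move=> cg z e e0; have [d d0 H] := cg z e e0; exists d => // w /H h.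
by rewrite -rmorphB normcR; apply: le_lt_trans (normc_dist _ _) _.
Qed.

(** The two consequences of holomorphy on which the averages rest: continuity, and one-variable
    holomorphy on every complex line. Both pass at once to a composition with a continuous linear
    map. *)
Definition lhol g := vcont g /\ forall z v, entire (fun a => g (z + a *: v)).

Lemma holomorphic_lhol g : holomorphic g -> lhol g.
Proof.
move=> hg; split.
  move=> z e e0; have /differentiable_continuous/cvgrPdist_lt := hg z.
  have e0' : 0 < e%:C :> R[i] by rewrite ltcR.
  move=> /(_ _ e0') /nbhs_ballP[r /= r0 Hr].
  exists (Re r); first by move: r0; rewrite ltcE => /andP[].
  move=> w wz.
  have rE : r = (Re r)%:C by move: r0; rewrite ltcE => /andP[/eqP + _]; case: (r) => a b /= ->.
  have ball_zw : ball (z : ('cV[R[i]]_n : normedModType R[i])) r w.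
    split=> // j k; rewrite [k]ord1 /ball/= rE.
    by rewrite -[X in X < _]/((normc (z j 0 - w j 0))%:C) ltcR normcB.
  have := Hr w ball_zw; rewrite /= -[X in X < _]/((normc (g z - g w))%:C) ltcR.
  by rewrite normcB.
move=> z v a; pose x := z + a *: v.
have /diff_derivable - /(_ v) /cvg_ex[l Hl] := hg x.
exists l => e e0; have e0' : 0 < e%:C :> R[i] by rewrite ltcR.
move: Hl => /cvgrPdist_le /(_ _ e0') /nbhs_ballP[r /= r0 Hr].
exists (Re r); first by move: r0; rewrite ltcE => /andP[].
move=> b bz; have [->|ba] := eqVneq b a.
  by rewrite !subrr mulr0 subrr Normc.normc0 mulr0.
have rE : r = (Re r)%:C by move: r0; rewrite ltcE => /andP[/eqP + _]; case: (r) => ? ? /= ->.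
have ba0 : b - a != 0 by rewrite subr_eq0.
have := Hr (b - a); rewrite /ball/= sub0r normrN rE.
rewrite -[X in X < _]/((normc (b - a))%:C) ltcR => /(_ bz ba0).
have -> : (b - a) *: v + x = z + b *: v.
  by rewrite /x addrCA -scalerDl subrK.
rewrite -[X in X <= _]/((normc (l - (b - a)^-1 * (g (z + b *: v) - g x)))%:C) lecR => H.
have -> : g (z + b *: v) - g x - l * (b - a) = - (l - (b - a)^-1 * (g (z + b *: v) - g x)) * (b - a).
  rewrite mulNr mulrBl opprB; congr (_ - _).
  by rewrite mulrAC mulVf// mul1r.
by rewrite Normc.normcM normcN ler_wpM2r ?normc_ge0.
Qed.

Lemma holomorphic_comp_cdot (F : R[i] -> R[i]) (p : 'cV[R[i]]_n) :
  entire F -> holomorphic (fun z => F (cdot z p)).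
Proof.
move=> eF z.
pose L (z : ('cV[R[i]]_n : normedModType R[i])) : R[i]^o := cdot z p.
have dL : differentiable L z.
  have -> : L = \sum_(j < n) ((p j 0)^* *:
      ((fun z => z j 0) : ('cV[R[i]]_n : normedModType R[i]) -> R[i]^o)).
    by apply/funext => w; rewrite fct_sumE; apply: eq_bigr => j _; rewrite mulrC.
  apply: differentiable_sum => j.
  by apply: differentiableZ; exact: differentiable_coord.
apply: (@differentiable_comp _ _ _ _ L (F : R[i]^o -> R[i]^o)) => //.
exact/cdiffP.
Qed.

Lemma holomorphicD (g h : 'cV[R[i]]_n -> R[i]) c : holomorphic g -> holomorphic h ->
  holomorphic (fun z => c * g z + h z).
Proof.
move=> hg hh z; apply: differentiableD; last exact: hh.
by apply: (@differentiableZ _ _ _ (g : 'cV[R[i]]_n -> R[i]^o) c); exact: hg.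
Qed.

End VectorFunctions.

(** * Lebesgue measure on C^n and its invariances *)

Section ProductSigmaFinite.
Context d {T : measurableType d} {R : realType}.
Local Notation leb := (@lebesgue_measure R).
Variables (m : {sigma_finite_measure set T -> \bar R}).

(* The sigma-finiteness of a product measure is not inferred from the library
   for measures that are not subprobabilities, hence this copy. *)
Definition prod_leb : set (T * measurableTypeR R) -> \bar R := (m \x leb)%E.

HB.instance Definition _ := Measure.copy prod_leb
  ((m \x leb)%E : measure (T * measurableTypeR R)%type R).

Let prod_leb_sigma_finite : sigma_finite setT prod_leb.
Proof.
have /sigma_finiteP[F [TF ndF Foo]] := sigma_finiteT m.
have /sigma_finiteP[G [TG ndG Goo]] := sigma_finiteT leb.
exists (fun k => F k `*` G k).
  apply/seteqP; split => // -[x y] _.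
  have [k _ Fk] : (\bigcup_k F k) x by rewrite -TF.
  have [l _ Gl] : (\bigcup_k G k) y by rewrite -TG.
  exists (maxn k l) => //; split => /=.
  - by move: x Fk; exact/subsetPset/ndF/leq_maxl.
  - by move: y Gl; exact/subsetPset/ndG/leq_maxr.
move=> k; have [mF Fk] := Foo k; have [mG Gk] := Goo k.
split; first exact: measurableX.
rewrite /prod_leb product_measure1E//; apply: lte_mul_pinfty => //.
by rewrite ge0_fin_numE.
Qed.

HB.instance Definition _ := Measure_isSigmaFinite.Build _ _ _ prod_leb
  prod_leb_sigma_finite.

Variable G : T * measurableTypeR R * measurableTypeR R -> \bar R.
Hypotheses (mG : measurable_fun setT G) (G0 : forall z, (0 <= G z)%E).

Lemma fubini3_yxt : (\int[(prod_leb \x leb)%E]_z G z =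
  \int[leb]_y \int[leb]_x \int[m]_t G (t, x, y))%E.
Proof.
transitivity (\int[leb]_y \int[prod_leb]_z G (z, y))%E.
  exact: (fubini_tonelli2 G mG G0).
apply: eq_integral => y _.
have mGy : measurable_fun setT (fun z => G (z, y)).
  exact: (measurableT_comp mG (measurable_pair2 y)).
exact: (fubini_tonelli2 (fun z => G (z, y)) mGy).
Qed.

Lemma fubini3_txy : (\int[(prod_leb \x leb)%E]_z G z =
  \int[m]_t \int[leb]_x \int[leb]_y G (t, x, y))%E.
Proof.
transitivity (\int[prod_leb]_z \int[leb]_y G (z, y))%E.
  exact: (fubini_tonelli1 G mG G0).
pose H z := (\int[leb]_y G (z, y))%E.
have mH : measurable_fun setT H by exact: (measurable_fun_fubini_tonelli_F G).
have H0 z : (0 <= H z)%E by apply: integral_ge0 => y _; exact: G0.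
exact: (fubini_tonelli1 H mH H0).
Qed.

End ProductSigmaFinite.

Section LebesgueCnFubini.
Context {R : realType}.
Local Notation plane := (measurableTypeR R * measurableTypeR R)%type.
Local Notation leb := (@lebesgue_measure R).

Let box n (k : nat) : set (n.-tuple plane) :=
  [set t | forall j, `|(tnth t j).1| <= k%:R /\ `|(tnth t j).2| <= k%:R].
Local Arguments box : clear implicits.

Lemma measurable_tnth1 n (j : 'I_n) :
  measurable_fun setT (fun t : n.-tuple plane => (tnth t j).1).
Proof. exact: (measurableT_comp measurable_fst (measurable_tnth j)). Qed.

Lemma measurable_tnth2 n (j : 'I_n) :
  measurable_fun setT (fun t : n.-tuple plane => (tnth t j).2).
Proof. exact: (measurableT_comp measurable_snd (measurable_tnth j)). Qed.

Let measurable_box n (k : nat) : measurable (box n k).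
Proof.
have -> : box n k = \big[setI/setT]_(j : 'I_n)
   ((fun t : n.-tuple plane => (tnth t j).1) @^-1` `[- k%:R, k%:R] `&`
    (fun t : n.-tuple plane => (tnth t j).2) @^-1` `[- k%:R, k%:R]).
  apply/seteqP; split => t /=.
    move=> h; rewrite -bigcap_seq => j _ /=; have [h1 h2] := h j.
    by rewrite !in_itv/= -!ler_norml.
  rewrite -bigcap_seq => h j; have := h j; rewrite /= mem_index_enum => /(_ isT).
  by rewrite !in_itv/= -!ler_norml.
apply: bigsetI_measurable => j _; apply: measurableI; rewrite -[X in measurable X]setTI.
  by apply: measurable_tnth1 => //; exact: measurable_itv.
by apply: measurable_tnth2 => //; exact: measurable_itv.
Qed.

Let itv_lty (k : nat) : (leb `[(- k%:R)%R, k%:R] < +oo)%E.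
Proof. by rewrite lebesgue_measure_itv; case: ifP => _; rewrite ?ltry// -EFinD ltry. Qed.

Let box_lty n (k : nat) : (lebesgue_Cn n (box n k) < +oo)%E.
Proof.
elim: n => [|n IH].
  by rewrite /= diracE ltry.
rewrite /= /tuple_cons_measure /pushforward.
have -> : @tuple_cons R n @^-1` (box n.+1 k) = (box n k `*` `[- k%:R, k%:R]) `*` `[- k%:R, k%:R].
  apply/seteqP; split => [[[t x] y]|[[t x] y] /= [[bt +] +]] /=.
    move=> h; have [h1 h2] := h ord0; rewrite !in_itv/= -!ler_norml; split => //; split => //.
    by move=> j; have := h (lift ord0 j); rewrite tnthS.
  rewrite !in_itv/= -!ler_norml => hx hy j.
  by case: (unliftP ord0 j) => [i|] ->; rewrite ?tnthS//; exact: bt.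
have mI : measurable (`[- k%:R, k%:R] : set (measurableTypeR R)) by exact: measurable_itv.
rewrite (product_measure1E _ _ (measurableX (@measurable_box n k) mI) mI).
rewrite [X in (X * _ < _)%E](@product_measure1E _ _ _ _ R (lebesgue_Cn n) leb _ _ (@measurable_box n k) mI).
have fI := itv_lty k; have I0 : (0 <= leb `[(- k%:R)%R, k%:R])%E by [].
have B0 : (0 <= lebesgue_Cn n (box n k))%E by [].
have ab : (lebesgue_Cn n (box n k) * leb `[(- k%:R)%R, k%:R] < +oo)%E.
  by apply: lte_mul_pinfty => //; rewrite ge0_fin_numE.
have ab0 : (0 <= lebesgue_Cn n (box n k) * leb `[(- k%:R)%R, k%:R])%E by rewrite mule_ge0.
by apply: lte_mul_pinfty => //; rewrite ge0_fin_numE.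
Qed.

Lemma lebesgue_Cn_sigma_finite n : sigma_finite setT (@lebesgue_Cn R n).
Proof.
exists (box n); last by move=> k; split; [exact: measurable_box|exact: box_lty].
apply/seteqP; split => // t _.
pose M := \big[Num.max/0]_(j < n) Num.max `|(tnth t j).1| `|(tnth t j).2|.
exists (Num.truncn M).+1 => // j.
have HM : Num.max `|(tnth t j).1| `|(tnth t j).2| <= M by exact: le_bigmax.
have tM : M <= (Num.truncn M).+1%:R by apply/ltW; exact: truncnS_gt.
by have := le_trans HM tM; rewrite ge_max => /andP[].
Qed.

(** A copy of [lebesgue_Cn n] that carries the sigma-finite structure required by Tonelli's
    theorem. *)
Definition leb_sf n : set (n.-tuple plane) -> \bar R := @lebesgue_Cn R n.
Arguments leb_sf : clear implicits.

HB.instance Definition _ n := Measure.copy (leb_sf n) (@lebesgue_Cn R n).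
HB.instance Definition _ n := Measure_isSigmaFinite.Build _ _ _ (leb_sf n)
  (@lebesgue_Cn_sigma_finite n).

Lemma integral_lebesgue_CnS n (F : n.+1.-tuple plane -> \bar R) :
  measurable_fun setT F -> (forall t, 0 <= F t)%E ->
  (\int[lebesgue_Cn n.+1]_t F t =
   \int[(prod_leb (leb_sf n) \x leb)%E]_z F (@tuple_cons R n z))%E.
Proof.
move=> mF F0; rewrite /=.
have := @ge0_integral_pushforward _ _ _ _ R _ (@measurable_tuple_cons R n)
  (prod_leb (leb_sf n) \x leb)%E setT F measurableT mF.
by rewrite preimage_setT; apply => t _.
Qed.

Lemma integral_lebesgue_CnS1 n (F : n.+1.-tuple plane -> \bar R) :
  measurable_fun setT F -> (forall t, 0 <= F t)%E ->
  (\int[lebesgue_Cn n.+1]_t F t = \int[leb]_y \int[leb]_x \int[lebesgue_Cn n]_t F (@tuple_cons R n (t, x, y)))%E.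
Proof.
move=> mF F0; rewrite integral_lebesgue_CnS//.
exact: (fubini3_yxt (leb_sf n) (measurableT_comp mF (@measurable_tuple_cons R n)) (fun z => F0 _)).
Qed.

Lemma integral_lebesgue_CnS2 n (F : n.+1.-tuple plane -> \bar R) :
  measurable_fun setT F -> (forall t, 0 <= F t)%E ->
  (\int[lebesgue_Cn n.+1]_t F t = \int[lebesgue_Cn n]_t \int[leb]_x \int[leb]_y F (@tuple_cons R n (t, x, y)))%E.
Proof.
move=> mF F0; rewrite integral_lebesgue_CnS//.
exact: (fubini3_txy (leb_sf n) (measurableT_comp mF (@measurable_tuple_cons R n)) (fun z => F0 _)).
Qed.

End LebesgueCnFubini.
Arguments leb_sf {R} n _.

(** * Translations of the line and rotations of the plane *)

Section LineTranslation.
Context {R : realType}.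
Local Notation leb := (@lebesgue_measure R).

Lemma lebesgue_measureD (c : R) (A : set (measurableTypeR R)) : measurable A ->
  pushforward leb (fun x : measurableTypeR R => (x + c : measurableTypeR R)) A = leb A.
Proof.
have mc : measurable_fun setT (fun x : measurableTypeR R => (x + c : measurableTypeR R)).
  by apply: measurable_funD.
pose mu' := pushforward leb (fun x : measurableTypeR R => (x + c : measurableTypeR R)).
pose m := measure_function_pushforward__canonical__measure_function_Measure leb mc.
move=> mA; apply/esym; apply: (@lebesgue_measure_unique R m) => //= _ [[a b]] _ <-.
rewrite /pushforward/=.
have -> : (fun x : R => x + c) @^-1` `]a, b] = `]a - c, b - c]%classic.
  by apply/seteqP; split => x /=; rewrite !in_itv/= ltrBlDr lerBrDr.
rewrite !lebesgue_measure_itv/= !lte_fin ltrD2r.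
by case: ifP => // _; rewrite -!EFinB; congr EFin; ring.
Qed.

Lemma ge0_integral_translate (c : R) (f : R -> \bar R) :
  measurable_fun setT f -> (forall x, 0 <= f x)%E ->
  (\int[leb]_x f (x + c)%R = \int[leb]_x f x)%E.
Proof.
move=> mf f0.
have mc : measurable_fun setT (fun x : measurableTypeR R => (x + c : measurableTypeR R)).
  by apply: measurable_funD.
have := @ge0_integral_pushforward _ _ _ _ R _ mc leb setT f measurableT mf (fun x _ => f0 x).
rewrite preimage_setT => <-.
by apply: eq_measure_integral => A mA _; exact: lebesgue_measureD.
Qed.

End LineTranslation.

Section PlaneInvariance.
Context {R : realType}.
Local Notation leb := (@lebesgue_measure R).
Implicit Types F : R -> R -> \bar R.

Definition plint F := (\int[leb]_y \int[leb]_x F x y)%E.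

Definition plmeas F := measurable_fun setT
  (fun z : measurableTypeR R * measurableTypeR R => F z.1 z.2).

Lemma plmeas_comp F (a b c d : R) : plmeas F ->
  plmeas (fun x y => F (a * x + b * y) (c * x + d * y)).
Proof.
move=> mF; pose f (z : measurableTypeR R * measurableTypeR R) :
  measurableTypeR R * measurableTypeR R := (a * z.1 + b * z.2, c * z.1 + d * z.2).
apply: (measurableT_comp (f := fun z : measurableTypeR R * measurableTypeR R => F z.1 z.2) (g := f)) => //.
have ml (u v : R) : measurable_fun setT
    (fun z : measurableTypeR R * measurableTypeR R => u * z.1 + v * z.2 : measurableTypeR R).
  by apply: measurable_funD; apply: measurable_funM.
by apply: measurable_fun_pair; exact: ml.
Qed.

Lemma plint_swap F : plmeas F -> (forall x y, 0 <= F x y)%E ->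
  plint F = (\int[leb]_x \int[leb]_y F x y)%E.
Proof.
move=> mF F0; apply/esym.
exact: (@fubini_tonelli _ _ _ _ R leb leb (fun z => F z.1 z.2) mF (fun z => F0 _ _)).
Qed.

(** On each horizontal line the shear is a translation. *)
Lemma plint_shear1 F a : plmeas F -> (forall x y, 0 <= F x y)%E ->
  plint (fun x y => F (x + a * y) y) = plint F.
Proof.
move=> mF F0; apply: eq_integral => y _.
apply: (@ge0_integral_translate R (a * y) (F ^~ y)) => //.
exact: (measurableT_comp mF (measurable_pair2 y)).
Qed.

Lemma plint_shear2 F a : plmeas F -> (forall x y, 0 <= F x y)%E ->
  plint (fun x y => F x (y + a * x)) = plint F.
Proof.
move=> mF F0.
have mF1 : plmeas (fun x y => F x (y + a * x)).
  have := plmeas_comp 1 0 a 1 mF; congr plmeas.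
  by apply/funext => x; apply/funext => y; rewrite !mul1r mul0r addr0 addrC.
rewrite (plint_swap mF F0) (plint_swap mF1 (fun _ _ => F0 _ _)).
apply: eq_integral => x _.
apply: (@ge0_integral_translate R (a * x) (F x)) => //.
exact: (measurableT_comp mF (measurable_pair1 x)).
Qed.

(* A rotation of angle t <> pi is the product of three shears, of slopes
   - tan (t / 2), sin t and - tan (t / 2). *)
Let plint_rot_shears F c s : plmeas F -> (forall x y, 0 <= F x y)%E ->
  c ^+ 2 + s ^+ 2 = 1 -> c != -1 ->
  plint (fun x y => F (c * x + - s * y) (s * x + c * y)) = plint F.
Proof.
move=> mF F0 cs c1; have c1' : 1 + c != 0 by rewrite addrC addr_eq0.
pose k := s / (1 + c).
have s2 : s ^+ 2 = (1 - c) * (1 + c) by rewrite -[LHS](addKr (c ^+ 2)) cs; ring.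
have ks : k * s = 1 - c by rewrite /k mulrAC -expr2 s2 mulfK.
have kc : k * (1 + c) = s by rewrite /k divfK.
rewrite -[RHS](plint_shear1 (- k) mF F0).
have mF1 : plmeas (fun x y => F (x + - k * y) y).
  have := plmeas_comp 1 (- k) 0 1 mF; congr plmeas.
  by apply/funext => x; apply/funext => y; rewrite !mul1r mul0r add0r.
rewrite -[RHS](plint_shear2 s mF1); last by move=> *; exact: F0.
have mF2 : plmeas (fun x y => F (x + - k * (y + s * x)) (y + s * x)).
  have := plmeas_comp 1 0 s 1 mF1; congr plmeas.
  by apply/funext => x; apply/funext => y; rewrite !mul1r mul0r addr0 [s * _ + _]addrC.
rewrite -[RHS](plint_shear1 (- k) mF2); last by move=> *; exact: F0.
congr plint; apply/funext => x; apply/funext => y.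
have e1 : s * x + c * y = y + s * (x + - k * y).
  have -> : y + s * (x + - k * y) = s * x + (1 - k * s) * y by ring.
  by rewrite ks; ring.
rewrite -e1; congr F.
have -> : x + - k * y + - k * (s * x + c * y) = (1 - k * s) * x - (k * (1 + c)) * y by ring.
by rewrite ks kc; ring.
Qed.

Lemma plint_rot F c s : plmeas F -> (forall x y, 0 <= F x y)%E ->
  c ^+ 2 + s ^+ 2 = 1 ->
  plint (fun x y => F (c * x + - s * y) (s * x + c * y)) = plint F.
Proof.
move=> mF F0 cs; have [c1|c1] := eqVneq c (-1); last exact: plint_rot_shears.
have s0 : s = 0.
  by move: cs; rewrite c1 sqrrN expr1n => /eqP; rewrite -subr_eq0 addrAC subrr add0r sqrf_eq0 => /eqP.
(* The half turn is the square of the quarter turn [c = 0], [s = 1], to which the shears apply. *)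
have m1 : 0 != -1 :> R by rewrite eq_sym oppr_eq0 oner_eq0.
have e1 : 0 ^+ 2 + 1 ^+ 2 = 1 :> R by rewrite expr0n expr1n add0r.
rewrite -[RHS](plint_rot_shears mF F0 e1 m1).
have mF1 : plmeas (fun x y => F (0 * x + -1 * y) (1 * x + 0 * y)) by exact: plmeas_comp.
rewrite -[RHS](plint_rot_shears mF1 (fun _ _ => F0 _ _) e1 m1).
by congr plint; apply/funext => x; apply/funext => y; rewrite c1 s0; congr F; ring.
Qed.

Lemma plint_unimodular (H : R[i] -> \bar R) (u : R[i]) :
  plmeas (fun x y => H (x +i* y)) -> (forall z, 0 <= H z)%E -> normc u = 1 ->
  plint (fun x y => H (u * (x +i* y))) = plint (fun x y => H (x +i* y)).
Proof.
move=> mH H0 u1; have cs : Re u ^+ 2 + Im u ^+ 2 = 1 by rewrite -sqr_normcE u1 expr1n.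
rewrite -(plint_rot mH (fun _ _ => H0 _) cs); congr plint.
apply/funext => x; apply/funext => y; congr H.
by apply: eqc; rewrite ?(Re_mulc, Im_mulc)/=; ring.
Qed.

End PlaneInvariance.

(** * Integrals over vectors split into head and tail *)

Section VectorIntegral.
Context {R : realType}.
Local Notation leb := (@lebesgue_measure R).
Local Notation plane := (measurableTypeR R * measurableTypeR R)%type.

Definition vcons n (z : R[i]) (v : 'cV[R[i]]_n) : 'cV[R[i]]_n.+1 :=
  \col_j oapp (fun k => v k 0) z (unlift ord0 j).

Definition vtail n (w : 'cV[R[i]]_n.+1) : 'cV[R[i]]_n := \col_j w (lift ord0 j) 0.

Lemma vcons0 n z (v : 'cV[R[i]]_n) : vcons z v ord0 0 = z.
Proof. by rewrite mxE unlift_none. Qed.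

Lemma vconsS n z (v : 'cV[R[i]]_n) j : vcons z v (lift ord0 j) 0 = v j 0.
Proof. by rewrite mxE liftK. Qed.

Lemma vtail_cons n z (v : 'cV[R[i]]_n) : vtail (vcons z v) = v.
Proof. by apply/colP => j; rewrite mxE vconsS. Qed.

Lemma vcons_eta n (w : 'cV[R[i]]_n.+1) : vcons (w ord0 0) (vtail w) = w.
Proof.
by apply/colP => j; case: (unliftP ord0 j) => [k|] ->; rewrite ?vconsS ?vcons0 ?mxE.
Qed.

Lemma vec_tuple_cons n (t : n.-tuple plane) x y :
  vec_of_plane (tuple_cons (t, x, y)) = vcons (x +i* y) (vec_of_plane t).
Proof.
apply/colP => j; case: (unliftP ord0 j) => [k|] ->.
  by rewrite vconsS !mxE tnthS.
by rewrite vcons0 mxE.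
Qed.

Definition vint n (F : 'cV[R[i]]_n -> \bar R) := (\int[lebesgue_Cn n]_t F (vec_of_plane t))%E.

Definition vmeas n (F : 'cV[R[i]]_n -> \bar R) :=
  measurable_fun setT (fun t : n.-tuple plane => F (vec_of_plane t)).

Definition plane_of_vec n (z : 'cV[R[i]]_n) : n.-tuple plane :=
  [tuple (Re (z j 0), Im (z j 0)) | j < n].

Lemma plane_of_vecK n (z : 'cV[R[i]]_n) : vec_of_plane (plane_of_vec z) = z.
Proof. by apply/colP => j; rewrite mxE tnth_mktuple/=; case: (z j 0). Qed.

(** Measurability of [F] is a statement about tuples of planes, so [Z] is factored through them by
    [plane_of_vec]. *)
Lemma vmeas_comp d (T : measurableType d) n (Z : T -> 'cV[R[i]]_n) F : vmeas F ->
  (forall j, measurable_fun setT (fun t => Re (Z t j 0))) ->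
  (forall j, measurable_fun setT (fun t => Im (Z t j 0))) ->
  measurable_fun setT (fun t => F (Z t)).
Proof.
move=> mF mR mI.
have -> : (fun t => F (Z t)) = (fun s => F (vec_of_plane s)) \o (fun t => plane_of_vec (Z t)).
  by apply/funext => t /=; rewrite plane_of_vecK.
apply: measurableT_comp => //; apply/measurable_fun_tnthP => j.
have -> : (@tnth n plane)^~ j \o (fun t => plane_of_vec (Z t)) = (fun t => (Re (Z t j 0), Im (Z t j 0))).
  by apply/funext => t /=; rewrite tnth_mktuple.
by apply: measurable_fun_pair; [exact: mR|exact: mI].
Qed.

Lemma measurable_Re_vec n (j : 'I_n) :
  measurable_fun setT (fun t : n.-tuple plane => Re (vec_of_plane t j 0)).
Proof.
have := @measurable_tnth1 R n j; congr measurable_fun.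
by apply/funext => t; rewrite mxE.
Qed.

Lemma measurable_Im_vec n (j : 'I_n) :
  measurable_fun setT (fun t : n.-tuple plane => Im (vec_of_plane t j 0)).
Proof.
have := @measurable_tnth2 R n j; congr measurable_fun.
by apply/funext => t; rewrite mxE.
Qed.

Lemma vmeas_vcont n m (V : 'cV[R[i]]_n -> 'cV[R[i]]_m) F : vmeas F ->
  (forall j, vcont (fun z => V z j 0)) -> vmeas (fun z => F (V z)).
Proof.
move=> mF cV; apply: (vmeas_comp (Z := fun t => V (vec_of_plane t)) mF) => j;
  have [h1 h2] := measurable_vcont (@measurable_Re_vec n) (@measurable_Im_vec n) (cV j).
  exact: h1.
exact: h2.
Qed.

Lemma vcont_vcons n m (f : 'cV[R[i]]_n -> R[i]) (V : 'cV[R[i]]_n -> 'cV[R[i]]_m) :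
  vcont f -> (forall j, vcont (fun z => V z j 0)) ->
  forall j, vcont (fun z => vcons (f z) (V z) j 0).
Proof.
move=> cf cV j; case: (unliftP ord0 j) => [k|] ->.
  have -> : (fun z => vcons (f z) (V z) (lift ord0 k) 0) = (fun z => V z k 0).
    by apply/funext => z; rewrite vconsS.
  exact: cV.
have -> // : (fun z => vcons (f z) (V z) ord0 0) = f.
by apply/funext => z; rewrite vcons0.
Qed.

Lemma vcont_vtail n j : vcont (fun w : 'cV[R[i]]_n.+1 => vtail w j 0).
Proof.
have := @vcont_coord R n.+1 (lift ord0 j); congr vcont.
by apply/funext => w; rewrite mxE.
Qed.

Lemma vmeas_slice n (F : 'cV[R[i]]_n.+1 -> \bar R) z : vmeas F -> vmeas (fun v => F (vcons z v)).
Proof.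
move=> mF; apply: (vmeas_vcont (V := vcons z) mF).
by apply: (@vcont_vcons n n (fun=> z) id); [exact: vcont_cst|exact: vcont_coord].
Qed.

Lemma plmeas_slice n (F : 'cV[R[i]]_n.+1 -> \bar R) v : vmeas F ->
  plmeas (fun x y => F (vcons (x +i* y) v)).
Proof.
move=> mF; apply: (vmeas_comp (Z := fun z : plane => vcons (z.1 +i* z.2) v) mF) => j;
  case: (unliftP ord0 j) => [k|] ->; under [X in measurable_fun _ X]funext do rewrite ?vcons0 ?vconsS/=.
all: by [exact: measurable_cst|exact: measurable_fst|exact: measurable_snd].
Qed.

(** With the head outermost, a change of the tail that depends on the head acts on the inner
    integral; [vint_S2] does the same for changes of the head. *)
Lemma vint_S1 n (F : 'cV[R[i]]_n.+1 -> \bar R) : vmeas F -> (forall z, 0 <= F z)%E ->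
  vint F = plint (fun x y => vint (fun v => F (vcons (x +i* y) v))).
Proof.
move=> mF F0; rewrite /vint [LHS](integral_lebesgue_CnS1 mF (fun t => F0 _)).
apply: eq_integral => y _; apply: eq_integral => x _; apply: eq_integral => t _.
by rewrite vec_tuple_cons.
Qed.

Lemma vint_S2 n (F : 'cV[R[i]]_n.+1 -> \bar R) : vmeas F -> (forall z, 0 <= F z)%E ->
  vint F = vint (fun v => plint (fun x y => F (vcons (x +i* y) v))).
Proof.
move=> mF F0; rewrite /vint [LHS](integral_lebesgue_CnS2 mF (fun t => F0 _)).
apply: eq_integral => t _; rewrite [RHS](plint_swap (plmeas_slice _ mF) (fun _ _ => F0 _)).
apply: eq_integral => x _; apply: eq_integral => y _.
by rewrite vec_tuple_cons.
Qed.

End VectorIntegral.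

Section VectorInvariance.
Context {R : realType}.
Local Notation leb := (@lebesgue_measure R).

Lemma eq_vint n (F G : 'cV[R[i]]_n -> \bar R) : F =1 G -> vint F = vint G.
Proof. by move=> FG; congr vint; apply/funext. Qed.

Lemma eq_plint (F G : R -> R -> \bar R) : (forall x y, F x y = G x y) -> plint F = plint G.
Proof. by move=> FG; congr plint; apply/funext => x; apply/funext => y. Qed.

Lemma plint_translate (H : R[i] -> \bar R) (a : R[i]) :
  plmeas (fun x y => H (x +i* y)) -> (forall z, 0 <= H z)%E ->
  plint (fun x y => H ((x +i* y) + a)) = plint (fun x y => H (x +i* y)).
Proof.
move=> mH H0; case: a => a b.
pose G y := (\int[leb]_x H (x +i* y))%E.
have mG : measurable_fun setT G.
  exact: (measurable_fun_fubini_tonelli_G (m1 := leb)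
    (fun z : measurableTypeR R * measurableTypeR R => H (z.1 +i* z.2)) mH (fun z => H0 _)).
have G0 y : (0 <= G y)%E by apply: integral_ge0 => x _; exact: H0.
rewrite -[RHS](@ge0_integral_translate R b G mG G0).
apply: eq_integral => y _.
apply: (@ge0_integral_translate R a (fun x => H (x +i* (y + b)))) => //.
exact: (measurableT_comp mH (measurable_pair2 (y + b))).
Qed.

Lemma vint_translate n (F : 'cV[R[i]]_n -> \bar R) a : vmeas F -> (forall z, 0 <= F z)%E ->
  vint (fun v => F (v + a)) = vint F.
Proof.
elim: n F a => [|n IH] F a mF F0.
  by apply: eq_vint => v; congr F; apply/colP => -[].
have mF1 : vmeas (fun v => F (v + a)).
  apply: (vmeas_vcont (V := fun v => v + a) mF) => j.
  have -> : (fun z => (z + a) j 0) = (fun z : 'cV[R[i]]_n.+1 => z j 0 + a j 0).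
    by apply/funext => z; rewrite mxE.
  by apply: vcontD; [exact: vcont_coord|exact: vcont_cst].
rewrite (vint_S1 mF1 (fun _ => F0 _)) (vint_S1 mF F0).
pose H z := vint (fun v => F (vcons z v)).
have mH : plmeas (fun x y => H (x +i* y)).
  pose f (w : n.-tuple (measurableTypeR R * measurableTypeR R) *
     (measurableTypeR R * measurableTypeR R)) := F (vcons (w.2.1 +i* w.2.2) (vec_of_plane w.1)).
  have mf : measurable_fun setT f.
    apply: (vmeas_comp (Z := fun w => vcons (w.2.1 +i* w.2.2) (vec_of_plane w.1)) mF) => j.
      case: (unliftP ord0 j) => [k|] ->; under [X in measurable_fun _ X]funext do rewrite ?vcons0 ?vconsS/=.
        exact: (measurableT_comp (@measurable_Re_vec R n k) measurable_fst).
      exact: (measurableT_comp measurable_fst measurable_snd).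
    case: (unliftP ord0 j) => [k|] ->; under [X in measurable_fun _ X]funext do rewrite ?vcons0 ?vconsS/=.
      exact: (measurableT_comp (@measurable_Im_vec R n k) measurable_fst).
    exact: (measurableT_comp measurable_snd measurable_snd).
  have f0 w : (0 <= f w)%E by exact: F0.
  exact: (measurable_fun_fubini_tonelli_G (m1 := leb_sf n) f mf f0).
have H0 z : (0 <= H z)%E by apply: integral_ge0 => t _; exact: F0.
rewrite -[RHS](plint_translate (a ord0 0) mH H0); apply: eq_plint => x y.
rewrite /H -[RHS](IH _ (vtail a)) => [|//|//]; last exact: vmeas_slice.
apply: eq_vint => v; congr F; apply/colP => j.
by case: (unliftP ord0 j) => [k|] ->; rewrite !mxE ?unlift_none ?liftK/= ?mxE.
Qed.

End VectorInvariance.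

Lemma vcont_compV {R : realType} n m (V : 'cV[R[i]]_n -> 'cV[R[i]]_m) (g : 'cV[R[i]]_m -> R[i]) :
  (forall j, vcont (fun w => V w j 0)) -> vcont g -> vcont (fun w => g (V w)).
Proof.
move=> cV cg z e e0; have [d d0 Hd] := cg (V z) e e0.
have /choice[f Hf] : forall j : 'I_m, exists f, 0 < f /\ forall w : 'cV[R[i]]_n,
    (forall k, normc (w k 0 - z k 0) < f) -> normc (V w j 0 - V z j 0) < d.
  by move=> j; have [f f0 H] := cV j z d d0; exists f.
exists (\big[Num.min/1]_j f j).
  by apply: lt_bigmin => // j _; have [] := Hf j.
move=> w wz; apply: Hd => j; have [_] := Hf j; apply => k.
by apply: lt_le_trans (wz k) _; exact: bigmin_le.
Qed.

(** * Shears and unitary maps of [C^n] *)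

Section Shears.
Context {R : realType} {n : nat}.
Implicit Types (F : 'cV[R[i]]_n.+1 -> \bar R) (q v : 'cV[R[i]]_n) (w : 'cV[R[i]]_n.+1).

Definition tail_shear (c : R[i]) q w := vcons (w ord0 0) (vtail w + (c * w ord0 0) *: q).
Definition head_shear (c : R[i]) q w := vcons (w ord0 0 + c * cdot (vtail w) q) (vtail w).

Lemma vcont_cdot q (V : 'cV[R[i]]_n.+1 -> 'cV[R[i]]_n) :
  (forall j, vcont (fun w => V w j 0)) -> vcont (fun w => cdot (V w) q).
Proof.
move=> cV; rewrite /cdot; apply: vcont_sum => j.
by apply: vcontM; [exact: cV|exact: vcont_cst].
Qed.

Lemma vcont_tail_shear c q j : vcont (fun w => tail_shear c q w j 0).
Proof.
apply: (@vcont_vcons _ _ _ (fun w => w ord0 0) (fun w => vtail w + (c * w ord0 0) *: q)).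
  exact: vcont_coord.
move=> k; have -> : (fun w => (vtail w + (c * w ord0 0) *: q) k 0) =
   (fun w => vtail w k 0 + (c * w ord0 0) * q k 0).
  by apply/funext => w; rewrite !mxE.
apply: vcontD; first exact: vcont_vtail.
apply: vcontM; last exact: vcont_cst.
by apply: vcontM; [exact: vcont_cst|exact: vcont_coord].
Qed.

Lemma vcont_head_shear c q j : vcont (fun w => head_shear c q w j 0).
Proof.
apply: (@vcont_vcons _ _ _ (fun w => w ord0 0 + c * cdot (vtail w) q) (@vtail R n)).
  apply: vcontD; first exact: vcont_coord.
  by apply: vcontM; [exact: vcont_cst|apply: vcont_cdot; exact: vcont_vtail].
exact: vcont_vtail.
Qed.

(** For a fixed head this is a translation of the tail. *)
Lemma vint_tail_shear F c q : vmeas F -> (forall z, 0 <= F z)%E ->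
  vint (fun w => F (tail_shear c q w)) = vint F.
Proof.
move=> mF F0.
have mF1 : vmeas (fun w => F (tail_shear c q w)).
  by apply: (vmeas_vcont (V := tail_shear c q) mF); exact: vcont_tail_shear.
rewrite (vint_S1 mF1 (fun _ => F0 _)) (vint_S1 mF F0); apply: eq_plint => x y.
rewrite -[RHS](vint_translate ((c * (x +i* y)) *: q) (vmeas_slice _ mF) (fun _ => F0 _)).
by apply: eq_vint => v; rewrite /tail_shear vcons0 vtail_cons.
Qed.

Lemma vint_head_shear F c q : vmeas F -> (forall z, 0 <= F z)%E ->
  vint (fun w => F (head_shear c q w)) = vint F.
Proof.
move=> mF F0.
have mF1 : vmeas (fun w => F (head_shear c q w)).
  by apply: (vmeas_vcont (V := head_shear c q) mF); exact: vcont_head_shear.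
rewrite (vint_S2 mF1 (fun _ => F0 _)) (vint_S2 mF F0); apply: eq_vint => v.
rewrite -[RHS](plint_translate (H := fun z => F (vcons z v)) (c * cdot v q) (plmeas_slice _ mF) (fun _ => F0 _)).
by apply: eq_plint => x y; rewrite /head_shear vcons0 vtail_cons.
Qed.

End Shears.

Section DiagonalRotation.
Context {R : realType}.

Definition rot2 n (a b : R[i]) (w : 'cV[R[i]]_n.+1) := vcons (a * w ord0 0) (b *: vtail w).

Lemma vcont_rot2 n (a b : R[i]) j : vcont (fun w : 'cV[R[i]]_n.+1 => rot2 a b w j 0).
Proof.
apply: (@vcont_vcons _ _ _ (fun w => a * w ord0 0) (fun w => b *: vtail w)).
  by apply: vcontM; [exact: vcont_cst|exact: vcont_coord].
move=> k; have -> : (fun w : 'cV[R[i]]_n.+1 => (b *: vtail w) k 0) = (fun w => b * vtail w k 0).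
  by apply/funext => w; rewrite mxE.
by apply: vcontM; [exact: vcont_cst|exact: vcont_vtail].
Qed.

(** Invariance under scalings of the tail is a hypothesis here, so that this step serves both as the
    induction step of [vint_scale] and, afterwards, for [vint_rot2]. *)
Let vint_rot2_step n (F : 'cV[R[i]]_n.+1 -> \bar R) a b : normc a = 1 -> normc b = 1 ->
  (forall F : 'cV[R[i]]_n -> \bar R, vmeas F -> (forall z, 0 <= F z)%E ->
    vint (fun v => F (b *: v)) = vint F) ->
  vmeas F -> (forall z, 0 <= F z)%E ->
  vint (fun w => F (rot2 a b w)) = vint F.
Proof.
move=> a1 b1 IH mF F0.
have mr c d : vmeas (fun w => F (rot2 c d w)).
  by apply: (vmeas_vcont (V := rot2 c d) mF); exact: vcont_rot2.
transitivity (vint (fun w => F (rot2 a 1 w))).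
  rewrite (vint_S1 (mr a b) (fun _ => F0 _)) (vint_S1 (mr a 1) (fun _ => F0 _)).
  apply: eq_plint => x y.
  have h := IH (fun v => F (vcons (a * (x +i* y)) v)) (vmeas_slice _ mF) (fun _ => F0 _).
  transitivity (vint (fun v => F (vcons (a * (x +i* y)) (b *: v)))).
    by apply: eq_vint => v; rewrite /rot2 vcons0 vtail_cons.
  by rewrite h; apply: eq_vint => v; rewrite /rot2 vcons0 vtail_cons scale1r.
rewrite (vint_S2 (mr a 1) (fun _ => F0 _)) (vint_S2 mF F0); apply: eq_vint => v.
rewrite -[RHS](plint_unimodular (H := fun z => F (vcons z v)) (plmeas_slice _ mF) (fun _ => F0 _) a1).
by apply: eq_plint => x y; rewrite /rot2 vcons0 vtail_cons scale1r.
Qed.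

Lemma vint_scale n (F : 'cV[R[i]]_n -> \bar R) u : normc u = 1 ->
  vmeas F -> (forall z, 0 <= F z)%E -> vint (fun v => F (u *: v)) = vint F.
Proof.
move=> u1; elim: n F => [|n IH] F mF F0.
  by apply: eq_vint => v; congr F; apply/colP => -[].
rewrite -[RHS](vint_rot2_step u1 u1 IH mF F0); apply: eq_vint => w; congr F.
apply/colP => j; rewrite /rot2; case: (unliftP ord0 j) => [k|] ->.
  by rewrite vconsS !mxE.
by rewrite vcons0 mxE.
Qed.

Lemma vint_rot2 n (F : 'cV[R[i]]_n.+1 -> \bar R) a b : normc a = 1 -> normc b = 1 ->
  vmeas F -> (forall z, 0 <= F z)%E ->
  vint (fun w => F (rot2 a b w)) = vint F.
Proof.
move=> a1 b1; apply: vint_rot2_step => // G mG G0; exact: vint_scale.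
Qed.

End DiagonalRotation.

Section CdotTheory.
Context {R : realType}.

Lemma cdotDl n (v w q : 'cV[R[i]]_n) : cdot (v + w) q = cdot v q + cdot w q.
Proof. by rewrite /cdot -big_split; apply: eq_bigr => j _; rewrite mxE mulrDl. Qed.

Lemma cdotZl n a (v q : 'cV[R[i]]_n) : cdot (a *: v) q = a * cdot v q.
Proof. by rewrite /cdot mulr_sumr; apply: eq_bigr => j _; rewrite mxE mulrA. Qed.

Lemma cdotC n (v w : 'cV[R[i]]_n) : cdot w v = conj (cdot v w).
Proof.
rewrite /cdot (big_morph conj (@conjD R) (rmorph0 conj)); apply: eq_bigr => j _.
by rewrite conjM conjCK mulrC.
Qed.

Lemma cdotDr n (q v w : 'cV[R[i]]_n) : cdot q (v + w) = cdot q v + cdot q w.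
Proof. by rewrite cdotC cdotDl conjD -!cdotC. Qed.

Lemma cdotZr n a (q v : 'cV[R[i]]_n) : cdot q (a *: v) = conj a * cdot q v.
Proof. by rewrite cdotC cdotZl conjM -!cdotC. Qed.

Lemma cdotN n (v q : 'cV[R[i]]_n) : cdot (- v) (- q) = cdot v q.
Proof. by rewrite /cdot; apply: eq_bigr => j _; rewrite !mxE rmorphN/= mulrNN. Qed.

Lemma cdot0l n (q : 'cV[R[i]]_n) : cdot 0 q = 0.
Proof. by rewrite /cdot big1// => j _; rewrite mxE mul0r. Qed.

Lemma cdot0r n (q : 'cV[R[i]]_n) : cdot q 0 = 0.
Proof. by rewrite cdotC cdot0l rmorph0. Qed.

Lemma cdot_sqnorm n (v : 'cV[R[i]]_n) : cdot v v = (sqnorm v)%:C.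
Proof.
rewrite /sqnorm; apply: eqc => //=; rewrite /cdot.
elim/big_ind: _ => //; first by move=> x y; rewrite Im_addc => -> ->; rewrite addr0.
by move=> j _; rewrite mulc_conjc.
Qed.

Lemma sqnormE n (v : 'cV[R[i]]_n) : sqnorm v = \sum_(j < n) normc (v j 0) ^+ 2.
Proof.
apply: complexI; rewrite -cdot_sqnorm rmorph_sum; apply: eq_bigr => j _.
by rewrite /= mulc_conjc.
Qed.

Lemma sqnorm_ge0 n (v : 'cV[R[i]]_n) : 0 <= sqnorm v.
Proof. by rewrite sqnormE sumr_ge0// => j _; rewrite sqr_ge0. Qed.

Lemma sqnorm_eq0 n (v : 'cV[R[i]]_n) : sqnorm v = 0 -> v = 0.
Proof.
rewrite sqnormE => /eqP; rewrite psumr_eq0; last by move=> j _; rewrite sqr_ge0.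
move=> /allP h; apply/colP => j; rewrite mxE; apply/eqP.
by have := h j (mem_index_enum _); rewrite sqrf_eq0 normc_eq0.
Qed.

Lemma cdot_vcons n a b (v w : 'cV[R[i]]_n) : cdot (vcons a v) (vcons b w) = a * conj b + cdot v w.
Proof.
rewrite /cdot big_ord_recl !vcons0; congr (_ + _).
by apply: eq_bigr => j _; rewrite !vconsS.
Qed.

Lemma sqnorm_vcons n a (v : 'cV[R[i]]_n) : sqnorm (vcons a v) = normc a ^+ 2 + sqnorm v.
Proof.
by apply: complexI; rewrite -cdot_sqnorm cdot_vcons mulc_conjc cdot_sqnorm rmorphD.
Qed.

Lemma sqnorm_scale n a (v : 'cV[R[i]]_n) : sqnorm (a *: v) = normc a ^+ 2 * sqnorm v.
Proof.
apply: complexI; rewrite -cdot_sqnorm cdotZl cdotZr mulrA mulc_conjc cdot_sqnorm.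
by rewrite -rmorphM.
Qed.

End CdotTheory.

Section UnitaryRotation.
Context {R : realType} {n : nat}.

Record vec_isometry (V : 'cV[R[i]]_n -> 'cV[R[i]]_n) : Prop := VecIsometry {
  isom_lin : forall a v w, V (v + a *: w) = V v + a *: V w ;
  isom_cont : forall j, vcont (fun w => V w j 0) ;
  isom_norm : forall w, sqnorm (V w) = sqnorm w ;
  isom_vint : forall F, vmeas F -> (forall z, 0 <= F z)%E -> vint (fun w => F (V w)) = vint F
}.

End UnitaryRotation.

Section UnitaryRotationExistence.
Context {R : realType} {n : nat}.

Let comb_identity (K : comRingType) (A X a Y B S T : K) :
  A * (X + a * Y) - B * (S + a * T) = A * X - B * S + a * (A * Y - B * T).
Proof. by ring. Qed.

Let su2_identity (K : comRingType) (A A' B X Y' S T' W : K) : A * A' + B * B = 1 ->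
  (A * X - B * S) * (A' * Y' - B * T') +
  (W + (B * Y' + (A - 1) * T') * S +
   ((B * X + (A' - 1) * S) * T' + (B * X + (A' - 1) * S) * (B * Y' + (A - 1) * T')))
  = X * Y' + W.
Proof.
move=> h.
transitivity ((A * A' + B * B) * (X * Y') + W + (A * A' + B * B - 1) * (S * T')).
  by ring.
by rewrite h subrr mul0r addr0 mul1r.
Qed.

(* In the plane spanned by e_0 and q this is the element [a, -b; b, conj a] of
   SU(2), which is a product of three shears as b <> 0; on the orthogonal
   complement of that plane it is the identity. *)
Lemma vec_isometry_head (p : 'cV[R[i]]_n.+1) : exists V (l : R[i]),
  [/\ vec_isometry V, V (vcons l 0) = p &
      forall w, cdot (V w) p = conj l * w ord0 0].
Proof.
pose p0 := p ord0 0; pose p' := vtail p.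
have pE : p = vcons p0 p' by rewrite vcons_eta.
have [p'0|/eqP p'n0] := pselect (p' = 0).
  exists id, p0; split; [split=> //; exact: vcont_coord|by rewrite pE p'0|].
  move=> w; rewrite pE p'0 -[w in LHS]vcons_eta cdot_vcons cdot0r addr0.
  by rewrite mulrC.
pose m := Num.sqrt (sqnorm p'); pose l := Num.sqrt (sqnorm p).
have sp' : 0 < sqnorm p'.
  rewrite lt_neqAle sqnorm_ge0 andbT eq_sym; apply: contra p'n0 => /eqP/sqnorm_eq0 ->//.
have sp : 0 < sqnorm p.
  by rewrite pE sqnorm_vcons ltr_wpDl// sqr_ge0.
have m0 : 0 < m by rewrite sqrtr_gt0.
have l0 : 0 < l by rewrite sqrtr_gt0.
have mC : m%:C != 0 :> R[i] by exact: realc_neq0.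
have lC : l%:C != 0 :> R[i] by exact: realc_neq0.
pose q := (m%:C)^-1 *: p'.
have qq : cdot q q = 1.
  rewrite cdot_sqnorm /q sqnorm_scale normc_inv normcR gtr0_norm// exprVn.
  by rewrite /m sqr_sqrtr ?ltW// mulVf// gt_eqF.
have qE : m%:C *: q = p' by rewrite /q scalerA divff// scale1r.
clearbody q.
pose al : R[i] := p0 / l%:C; pose be : R[i] := m%:C / l%:C.
have be0 : be != 0 by rewrite mulf_neq0// invr_eq0.
have conjVr (r : R) : conj r%:C^-1 = r%:C^-1 :> R[i] by rewrite conjV conj_real.
have beJ : conj be = be by rewrite /be conjM conjVr conj_real.
have ab : al * conj al + be * be = 1.
  rewrite /al /be conjM conjVr.
  have -> : p0 / l%:C * (conj p0 / l%:C) + m%:C / l%:C * (m%:C / l%:C) =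
     (p0 * conj p0 + m%:C * m%:C) / (l%:C * l%:C) by rewrite invfM mulrDl; congr (_ + _); rewrite mulrACA.
  rewrite -!rmorphM -!expr2 !sqr_sqrtr ?ltW// mulc_conjc -rmorphD -sqnorm_vcons -pE.
  by rewrite divff// realc_neq0.
have alE : al * l%:C = p0 by rewrite /al divfK.
have beE : be * l%:C = m%:C by rewrite /be divfK.
clearbody al be.
(* The diagonal entries force the slopes: [1 - be * x1 = al] and [1 - x2 * be = conj al]. The
   remaining entry [x1 + x2 * al = be] then follows from the determinant [ab]. *)
pose x1 := (1 - al) / be; pose x2 := (1 - conj al) / be.
pose V w := tail_shear x2 q (head_shear (- be) q (tail_shear x1 q w)).
have VE z v : V (vcons z v) = vcons (al * z - be * cdot v q)
    (v + (be * z + (conj al - 1) * cdot v q) *: q).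
  rewrite /V /tail_shear /head_shear !(vcons0, vtail_cons) cdotDl cdotZl qq mulr1.
  have e1 : z + - be * (cdot v q + x1 * z) = al * z - be * cdot v q.
    have -> : z + - be * (cdot v q + x1 * z) = (1 - be * x1) * z - be * cdot v q.
      by rewrite mulrDr mulrDl mul1r !mulNr mulrA addrA addrAC.
    have bx1 : be * x1 = 1 - al by rewrite /x1 mulrC divfK.
    by rewrite bx1 subKr.
  rewrite e1; congr vcons; rewrite -addrA -scalerDl; congr (_ + _ *: _).
  have e2 : x1 + x2 * al = be.
    have e : (x1 + x2 * al) * be = be * be.
      have x1b : x1 * be = 1 - al by rewrite /x1 divfK.
      have x2b : x2 * be = 1 - conj al by rewrite /x2 divfK.
      rewrite mulrDl x1b mulrAC x2b mulrBl mul1r [conj al * al]mulrC addrA subrK.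
      by rewrite -[in LHS]ab addrC addKr.
    exact: (mulIf be0 e).
  have e3 : x2 * be = 1 - conj al by rewrite /x2 divfK.
  have alg (a b c d s t : R[i]) : a * d + (b * c * d - (1 - t) * s) = (a + b * c) * d + (t - 1) * s.
    by ring.
  by rewrite mulrBr !mulrA e3 alg e2.
have linV a v w : V (v + a *: w) = V v + a *: V w.
  rewrite -[v]vcons_eta -[w]vcons_eta.
  have vconsDZ (x y : R[i]) (s t : 'cV[R[i]]_n) :
      vcons x s + a *: vcons y t = vcons (x + a * y) (s + a *: t).
    by apply/colP => j; case: (unliftP ord0 j) => [k|] ->; rewrite !mxE ?unlift_none ?liftK/= ?mxE.
  rewrite vconsDZ.
  rewrite !VE vconsDZ.
  rewrite cdotDl cdotZl; move: (v ord0 0) (w ord0 0) (cdot (vtail v) q) (cdot (vtail w) q) => X Y S T.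
  congr vcons; first exact: comb_identity.
  rewrite [in RHS]scalerDr [in RHS]addrACA scalerA -scalerDl; congr (_ + _ *: _).
  have := comb_identity be X a Y (1 - conj al) S T.
  by rewrite -!mulNr opprB.
have cVV (w w' : 'cV[R[i]]_n.+1) : cdot (V w) (V w') = cdot w w'.
  rewrite -[w]vcons_eta -[w']vcons_eta !VE !cdot_vcons.
  rewrite !(cdotDl, cdotDr, cdotZl, cdotZr) qq mulr1 [cdot q _]cdotC.
  rewrite !(conjB, conjD, conjM) conjCK rmorph1 beJ.
  exact: su2_identity.
have Vl : V (vcons l%:C 0) = p.
  by rewrite VE cdot0l !mulr0 subr0 addr0 add0r [RHS]pE alE beE qE.
exists V, l%:C; split=> [|//|w].
  split=> //.
  - move=> j; apply: (vcont_compV (V := tail_shear x1 q) (@vcont_tail_shear _ _ _ _)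
      (g := fun w => tail_shear x2 q (head_shear (- be) q w) j 0)).
    apply: (vcont_compV (V := head_shear (- be) q) (@vcont_head_shear _ _ _ _)
      (g := fun w => tail_shear x2 q w j 0)).
    exact: vcont_tail_shear.
  - by move=> w; apply: complexI; rewrite -!cdot_sqnorm cVV.
  - move=> F mF F0.
    have m2 : vmeas (fun w => F (tail_shear x2 q w)).
      by apply: (vmeas_vcont (V := tail_shear x2 q) mF); exact: vcont_tail_shear.
    have m1 : vmeas (fun w => F (tail_shear x2 q (head_shear (- be) q w))).
      by apply: (vmeas_vcont (V := head_shear (- be) q) m2); exact: vcont_head_shear.
    rewrite -[RHS](vint_tail_shear x2 q mF F0).
    rewrite -[RHS](vint_head_shear (- be) q m2 (fun _ => F0 _)).
    by rewrite -[RHS](vint_tail_shear x1 q m1 (fun _ => F0 _)).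
rewrite -Vl cVV -[w in LHS]vcons_eta cdot_vcons cdot0r addr0 mulrC.
by [].
Qed.

End UnitaryRotationExistence.

(** * Radial integrals *)

Section RadialMeasure.
Context {R : realType}.
Local Notation leb := (@lebesgue_measure R).
Local Notation plane := (measurableTypeR R * measurableTypeR R)%type.

Lemma ge0_integral_dilate (c : R) (f : R -> \bar R) : 0 < c ->
  measurable_fun setT f -> (forall x, 0 <= f x)%E ->
  (\int[leb]_x f x = c%:E * \int[leb]_x f (c * x)%R)%E.
Proof.
move=> c0 mf f0.
have mc : measurable_fun setT (fun x : measurableTypeR R => (c * x : measurableTypeR R)).
  by apply: measurable_funM.
pose push := measure_function_pushforward__canonical__measure_function_Measure leb mc.
pose m := mscale (NngNum (ltW c0)) push.
have mE A : measurable A -> leb A = m A.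
  apply: (@lebesgue_measure_unique R m) => _ [[a b]] _ <-.
  have pre : (fun x : measurableTypeR R => c * x : measurableTypeR R) @^-1` `]a, b]%classic =
      `]a / c, b / c]%classic.
    by apply/seteqP; split => x /=; rewrite !in_itv/= ltr_pdivrMr// ler_pdivlMr// mulrC.
  transitivity (c%:E * leb (`](a / c)%R, (b / c)%R]%classic))%E; last by rewrite -pre.
  rewrite !lebesgue_measure_itv/= !lte_fin ltr_pM2r ?invr_gt0//.
  case: ifP => _; last by rewrite mule0.
  rewrite -!EFinB -EFinM; congr EFin; field; exact: lt0r_neq0.
transitivity (\int[m]_x f x)%E.
  by apply: eq_measure_integral => A mA _; exact: mE.
rewrite ge0_integral_mscale//; congr (_ * _)%E.
have := @ge0_integral_pushforward _ _ _ _ R _ mc leb setT f measurableT mf (fun x _ => f0 x).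
by rewrite preimage_setT.
Qed.

Definition sqsum (z : plane) : measurableTypeR R := z.1 ^+ 2 + z.2 ^+ 2.

Lemma measurable_sqsum : measurable_fun setT sqsum.
Proof.
apply: measurable_funD.
  by apply: measurable_funX; exact: measurable_fst.
by apply: measurable_funX; exact: measurable_snd.
Qed.

(** The law of the squared radius. It will be identified on the half line with [pi] times Lebesgue
    measure, which is polar coordinates without an angular variable. *)
Definition radial_measure :=
  measure_function_pushforward__canonical__measure_function_Measure
    ((leb \x leb)%E : measure plane R) measurable_sqsum.

Lemma plint_sqsum (F : R -> \bar R) : measurable_fun setT F -> (forall x, 0 <= F x)%E ->
  plint (fun x y => F (x ^+ 2 + y ^+ 2)) = (\int[radial_measure]_(s in `[0%R, +oo[) F s)%E.
Proof.
move=> mF F0.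
have mD : measurable (`[0%R, +oo[%classic : set (measurableTypeR R)) by exact: measurable_itv.
have h := @ge0_integral_pushforward _ _ _ _ R _ measurable_sqsum
  ((leb \x leb)%E : measure plane R) `[0%R, +oo[%classic F mD
  (measurable_funS measurableT (subsetT _) mF) (fun x _ => F0 x).
apply: etrans (esym h).
have -> : sqsum @^-1` `[0%R, +oo[%classic = setT.
  apply/seteqP; split => // z _ /=; rewrite in_itv/= andbT.
  by rewrite addr_ge0 ?sqr_ge0.
have mFs : measurable_fun setT (F \o sqsum) by exact: measurableT_comp measurable_sqsum.
exact/esym/(@fubini_tonelli2 _ _ _ _ R leb leb (F \o sqsum) mFs (fun z => F0 _)).
Qed.

Let ray (t : R) : set (measurableTypeR R) := `]-oo, t[%classic.

Let mray t : measurable (ray t).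
Proof. exact: measurable_itv. Qed.

Lemma radial_measureE (A : set (measurableTypeR R)) : measurable A ->
  radial_measure A = plint (fun x y => (\1_A (x ^+ 2 + y ^+ 2))%:E).
Proof.
move=> mA; rewrite (plint_sqsum (F := fun s => (\1_A s)%:E)); last 2 first.
- by apply/measurable_EFinP; exact: measurable_indic.
- by move=> s; rewrite lee_fin.
have mD : measurable (`[0%R, +oo[%classic : set (measurableTypeR R)) by exact: measurable_itv.
rewrite (integral_indic radial_measure mD mA).
rewrite /= /pushforward preimage_setI; congr ((_ \x _)%E _).
apply/seteqP; split => z /=; last by case.
by move=> Az; split=> //; rewrite in_itv/= andbT addr_ge0 ?sqr_ge0.
Qed.

Let kap := radial_measure (ray 1).

Let kap_ge0 : (0 <= kap)%E.
Proof. exact: measure_ge0. Qed.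

(** [kap] is the area of the unit disc, which lies in a square of side 2. *)
Let kap_fin : (kap < +oo)%E.
Proof.
pose I1 : set (measurableTypeR R) := `[(-1)%R, 1%R]%classic.
have mI : measurable I1 by exact: measurable_itv.
have I1fin : (leb I1 < +oo)%E.
  by rewrite lebesgue_measure_itv; case: ifP => _; rewrite ?ltry// -EFinD ltry.
have s1 (a b : R) : a ^+ 2 + b ^+ 2 < 1 -> -1 <= a <= 1.
  move=> h; rewrite -ler_norml -(ler_pXn2r (n := 2))// ?nnegrE// expr1n real_normK ?num_real//.
  by have := sqr_ge0 b; lra.
apply: (@le_lt_trans _ _ ((leb \x leb)%E (I1 `*` I1))).
  rewrite /kap /= /pushforward; apply: le_measure; rewrite ?inE.
  - by rewrite -[X in measurable X]setTI; apply: measurable_sqsum.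
  - exact: measurableX.
  - move=> z /=; rewrite /ray/= in_itv/= => h; split; rewrite /I1/= in_itv/=.
      exact: s1 h.
    by apply: s1; rewrite addrC; exact: h.
rewrite product_measure1E//; apply: lte_mul_pinfty => //.
by rewrite ge0_fin_numE.
Qed.

(** Dilating both coordinates by the square root of [t] maps the unit disc to the disc of squared
    radius [t] and multiplies areas by [t]. *)
Let radial_ray t : radial_measure (ray t) = ((Num.max 0 t)%:E * kap)%E.
Proof.
have [t0|t0] := leP t 0.
  rewrite mul0e /= /pushforward.
  have -> : sqsum @^-1` ray t = set0.
    apply/seteqP; split => z //=; rewrite /ray/= in_itv/= => h.
    by have := lt_le_trans h t0; rewrite ltNge addr_ge0 ?sqr_ge0.
  by rewrite measure0.
pose c := Num.sqrt t; have c0 : 0 < c by rewrite sqrtr_gt0.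
have cc : c ^+ 2 = t by rewrite sqr_sqrtr// ltW.
rewrite /kap !radial_measureE//.
have mi A : measurable A -> measurable_fun setT (fun z : plane => (\1_A (z.1 ^+ 2 + z.2 ^+ 2))%:E : \bar R).
  move=> mA; apply/measurable_EFinP.
  apply: (measurableT_comp (f := \1_A : measurableTypeR R -> R) (g := sqsum)); last exact: measurable_sqsum.
  exact: measurable_indic.
pose G x y : \bar R := (\1_(ray t) (x ^+ 2 + y ^+ 2))%:E.
have G0 x y : (0 <= G x y)%E by rewrite lee_fin.
have mG : plmeas G by exact: (mi _ (mray t)).
have mGy y : measurable_fun setT (G ^~ y) by exact: (measurableT_comp mG (measurable_pair2 y)).
rewrite -[LHS]/(plint G).
have m1 : measurable_fun setT (fun y => \int[leb]_x G x y)%E.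
  exact: (measurable_fun_fubini_tonelli_G (m1 := leb) (fun z => G z.1 z.2) mG (fun z => G0 _ _)).
rewrite /plint (ge0_integral_dilate c0 m1); last by move=> y; apply: integral_ge0.
pose H x y : \bar R := (\1_(ray 1) (x ^+ 2 + y ^+ 2))%:E.
have H0 x y : (0 <= H x y)%E by rewrite lee_fin.
have mH : plmeas H by exact: (mi _ (mray 1)).
have GH x y : G (c * x) (c * y) = H x y.
  rewrite /G /H !indicE; congr ((nat_of_bool _)%:R%:E).
  rewrite /ray !mem_setE !in_itv/= !exprMn cc -mulrDr -[X in _ < X]mulr1.
  by rewrite ltr_pM2l.
have e (y : R) : (\int[leb]_x G x (c * y)%R = c%:E * \int[leb]_x H x y)%E.
  rewrite (ge0_integral_dilate c0 (mGy (c * y)) (fun x => G0 x _)); congr (_ * _)%E.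
  by apply: eq_integral => x _; exact: GH.
under eq_integral do rewrite e.
have m2 : measurable_fun setT (fun y => \int[leb]_x H x y)%E.
  exact: (measurable_fun_fubini_tonelli_G (m1 := leb) (fun z => H z.1 z.2) mH (fun z => H0 _ _)).
rewrite ge0_integralZl_EFin//; last 2 first.
- by move=> y _; apply: integral_ge0.
- exact: ltW.
by rewrite muleA -EFinM -expr2 cc.
Qed.

(** Open rays form a generating family stable under intersection on which both measures are finite
    and agree, so the measures coincide. *)
Let radial_eq_kap (A : set (measurableTypeR R)) : measurable A -> A `<=` `[0%R, +oo[%classic ->
  radial_measure A = (kap * leb A)%E.
Proof.
move=> mA AD.
have mD : measurable (`[0%R, +oo[%classic : set (measurableTypeR R)) by exact: measurable_itv.
have k0 : 0 <= fine kap by exact: fine_ge0.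
have kE : kap = (fine kap)%:E by rewrite fineK// (ge0_fin_numE kap_ge0).
pose m2 := (mscale (NngNum k0) (mrestr leb mD) : measure (measurableTypeR R) R).
have m2E B : m2 B = (kap * leb (B `&` `[0%R, +oo[%classic))%E by rewrite kE.
suff -> : radial_measure A = m2 A by rewrite m2E setIidl.
apply: (@measure_unique _ R (measurableTypeR R) (@RGenInftyO.G R)
  (fun k : nat => ray k%:R) _ _ _ _ radial_measure m2).
- exact: RGenInftyO.measurableE.
- move=> _ _ [x ->] [y ->]; exists (Num.min x y).
  apply/seteqP; split => z /=; rewrite !in_itv/= lt_min; last by move=> /andP[].
  by move=> [-> ->].
- by move=> k; exists k%:R.
- apply/seteqP; split => // x _; exists (Num.truncn x).+1 => //=.
  by rewrite /ray/= in_itv/= truncnS_gt.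
- move=> _ [t ->]; rewrite -/(ray t) radial_ray m2E muleC; congr (_ * _)%E.
  have [t0|t0] := leP t 0.
    have -> : ray t `&` `[0%R, +oo[%classic = set0.
      apply/seteqP; split => z //= []; rewrite /ray/= !in_itv/= andbT => h1 h2.
      by have := lt_le_trans h1 t0; rewrite ltNge h2.
    by rewrite measure0.
  have -> : ray t `&` `[0%R, +oo[%classic = `[0%R, t[%classic.
    apply/seteqP; split => z; rewrite /ray/= !in_itv/= andbT; last by move=> /andP[].
    by move=> [-> ->].
  by rewrite lebesgue_measure_itv/= lte_fin t0 oppr0 adde0.
- move=> k; rewrite [X in (X < _)%E](radial_ray k%:R); apply: lte_mul_pinfty.
  + by rewrite lee_fin le_max lexx.
  + by [].
  + exact: kap_fin.
- exact: mA.
Qed.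

Let plint_kap (F : R -> \bar R) : measurable_fun setT F -> (forall x, 0 <= F x)%E ->
  plint (fun x y => F (x ^+ 2 + y ^+ 2)) = (kap * \int[leb]_(s in `[0%R, +oo[) F s)%E.
Proof.
move=> mF F0; rewrite plint_sqsum//.
have k0 : 0 <= fine kap by exact: fine_ge0.
have kE : kap = (fine kap)%:E by rewrite fineK// (ge0_fin_numE kap_ge0).
transitivity (\int[mscale (NngNum k0) leb]_(s in `[0%R, +oo[) F s)%E.
  apply: eq_measure_integral => A mA AD.
  rewrite [LHS](radial_eq_kap mA AD).
  by transitivity ((fine kap)%:E * leb A)%E; [rewrite -kE|].
have mD : measurable (`[0%R, +oo[%classic : set (measurableTypeR R)) by exact: measurable_itv.
rewrite (ge0_integral_mscale leb mD (NngNum k0)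
  (measurable_funS measurableT (subsetT _) mF) (fun x _ => F0 x)).
by congr (_ * _)%E; rewrite [RHS]kE.
Qed.

(* The integral of [e^-(x^2 + y^2)] over the plane fixes the constant. *)
Let kap_pi : kap = pi%:E.
Proof.
pose F (s : R) := (expR (- s))%:E : \bar R.
have mF : measurable_fun setT F.
  apply/measurable_EFinP; apply: continuous_measurable_fun => x.
  by apply: (@continuous_comp _ _ _ (@GRing.opp R) expR); [exact: opp_continuous|exact: continuous_expR].
have F0 x : (0 <= F x)%E by rewrite lee_fin expR_ge0.
have := plint_kap mF F0.
have -> : (\int[leb]_(s in `[0%R, +oo[) F s = 1)%E.
  have := @integral_exponential_pdf R 1 ltr01.
  rewrite /exponential_pdf => <-.
  rewrite integral_mkcond; apply: eq_integral => x _.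
  by rewrite !patchE; case: ifP => // _; rewrite /F mulN1r mul1r.
rewrite mule1 => <-.
have -> : plint (fun x y => F (x ^+ 2 + y ^+ 2)) = (\int[leb]_y ((gauss_fun y)%:E * (Num.sqrt pi)%:E))%E.
  apply: eq_integral => y _; rewrite -integralT_gauss.
  have FE x : F (x ^+ 2 + y ^+ 2) = ((gauss_fun y)%:E * (gauss_fun x)%:E)%E.
    by rewrite /F /gauss_fun -EFinM -expRD opprD addrC.
  under eq_integral do rewrite FE.
  rewrite ge0_integralZl_EFin ?expR_ge0//.
    by move=> x _; rewrite lee_fin expR_ge0.
  by apply/measurable_EFinP; exact: measurable_gauss_fun.
rewrite ge0_integralZr//.
- by rewrite integralT_gauss -EFinM -expr2 sqr_sqrtr// pi_ge0.
- by apply/measurable_EFinP; exact: measurable_gauss_fun.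
- by move=> x _; rewrite lee_fin expR_ge0.
Qed.

Lemma plint_polar (F : R -> \bar R) : measurable_fun setT F -> (forall x, 0 <= F x)%E ->
  plint (fun x y => F (x ^+ 2 + y ^+ 2)) = (pi%:E * \int[leb]_(s in `[0%R, +oo[) F s)%E.
Proof. by move=> mF F0; rewrite plint_kap// kap_pi. Qed.

End RadialMeasure.

Section RadialIntegrals.
Context {R : realType}.
Local Notation leb := (@lebesgue_measure R).
Local Notation plane := (measurableTypeR R * measurableTypeR R)%type.
Local Notation D := (`[0%R, +oo[%classic : set R).
Implicit Types (F G H : R -> \bar R).

Let mD : measurable (D : set (measurableTypeR R)).
Proof. exact: measurable_itv. Qed.

Lemma integral_indicator (A : set (measurableTypeR R)) F :
  (\int[leb]_(x in A) F x = \int[leb]_x (F x * (\1_A x)%:E))%E.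
Proof. by rewrite integral_mkcond epatch_indic. Qed.

(** Integrating out one complex coordinate turns a function [G] of the squared norm into [pi] times
    [rint G] of the squared norm of the other coordinates. *)
Definition rint G s : \bar R := (\int[leb]_(u in D) G (s + u)%R)%E.

Lemma rint_ge0 G s : (forall x, 0 <= G x)%E -> (0 <= rint G s)%E.
Proof. by move=> G0; apply: integral_ge0 => u _; exact: G0. Qed.

Let mind (A : set (measurableTypeR R)) : measurable A ->
  measurable_fun setT (fun x : measurableTypeR R => (\1_A x)%:E : \bar R).
Proof. by move=> mA; apply/measurable_EFinP; exact: measurable_indic. Qed.

Let madd : measurable_fun setT (fun z : plane => z.1 + z.2 : measurableTypeR R).
Proof. by apply: measurable_funD; [exact: measurable_fst|exact: measurable_snd]. Qed.

Lemma measurable_rint G : measurable_fun setT G -> (forall x, 0 <= G x)%E ->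
  measurable_fun setT (rint G).
Proof.
move=> mG G0; pose f (z : plane) := (G (z.1 + z.2)%R * (\1_D z.2)%:E)%E.
have mf : measurable_fun setT f.
  apply: emeasurable_funM; first exact: (measurableT_comp mG madd).
  exact: (measurableT_comp (mind mD) measurable_snd).
have f0 z : (0 <= f z)%E by rewrite mule_ge0// lee_fin.
have := measurable_fun_fubini_tonelli_F (m2 := leb) f mf f0.
by congr measurable_fun; apply/funext => s; rewrite /rint integral_indicator.
Qed.

Lemma rint_tail H s : measurable_fun setT H -> (forall x, 0 <= H x)%E ->
  rint H s = (\int[leb]_t (H t * (\1_D (t - s)%R)%:E))%E.
Proof.
move=> mH H0; rewrite /rint integral_indicator.
pose f (t : R) := (H t * (\1_D (t - s)%R)%:E)%E.
have mf : measurable_fun setT f.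
  apply: emeasurable_funM => //.
  apply: (measurableT_comp (f := fun x => (\1_D x)%:E : \bar R)
      (g := fun t : measurableTypeR R => t - s : measurableTypeR R)).
    exact: mind.
  exact: measurable_funB.
have f0 t : (0 <= f t)%E by rewrite mule_ge0// lee_fin.
rewrite -[RHS](ge0_integral_translate s mf f0); apply: eq_integral => u _.
by rewrite /f [s + u]addrC addrK.
Qed.

Lemma integral0_exprn k (t : R) : 0 <= t ->
  (\int[leb]_(s in `[0%R, t]) (s ^+ k)%:E = (t ^+ k.+1 / k.+1%:R)%:E)%E.
Proof.
rewrite le_eqVlt => /predU1P[<-|t0].
  by rewrite set_itv1 integral_set1 exprS mul0r mul0r.
pose P (x : R) := x ^+ k.+1 / k.+1%:R.
have dP x : is_derive x (1 : R) P (x ^+ k).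
  have -> : P = (k.+1%:R^-1 : R) *: ((@id R) ^+ k.+1).
    by apply/funext => y; rewrite /P mulrC; congr (_ * _); rewrite exprfctE.
  apply: is_derive_eq.
  by rewrite /GRing.scale/= mulr1 mulrA mulVf ?mul1r// pnatr_eq0.
have cP x : {for x, continuous P}.
  by apply: differentiable_continuous; apply/derivable1_diffP; exact: (@ex_derive _ _ _ _ _ _ _ (dP x)).
rewrite (@continuous_FTC2 _ _ P)//.
- by rewrite -EFinB /P [0 ^+ _]exprS mul0r mul0r subr0.
- by apply: continuous_subspaceT => x; exact: exprn_continuous.
- split => [x _| |]; first exact: (@ex_derive _ _ _ _ _ _ _ (dP x)).
  + by apply: cvg_at_right_filter; exact: cP.
  + by apply: cvg_at_left_filter; exact: cP.
- by move=> x _; rewrite derive1E; exact: derive_val.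
Qed.

(** Exchanging the integrals over [0 <= s <= t] leaves the inner integral of [s ^+ k] from 0 to
    [t]. *)
Lemma moment_rint H k : measurable_fun setT H -> (forall x, 0 <= H x)%E ->
  (\int[leb]_(s in D) ((s ^+ k)%:E * rint H s) =
   (k.+1%:R^-1)%:E * \int[leb]_(t in D) ((t ^+ k.+1)%:E * H t))%E.
Proof.
move=> mH H0.
(* The absolute value makes [f] nonnegative on the whole plane, as Tonelli's theorem asks; the
   indicators confine it to [0 <= s <= t]. *)
pose f (z : plane) := ((`|z.1| ^+ k)%:E * (\1_D z.1)%:E * (H z.2 * (\1_D (z.2 - z.1)%R)%:E))%E.
have mX : measurable_fun setT (fun s : measurableTypeR R => (`|s| ^+ k)%:E : \bar R).
  by apply/measurable_EFinP; apply: measurable_funX; exact: normr_measurable.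
have mf : measurable_fun setT f.
  apply: emeasurable_funM; first apply: emeasurable_funM.
  - exact: (measurableT_comp mX measurable_fst).
  - exact: (measurableT_comp (mind mD) measurable_fst).
  - apply: emeasurable_funM; first exact: (measurableT_comp mH measurable_snd).
    apply: (measurableT_comp (f := fun x => (\1_D x)%:E : \bar R)
      (g := fun z : plane => z.2 - z.1 : measurableTypeR R)).
      exact: mind.
    by apply: measurable_funB; [exact: measurable_snd|exact: measurable_fst].
have f0 z : (0 <= f z)%E by rewrite !mule_ge0// lee_fin ?exprn_ge0.
transitivity (\int[leb]_s \int[leb]_t f (s, t))%E.
  rewrite integral_indicator; apply: eq_integral => s _.
  have m1 : measurable_fun setT (fun t => H t * (\1_D (t - s)%R)%:E)%E.
    apply: emeasurable_funM => //.
    apply: (measurableT_comp (f := fun x => (\1_D x)%:E : \bar R)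
      (g := fun t : measurableTypeR R => t - s : measurableTypeR R)).
      exact: mind.
    exact: measurable_funB.
  have p1 t : setT t -> (0 <= H t * (\1_D (t - s)%R)%:E)%E by rewrite mule_ge0// lee_fin.
  have c1 : (0 <= (`|s| ^+ k)%:E * (\1_D s)%:E)%E by rewrite mule_ge0// lee_fin exprn_ge0.
  rewrite /f/= ge0_integralZl// -rint_tail// muleAC; case: (boolP (s \in D)) => sD.
    have s0 : 0 <= s by move: sD; rewrite inE/= in_itv/= andbT.
    by rewrite ger0_norm.
  by rewrite indicE (negPf sD)/= !mule0.
rewrite (fubini_tonelli f mf f0).
have c1 : (0 <= (k.+1%:R^-1 : R)%:E)%E by rewrite lee_fin invr_ge0.
have p1 t : setT t -> (0 <= (t ^+ k.+1)%:E * H t * (\1_D t)%:E)%E.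
  move=> _; rewrite indicE; case: (boolP (t \in D)) => tD; rewrite ?mule0//= mule1 mule_ge0//.
  by rewrite lee_fin exprn_ge0//; move: tD; rewrite inE/= in_itv/= andbT.
have m1 : measurable_fun setT (fun t : measurableTypeR R => (t ^+ k.+1)%:E * H t * (\1_D t)%:E)%E.
  apply: emeasurable_funM; last exact: mind.
  by apply: emeasurable_funM => //; apply/measurable_EFinP; apply: measurable_funX; exact: measurable_id.
rewrite integral_indicator -ge0_integralZl//.
apply: eq_integral => t _; rewrite /f/=.
have fE s : ((`|s| ^+ k)%:E * (\1_D s)%:E * (H t * (\1_D (t - s)%R)%:E) =
    H t * ((`|s| ^+ k)%:E * (\1_(`[0%R, t]) s)%:E))%E.
  rewrite muleCA; congr (_ * _)%E; rewrite -muleA; congr (_ * _)%E.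
  rewrite -EFinM; congr EFin; rewrite !indicE -natrM mulnb; congr (nat_of_bool _)%:R.
  by rewrite !mem_setE !in_itv/= !andbT subr_ge0.
under eq_integral do rewrite fE.
have mi : measurable_fun setT (fun s : measurableTypeR R => (`|s| ^+ k)%:E * (\1_(`[0%R, t]) s)%:E : \bar R)%E.
  by apply: emeasurable_funM => //; apply: mind; exact: measurable_itv.
have p2 s : setT s -> (0 <= (`|s| ^+ k)%:E * (\1_(`[0%R, t]) s)%:E :> \bar R)%E.
  by move=> _; rewrite mule_ge0// lee_fin exprn_ge0.
rewrite ge0_integralZl//.
rewrite -integral_indicator.
have [t0|t0] := leP 0 t.
  have tD : t \in D by rewrite inE/= in_itv/= andbT.
  have -> : (\int[leb]_(s in `[0%R, t]) (`|s| ^+ k)%:E = \int[leb]_(s in `[0%R, t]) (s ^+ k)%:E)%E.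
    by apply: eq_integral => s; rewrite inE/= in_itv/= => /andP[s0 _]; rewrite ger0_norm.
  rewrite integral0_exprn// indicE tD/= mule1 muleA -EFinM muleC; congr (_%:E * _)%E.
  by rewrite mulrC.
have tD : (t \in D) = false by apply/negbTE/negP; rewrite inE/= in_itv/= andbT leNgt t0.
by rewrite set_itv_ge ?bnd_simp -?ltNge// integral_set0 mule0 indicE tD !mule0.
Qed.

Lemma measurable_iter_rint n G : measurable_fun setT G -> (forall x, 0 <= G x)%E ->
  measurable_fun setT (iter n rint G) /\ (forall x, 0 <= iter n rint G x)%E.
Proof.
move=> mG G0; elim: n => [//|n [IH1 IH2]] /=.
by split; [exact: measurable_rint|move=> x; exact: rint_ge0].
Qed.

(** The factors [1 / (k + 1)], ..., [1 / (k + n)] of the successive steps multiply to the quotient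
    of factorials. *)
Lemma moment_iter_rint n k G : measurable_fun setT G -> (forall x, 0 <= G x)%E ->
  (\int[leb]_(s in D) ((s ^+ k)%:E * iter n rint G s) =
   (k`!%:R / (k + n)`!%:R)%:E * \int[leb]_(t in D) ((t ^+ (k + n))%:E * G t))%E.
Proof.
move=> mG G0; elim: n k => [|n IH] k.
  by rewrite addn0 divff ?mul1e// pnatr_eq0 -lt0n fact_gt0.
have [m1 m2] := measurable_iter_rint n mG G0.
rewrite /= moment_rint// IH muleA -EFinM addSnnS; congr (_%:E * _)%E.
have h1 : (k.+1%:R : R) != 0 by rewrite pnatr_eq0.
by rewrite factS natrM mulrA mulrA mulVf// mul1r.
Qed.

Lemma measurable_sqnorm n :
  measurable_fun setT (fun t : n.-tuple plane => sqnorm (vec_of_plane t)).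
Proof.
have cc : vcont (fun v : 'cV[R[i]]_n => cdot v v).
  rewrite /cdot; apply: vcont_sum => j; apply: vcontM; first exact: vcont_coord.
  by apply: vcontJ; exact: vcont_coord.
by have [] := measurable_vcont (@measurable_Re_vec R n) (@measurable_Im_vec R n) cc.
Qed.

Lemma vmeas_radial n G s : measurable_fun setT G ->
  vmeas (fun v : 'cV[R[i]]_n => G (s + sqnorm v)).
Proof.
move=> mG; apply: (measurableT_comp (f := G)
  (g := fun t : n.-tuple plane => s + sqnorm (vec_of_plane t) : measurableTypeR R) mG).
apply: measurable_funD; first exact: measurable_cst.
exact: measurable_sqnorm.
Qed.

Lemma vint_radial n G s : measurable_fun setT G -> (forall x, 0 <= G x)%E ->
  vint (fun v : 'cV[R[i]]_n => G (s + sqnorm v)) = ((pi ^+ n)%:E * iter n rint G s)%E.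
Proof.
move=> mG G0; elim: n s => [|n IH] s.
  rewrite expr0 mul1e /vint [LHS]integral_dirac//; last exact: vmeas_radial.
  by rewrite diracT mul1e (_ : sqnorm _ = 0) ?addr0// sqnormE big_ord0.
have [m1 m2] := measurable_iter_rint n mG G0.
rewrite (vint_S1 (vmeas_radial s mG) (fun _ => G0 _)).
pose F u := ((pi ^+ n)%:E * iter n rint G (s + u)%R)%E.
have mF0 : measurable_fun setT (fun u : measurableTypeR R => iter n rint G (s + u)%R).
  apply: (measurableT_comp (f := iter n rint G)
    (g := fun u : measurableTypeR R => s + u : measurableTypeR R)) => //.
  exact: measurable_funD.
have mF : measurable_fun setT F by exact: measurable_funeM.
have pn0 : 0 <= pi ^+ n :> R by rewrite exprn_ge0// pi_ge0.
have F0 u : (0 <= F u)%E by rewrite mule_ge0// lee_fin.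
have -> : plint (fun x y => vint (fun v : 'cV[R[i]]_n => G (s + sqnorm (vcons (x +i* y) v)))) =
   plint (fun x y => F (x ^+ 2 + y ^+ 2)).
  apply: eq_plint => x y; rewrite /F -IH; apply: eq_vint => v.
  by rewrite sqnorm_vcons sqr_normcE addrA.
rewrite (plint_polar mF F0) /F exprS EFinM -muleA; congr (_ * _)%E.
rewrite ge0_integralZl//; last exact: measurable_funS mF0.
Qed.

Lemma vint_head_moment n k G : measurable_fun setT G -> (forall x, 0 <= G x)%E ->
  vint (fun w : 'cV[R[i]]_n.+1 => ((normc (w ord0 0) ^+ 2) ^+ k)%:E * G (sqnorm w))%E =
  ((pi ^+ n.+1 * (k`!%:R / (k + n)`!%:R))%:E * \int[leb]_(t in D) ((t ^+ (k + n))%:E * G t))%E.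
Proof.
move=> mG G0; have [m1 m2] := measurable_iter_rint n mG G0.
have mX : measurable_fun setT (fun s : measurableTypeR R => (`|s| ^+ k)%:E : \bar R).
  by apply/measurable_EFinP; apply: measurable_funX; exact: normr_measurable.
have mQ : vmeas (fun w : 'cV[R[i]]_n.+1 => ((normc (w ord0 0) ^+ 2) ^+ k)%:E * G (sqnorm w))%E.
  apply: emeasurable_funM.
    apply/measurable_EFinP; apply: measurable_funX; apply: measurable_funX.
    have := measurable_vcont (@measurable_Re_vec R n.+1) (@measurable_Im_vec R n.+1)
      (vcont_norm (@vcont_coord R n.+1 ord0)).
    by move=> [].
  by have := vmeas_radial (n := n.+1) 0 mG; under [X in vmeas X]funext do rewrite add0r.
have Q0 (w : 'cV[R[i]]_n.+1) : (0 <= ((normc (w ord0 0) ^+ 2) ^+ k)%:E * G (sqnorm w))%E.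
  by rewrite mule_ge0// lee_fin exprn_ge0// sqr_ge0.
rewrite (vint_S1 mQ Q0).
pose F u := ((`|u| ^+ k)%:E * ((pi ^+ n)%:E * iter n rint G u))%E.
have mF1 : measurable_fun setT (fun u => (pi ^+ n)%:E * iter n rint G u)%E by exact: measurable_funeM.
have mF : measurable_fun setT F by exact: emeasurable_funM.
have pn0 : 0 <= pi ^+ n :> R by rewrite exprn_ge0// pi_ge0.
have F0 u : (0 <= F u)%E by rewrite !mule_ge0// lee_fin ?exprn_ge0.
have -> : plint (fun x y => vint (fun v : 'cV[R[i]]_n =>
    ((normc (vcons (x +i* y) v ord0 0) ^+ 2) ^+ k)%:E * G (sqnorm (vcons (x +i* y) v)))%E) =
   plint (fun x y => F (x ^+ 2 + y ^+ 2)).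
  apply: eq_plint => x y; rewrite /F ger0_norm ?addr_ge0 ?sqr_ge0//.
  rewrite -(vint_radial n (x ^+ 2 + y ^+ 2) mG G0) /vint -ge0_integralZl//.
  - apply: eq_integral => t _; rewrite vcons0 sqr_normcE/=; congr (_ * G _)%E.
    by rewrite sqnorm_vcons sqr_normcE.
  - exact: vmeas_radial.
  - by rewrite lee_fin exprn_ge0// addr_ge0 ?sqr_ge0.
rewrite (plint_polar mF F0) exprS.
have -> : (\int[leb]_(s in D) F s = (pi ^+ n)%:E * \int[leb]_(s in D) ((s ^+ k)%:E * iter n rint G s))%E.
  rewrite -ge0_integralZl//.
  - apply: eq_integral => s; rewrite inE/= in_itv/= andbT => s0.
    by rewrite /F ger0_norm// muleCA.
  - apply: measurable_funS measurableT (subsetT _) _; apply: emeasurable_funM => //.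
    by apply/measurable_EFinP; apply: measurable_funX; exact: measurable_id.
  - by move=> s /=; rewrite in_itv/= andbT => s0; rewrite mule_ge0// lee_fin exprn_ge0.
by rewrite moment_iter_rint// !muleA -!EFinM mulrA.
Qed.

End RadialIntegrals.

(** * Moments of the weight *)

Section RayDerivative.
Context {R : realType}.
Implicit Types (f : R -> R) (x y : R).

Lemma ray_lin f y : ray_derivable f -> 0 <= y ->
  forall e, 0 < e -> exists2 d, 0 < d & forall x, 0 <= x -> `|x - y| < d ->
    `|f x - f y - ray_derive f y * (x - y)| <= e * `|x - y|.
Proof.
move=> df y0 e e0; have /cvgrPdist_le /(_ _ e0) := df y y0.
rewrite -/(ray_derive f y) => /nbhs_ballP[d /= d0 Hd]; exists d => // x x0 xy.
have [->|xny] := eqVneq x y; first by rewrite !subrr mulr0 subrr normr0 mulr0.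
have xy0 : x - y != 0 by rewrite subr_eq0.
have := Hd x; rewrite /ball/= distrC => /(_ xy xny); rewrite in_itv/= andbT => /(_ x0).
rewrite /ray_quot => H.
have -> : f x - f y - ray_derive f y * (x - y) =
   - (ray_derive f y - (f x - f y) / (x - y)) * (x - y) by field.
by rewrite normrM normrN ler_wpM2r.
Qed.

(** Composing with the absolute value extends a function from the half line to the whole line, where
    the two-sided notions of continuity, derivative and mean value apply. *)
Lemma ray_continuous f : ray_derivable f -> continuous (fun s : R => f `|s|).
Proof.
move=> df s; have [d d0 Hd] := ray_lin df (normr_ge0 s) ltr01.
apply/cvgrPdist_lt => e e0.
pose L := `|ray_derive f `|s| | + 1.
have L0 : 0 < L by rewrite ltr_wpDl.
have m0 : 0 < Num.min d (e / (2 * L)) by rewrite lt_min d0 divr_gt0// mulr_gt0.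
apply/nbhs_ballP; exists (Num.min d (e / (2 * L))) => // x.
rewrite /ball/= lt_min => /andP[x1 x2].
have xs : `| `|x| - `|s| | <= `|s - x| by rewrite [leRHS]distrC ler_dist_dist.
have h := Hd `|x| (normr_ge0 _) (le_lt_trans xs x1).
rewrite distrC; rewrite -[f _ - f _](subrK (ray_derive f `|s| * (`|x| - `|s|))).
apply: le_lt_trans (ler_normD _ _) _.
apply: (@le_lt_trans _ _ (L * `|s - x|)).
  rewrite /L mulrDl addrC; apply: lerD.
    by rewrite normrM ler_wpM2l.
  by apply: le_trans h _; rewrite !mul1r.
move: x2; rewrite ltr_pdivlMr ?mulr_gt0//.
by have := normr_ge0 (s - x); nra.
Qed.

Lemma ray_is_derive f x : ray_derivable f -> 0 < x ->
  is_derive x (1 : R) (fun s : R => f `|s|) (ray_derive f x).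
Proof.
move=> df x0.
have H : (h^-1 *: ((fun s : R => f `|s|) (h *: (1 : R) + x) - (fun s : R => f `|s|) x))
    @[h --> 0^'] --> ray_derive f x.
  apply/cvgrPdist_le => e e0; have [d d0 Hd] := ray_lin df (ltW x0) e0.
  apply/nbhs_ballP; exists (Num.min d x); first by rewrite /= lt_min d0.
  move=> h; rewrite /ball/= sub0r normrN lt_min => /andP[hd hx] h0.
  have hx0 : 0 <= h + x.
    by move: hx; rewrite ltr_norml => /andP[? _]; lra.
  rewrite /GRing.scale/= mulr1 (ger0_norm hx0) (gtr0_norm x0).
  have := Hd (h + x) hx0; rewrite addrK => /(_ hd) Hh.
  have n0 : 0 < `|h| by rewrite normr_gt0.
  rewrite -(ler_pM2r n0) -normrM.
  have alg (a b c : R) : (a - h^-1 * (b - c)) * h = - (b - c - a * h) by field.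
  by rewrite [X in `|X|]alg normrN.
have D : derivable (fun s : R => f `|s|) x (1 : R) by apply/cvg_ex; exists (ray_derive f x).
by split => //; exact: (cvg_lim _ H).
Qed.

Lemma ray_MVT f x y : ray_derivable f -> 0 <= x -> x < y ->
  exists2 c, x < c < y & f y - f x = ray_derive f c * (y - x).
Proof.
move=> df x0 xy; have y0 : 0 <= y by exact: le_trans (ltW xy).
have dd z : z \in `]x, y[ -> is_derive z (1 : R) (fun s : R => f `|s|) (ray_derive f z).
  by rewrite in_itv/= => /andP[xz _]; apply: ray_is_derive => //; exact: le_lt_trans xz.
have [c] := MVT xy dd (continuous_subspaceT (ray_continuous df)).
rewrite in_itv/= (ger0_norm x0) (ger0_norm y0) => cxy e; by exists c.
Qed.

End RayDerivative.

Section WeightMoments.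
Context {R : realType}.
Local Notation leb := (@lebesgue_measure R).
Local Notation D := (`[0%R, +oo[%classic : set R).
Variables (n : nat) (psi : R -> R).
Hypothesis hpsi : admissible_weight n psi.

Let mD : measurable (D : set (measurableTypeR R)).
Proof. exact: measurable_itv. Qed.

Lemma weight_homo x y : 0 <= x -> x <= y -> psi x <= psi y.
Proof.
move=> x0; rewrite le_eqVlt => /predU1P[->//|xy].
have [c /andP[xc _] e] := ray_MVT (weight_derivable1 hpsi) x0 xy.
rewrite -subr_ge0 e mulr_ge0 ?subr_ge0 ?(ltW xy)//.
by apply/ltW/(weight_derive1_gt0 hpsi)/ltW; exact: le_lt_trans xc.
Qed.

(** The derivative is nondecreasing, so it never drops below its positive value at 0. This bound
    makes all moments finite. *)
Lemma weight_linear : exists2 a, 0 < a & forall s, 0 <= s -> a * s <= psi s.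
Proof.
pose a := ray_derive psi 0.
have a0 : 0 < a by exact: (weight_derive1_gt0 hpsi).
have homo c : 0 < c -> a <= ray_derive psi c.
  move=> c0; have [b /andP[b0 _] e] := ray_MVT (weight_derivable2 hpsi) (lexx 0) c0.
  by rewrite -subr_ge0 e mulr_ge0 ?subr_ge0 ?(ltW c0)// (weight_derive2_ge0 hpsi)// ltW.
exists a => // s; rewrite le_eqVlt => /predU1P[<-|s0].
  by rewrite mulr0; exact: (weight_ge0 hpsi).
have [c /andP[c0 _] e] := ray_MVT (weight_derivable1 hpsi) (lexx 0) s0.
have h0 := weight_ge0 hpsi (lexx 0).
move: e; rewrite subr0 => /eqP; rewrite subr_eq => /eqP ->.
by rewrite -[X in X <= _]addr0 lerD// ler_pM2r// homo.
Qed.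

Definition wt (s : R) : R := expR (- psi `|s|).

Lemma wt_gt0 s : 0 < wt s.
Proof. exact: expR_gt0. Qed.

Lemma wt_ge0 s : 0 <= wt s.
Proof. exact/ltW/wt_gt0. Qed.

Lemma continuous_wt : continuous wt.
Proof.
move=> s; apply: (@continuous_comp _ _ _ (fun s => - psi `|s|) expR); last exact: continuous_expR.
by apply: cvgN; exact: (ray_continuous (weight_derivable1 hpsi)).
Qed.

Lemma measurable_wt : measurable_fun setT (fun s : measurableTypeR R => (wt s)%:E).
Proof. by apply/measurable_EFinP; apply: continuous_measurable_fun; exact: continuous_wt. Qed.

Let mX k : measurable_fun setT (fun s : measurableTypeR R => (s ^+ k)%:E : \bar R).
Proof. by apply/measurable_EFinP; apply: measurable_funX; exact: measurable_id. Qed.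

Let mint k := (\int[leb]_(s in D) ((s ^+ k)%:E * (wt s)%:E))%E.

Let mXw k : measurable_fun D (fun s : measurableTypeR R => (s ^+ k)%:E * (wt s)%:E)%E.
Proof. by apply: measurable_funTS; apply: emeasurable_funM; [exact: mX|exact: measurable_wt]. Qed.

Let Xw_ge0 k s : D s -> (0 <= (s ^+ k)%:E * (wt s)%:E)%E.
Proof.
by rewrite /= in_itv/= andbT => s0; rewrite mule_ge0// lee_fin ?exprn_ge0// wt_ge0.
Qed.

Let mint_fin k : (mint k < +oo)%E.
Proof.
have [a a0 ha] := weight_linear.
(* Half of the exponential decay absorbs [s ^+ k], by [s ^+ k <= k! / r ^+ k * expR (r * s)]; the
   other half is an exponential density up to a constant. *)
pose r := a / 2; have r0 : 0 < r by rewrite divr_gt0.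
pose C := k`!%:R / r ^+ k / r.
have C0 : 0 <= C by rewrite !divr_ge0// ?exprn_ge0// ltW.
have pe := integral_exponential_pdf r0.
have pdfE s : 0 <= s -> exponential_pdf r s = r * expR (- r * s).
  by move=> s0; rewrite exponential_pdfE.
apply: (@le_lt_trans _ _ (\int[leb]_(s in D) (C%:E * (exponential_pdf r s)%:E))%E).
  apply: ge0_le_integral => //.
  - by move=> s; exact: Xw_ge0.
  - exact: mXw.
  - apply: measurable_funTS; apply: measurable_funeM; apply/measurable_EFinP.
    exact: measurable_exponential_pdf.
  - move=> s; rewrite /= in_itv/= andbT => s0; rewrite -!EFinM lee_fin pdfE//.
    rewrite /C mulrA divfK ?gt_eqF// /wt ger0_norm//.
    have h1 : s ^+ k <= k`!%:R / r ^+ k * expR (r * s).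
      have rs : 0 <= r * s by rewrite mulr_ge0// ltW.
      have h j : (r * s) ^+ j / j`!%:R <= expR (r * s).
        case: j => [|j]; first by rewrite expr0 fact0 divr1 -expR0 ler_expR.
        by apply: le_trans (expR_ge1Dxn j rs); rewrite lerDr.
      have kf : 0 < k`!%:R :> R by rewrite ltr0n fact_gt0.
      rewrite mulrAC ler_pdivlMr ?exprn_gt0// -exprMn [s * r]mulrC.
      by move: (h k); rewrite ler_pdivrMr// [_ * k`!%:R]mulrC.
    have h2 : expR (- psi s) <= expR (- (a * s)) by rewrite ler_expR lerN2 ha.
    apply: le_trans (ler_pM (exprn_ge0 _ s0) (expR_ge0 _) h1 h2) _.
    rewrite -[leLHS]mulrA -expRD; apply: ler_wpM2l; first by rewrite divr_ge0 ?exprn_ge0// ltW.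
    by rewrite ler_expR /r; lra.
rewrite ge0_integralZl//.
- have p1 : (\int[leb]_(s in D) (exponential_pdf r s)%:E <= 1)%E.
    rewrite -pe; apply: ge0_subset_integral => //.
    + by apply/measurable_EFinP; exact: measurable_exponential_pdf.
    + by move=> s _; rewrite lee_fin exponential_pdf_ge0// ltW.
  apply: lte_mul_pinfty => //.
  by apply: le_lt_trans p1 _; rewrite ltry.
- apply: measurable_funTS; apply/measurable_EFinP; exact: measurable_exponential_pdf.
- by move=> s _; rewrite lee_fin exponential_pdf_ge0// ltW.
Qed.

Let mint_ge0 k : (0 <= mint k)%E.
Proof. by apply: integral_ge0 => s; exact: Xw_ge0. Qed.

Let momentE k : moment psi k = fine (mint k).
Proof.
congr fine; apply: eq_integral => s; rewrite inE/= in_itv/= andbT => s0.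
by rewrite -EFinM /wt ger0_norm.
Qed.

Lemma integral_moment k :
  (\int[leb]_(s in D) ((s ^+ k)%:E * (wt s)%:E) = (moment psi k)%:E)%E.
Proof. by rewrite momentE fineK// ge0_fin_numE// mint_fin. Qed.

(** Only the part of the integral over [[M, M + 1]] is kept. As [M] is arbitrary, the moments
    outgrow every geometric sequence, so the kernel series converges everywhere. *)
Lemma moment_growth M : 0 < M -> exists2 c, 0 < c & forall k, c * M ^+ k <= moment psi k.
Proof.
move=> M0; exists (wt (M + 1)); first exact: wt_gt0.
move=> k; rewrite -lee_fin -integral_moment.
pose J : set (measurableTypeR R) := `[M, M + 1]%classic.
have mJ : measurable J by exact: measurable_itv.
apply: (@le_trans _ _ (\int[leb]_(s in J) ((s ^+ k)%:E * (wt s)%:E))%E); last first.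
  apply: (@ge0_subset_integral _ _ _ leb J D mJ mD _ (mXw k) (@Xw_ge0 k)).
  by move=> s; rewrite /J/= !in_itv/= andbT => /andP[Ms _]; apply: le_trans Ms; exact: ltW.
have -> : ((wt (M + 1) * M ^+ k)%:E = \int[leb]_(s in J) (wt (M + 1) * M ^+ k)%:E)%E.
  have J1 : leb J = 1%E.
    have := @lebesgue_measure_itv R `[M, (M + 1)%R].
    by rewrite /= lte_fin ltrDl ltr01 -EFinB addrAC subrr add0r.
  have := integral_cst leb mJ (wt (M + 1) * M ^+ k)%:E.
  by rewrite -[X in (_ = _ * X)%E -> _]/(leb J) J1 mule1 => E; exact: esym E.
apply: ge0_le_integral => //.
- by move=> s _; rewrite lee_fin mulr_ge0 ?wt_ge0 ?exprn_ge0// ltW.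
- by apply: measurable_funTS; apply: emeasurable_funM; [exact: mX|exact: measurable_wt].
- move=> s; rewrite /J/= in_itv/= => /andP[Ms sM]; rewrite -EFinM lee_fin mulrC.
  have s0 : 0 <= s by apply: le_trans Ms; exact: ltW.
  apply: ler_pM; rewrite ?wt_ge0 ?exprn_ge0 ?(ltW M0)//.
    by rewrite lerXn2r ?nnegrE// ltW.
  rewrite /wt !ger0_norm//; last by rewrite addr_ge0// ltW.
  by rewrite ler_expR lerN2; exact: weight_homo.
Qed.

Lemma moment_gt0 k : 0 < moment psi k.
Proof.
have [c c0 h] := moment_growth ltr01.
by apply: lt_le_trans (h k); rewrite expr1n mulr1.
Qed.

End WeightMoments.

(** * Averages over rotations *)

Section VectorAverage.
Context {R : realType}.
Local Notation leb := (@lebesgue_measure R).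
Local Notation plane := (measurableTypeR R * measurableTypeR R)%type.
Local Notation I := (`[(- pi)%R, pi]%classic : set R).

Definition vL1 n (f : 'cV[R[i]]_n -> R) :=
  (lebesgue_Cn n).-integrable setT (fun t => (f (vec_of_plane t))%:E).

Lemma vmeas_funepos n (F : 'cV[R[i]]_n -> \bar R) : vmeas F -> vmeas (F^\+)%E.
Proof.
move=> mF; have := measurable_funepos mF; congr measurable_fun.
by apply/funext => t; rewrite !funeposE.
Qed.

Lemma vmeas_funeneg n (F : 'cV[R[i]]_n -> \bar R) : vmeas F -> vmeas (F^\-)%E.
Proof.
move=> mF; have := measurable_funeneg mF; congr measurable_fun.
by apply/funext => t; rewrite !funenegE.
Qed.

Lemma vintE n (F : 'cV[R[i]]_n -> \bar R) : (vint F = vint F^\+ - vint F^\-)%E.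
Proof.
rewrite /vint [LHS]integralE; congr (_ - _)%E; apply: eq_integral => t _.
  by rewrite !funeposE.
by rewrite !funenegE.
Qed.

Lemma vint_invariant n (V : 'cV[R[i]]_n -> 'cV[R[i]]_n) (F : 'cV[R[i]]_n -> \bar R) :
  (forall G, vmeas G -> (forall z, 0 <= G z)%E -> vint (fun w => G (V w)) = vint G) ->
  vmeas F -> vint (fun w => F (V w)) = vint F.
Proof.
move=> iV mF; rewrite vintE [RHS]vintE.
rewrite -(iV _ (vmeas_funepos mF) (funepos_ge0 F)) -(iV _ (vmeas_funeneg mF) (funeneg_ge0 F)).
by congr (_ - _)%E; apply: eq_vint => w; rewrite ?funeposE ?funenegE.
Qed.

Lemma ge0_mu_int n (F : 'cV[R[i]]_n -> \bar R) : vmeas F -> (forall z, 0 <= F z)%E ->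
  (\int[mu_Cn n]_t F (vec_of_plane t) = ((n.-1)`!%:R / pi ^+ n)%:E * vint F)%E.
Proof. by move=> mF F0; exact: ge0_integral_mscale. Qed.

Lemma mu_int n (f : 'cV[R[i]]_n -> R) : vL1 f ->
  (\int[mu_Cn n]_t f (vec_of_plane t) = ((n.-1)`!%:R / pi ^+ n) * \int[lebesgue_Cn n]_t f (vec_of_plane t))%R.
Proof.
move=> fL; have mF := measurable_int _ fL.
rewrite /Rintegral; set c := (_ / _)%R.
rewrite -[c in RHS]/(fine c%:E) -fineM//; last exact: integrable_fin_num.
congr fine; rewrite [LHS]integralE [X in (_ * X)%E]integralE muleBr//; last exact: integrable_add_def.
have h := ge0_integral_mscale (lebesgue_Cn n) measurableT (NngNum (@mu_factor_ge0 R n)).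
congr (_ - _)%E; apply: h.
- exact: measurable_funepos.
- by move=> t _; exact: funepos_ge0.
- exact: measurable_funeneg.
- by move=> t _; exact: funeneg_ge0.
Qed.

(** By Fubini's theorem the average can be taken outside, where for each [s] the integral of
    [f \o V s] is that of [f]. *)
Lemma vint_average n (V : R -> 'cV[R[i]]_n -> 'cV[R[i]]_n) (f : 'cV[R[i]]_n -> R) :
  (forall s G, vmeas G -> (forall z, 0 <= G z)%E -> vint (fun w => G (V s w)) = vint G) ->
  measurable_fun setT (fun q : n.-tuple plane * measurableTypeR R => f (V q.2 (vec_of_plane q.1))) ->
  (forall z, leb.-integrable I (fun s => (f (V s z))%:E)) ->
  vL1 f ->
  vL1 (fun z => \int[leb]_(s in I) f (V s z)) /\
  (\int[lebesgue_Cn n]_t \int[leb]_(s in I) f (V s (vec_of_plane t)) =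
   (pi + pi) * \int[lebesgue_Cn n]_t f (vec_of_plane t))%R.
Proof.
move=> iV mf fI fL.
have mI : measurable (I : set (measurableTypeR R)) by exact: measurable_itv.
have vf : vmeas (fun z => (f z)%:E) := measurable_int _ fL.
have leb2 : leb I = (pi + pi)%:E.
  have := @lebesgue_measure_itv R `[(- pi)%R, pi].
  by rewrite /= lte_fin gt0_cp ?pi_gt0// -EFinB opprK.
pose F (q : n.-tuple plane * measurableTypeR R) : \bar R :=
  ((f (V q.2 (vec_of_plane q.1)))%:E * (\1_I q.2)%:E)%E.
have mF : measurable_fun setT F.
  apply: emeasurable_funM; first exact/measurable_EFinP.
  apply/measurable_EFinP; apply: (measurableT_comp (measurable_indic mI) measurable_snd).
have slice (t : n.-tuple plane) : (\int[leb]_s F (t, s) = \int[leb]_(s in I) (f (V s (vec_of_plane t)))%:E)%E.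
  exact: (esym (integral_indicator I (fun s => (f (V s (vec_of_plane t)))%:E))).
have N_fin : (vint (fun z => `|(f z)%:E|) < +oo)%E by case/integrableP: fL.
have mI1 : measurable_fun setT (fun s : measurableTypeR R => (\1_I s)%:E : \bar R).
  by apply/measurable_EFinP; exact: measurable_indic.
have I1 : (\int[leb]_s (\1_I s)%:E = (pi + pi)%:E)%E.
  by rewrite integral_indic// setIT.
have mfs s : measurable_fun setT (fun t : n.-tuple plane => (f (V s (vec_of_plane t)))%:E).
  by apply/measurable_EFinP; exact: (measurableT_comp mf (measurable_pair2 s)).
have FL : (leb_sf n \x leb)%E.-integrable setT F.
  apply/(integrable21ltyP (leb_sf n) leb mF).
  have N0 : (0 <= vint (fun z => `|(f z)%:E|))%E by apply: integral_ge0.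
  have -> : (\int[leb]_s \int[leb_sf n]_t `|F (t, s)| =
      \int[leb]_s (vint (fun z => `|(f z)%:E|) * (\1_I s)%:E))%E.
    apply: eq_integral => s _.
    rewrite -(iV s (fun z => `|(f z)%:E|)%E) => [|//|//].
      rewrite muleC -ge0_integralZl//.
        by apply: eq_integral => t _; rewrite abseM muleC [X in (X * _)%E]gee0_abs// lee_fin indicE.
      exact: (measurableT_comp _ (mfs s)).
    exact: (measurableT_comp _ vf).
  rewrite ge0_integralZl//.
  rewrite [X in (_ * X)%E](_ : _ = (pi + pi)%:E); last exact: I1.
  by apply: lte_mul_pinfty => //; rewrite ?ltry// ge0_fin_numE.
have FE (t : n.-tuple plane) : (\int[leb]_s F (t, s) =
    (\int[leb]_(s in I) f (V s (vec_of_plane t)))%R%:E)%E.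
  rewrite slice /Rintegral fineK//; exact: (integrable_fin_num mI (fI _)).
split.
  have := integrable_fubini_F FL; congr (_.-integrable _).
  by apply/funext => t; exact: FE.
have E1 := integral12_prod_meas1 FL; have E2 := integral21_prod_meas1 FL.
pose W := vint (fun z => (f z)%:E).
have Wfin : W \is a fin_num by exact: (integrable_fin_num measurableT fL).
rewrite /Rintegral -/(vint (fun z => (f z)%:E)) -/W -[(pi + pi)%R]/(fine (pi + pi)%:E) -fineM//.
congr fine; transitivity (\int[leb_sf n]_t fubini_F leb F t)%E.
  by apply: eq_integral => t _; exact/esym/FE.
rewrite E1 -E2.
transitivity (\int[leb]_s (W * (\1_I s)%:E))%E.
  apply: eq_integral => s _.
  have Ws : W = vint (fun z => (f (V s z))%:E) by exact/esym/(vint_invariant (iV s) vf).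
  rewrite indicE; case Is : (s \in I).
    rewrite mule1 Ws; apply: eq_integral => t _; rewrite /F/= indicE Is; exact: mule1.
  rewrite mule0; apply: integral0_eq => t _; rewrite /F/= indicE Is; exact: mule0.
have := @integralZl _ _ R leb setT measurableT (fun s => (\1_I s)%:E) _ (fine W).
rewrite fineK// => ->; first by rewrite [X in (_ * X)%E](_ : _ = (pi + pi)%:E) 1?muleC//; exact: I1.
apply/integrableP; split; first exact: mI1.
rewrite [ltLHS](_ : _ = (pi + pi)%:E) ?ltry//.
rewrite -I1; apply: eq_integral => s _; rewrite gee0_abs// lee_fin indicE.
Qed.

End VectorAverage.

Section ComplexVectorIntegral.
Context {R : realType}.
Local Notation leb := (@lebesgue_measure R).
Local Notation plane := (measurableTypeR R * measurableTypeR R)%type.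
Local Notation I := (`[(- pi)%R, pi]%classic : set R).
Implicit Types n : nat.

Definition cL1 n (f : 'cV[R[i]]_n -> R[i]) := vL1 (fun z => Re (f z)) /\ vL1 (fun z => Im (f z)).

Definition cI n (f : 'cV[R[i]]_n -> R[i]) : R[i] :=
  (\int[lebesgue_Cn n]_t Re (f (vec_of_plane t))) +i*
  (\int[lebesgue_Cn n]_t Im (f (vec_of_plane t))).

Lemma vcont_vmeas n (f : 'cV[R[i]]_n -> R[i]) : vcont f ->
  vmeas (fun z => (Re (f z))%:E) /\ vmeas (fun z => (Im (f z))%:E).
Proof.
move=> cf; have [h1 h2] := measurable_vcont (@measurable_Re_vec R n) (@measurable_Im_vec R n) cf.
by split; apply/measurable_EFinP.
Qed.

Lemma vL1_le n (f g : 'cV[R[i]]_n -> R) : vmeas (fun z => (f z)%:E) -> vL1 g ->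
  (forall z, `|f z| <= g z) -> vL1 f.
Proof.
move=> mf gL fg; apply: (le_integrable measurableT mf _ gL) => t _.
by rewrite /= lee_fin (le_trans (fg _))// ler_norm.
Qed.

Lemma cL1_le n (f : 'cV[R[i]]_n -> R[i]) g : vcont f -> vL1 g ->
  (forall z, normc (f z) <= g z) -> cL1 f.
Proof.
move=> cf gL fg; have [m1 m2] := vcont_vmeas cf.
by split; [apply: (vL1_le m1 gL) => z|apply: (vL1_le m2 gL) => z];
  apply: le_trans (fg z); [exact: normc_geRe|exact: normc_geIm].
Qed.

Lemma integral_CnE n (f : 'cV[R[i]]_n -> R[i]) : cL1 f ->
  integral_Cn f = ((n.-1)`!%:R / pi ^+ n)%:C * cI f.
Proof.
move=> [f1 f2]; rewrite /integral_Cn (mu_int f1) (mu_int f2) /cI.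
by apply: eqc; rewrite ?Re_mulc ?Im_mulc /= mul0r ?subr0 ?addr0.
Qed.

Lemma vL1D n (f g : 'cV[R[i]]_n -> R) a b : vL1 f -> vL1 g ->
  vL1 (fun z => a * f z + b * g z) /\
  (\int[lebesgue_Cn n]_t (a * f (vec_of_plane t) + b * g (vec_of_plane t)) =
   a * \int[lebesgue_Cn n]_t f (vec_of_plane t) + b * \int[lebesgue_Cn n]_t g (vec_of_plane t))%R.
Proof.
move=> fL gL.
have f1 := integrableZl measurableT a fL; have g1 := integrableZl measurableT b gL.
split.
  have := integrableD measurableT f1 g1; congr (_.-integrable _).
rewrite -(RintegralZl a measurableT fL) -(RintegralZl b measurableT gL).
exact: (RintegralD measurableT f1 g1).
Qed.

Lemma cI_lin n (f g : 'cV[R[i]]_n -> R[i]) c : cL1 f -> cL1 g ->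
  cL1 (fun z => c * f z + g z) /\ cI (fun z => c * f z + g z) = c * cI f + cI g.
Proof.
move=> [f1 f2] [g1 g2].
have [h1 e1] := vL1D (Re c) (- Im c) f1 f2.
have [h2 e2] := vL1D 1 1 h1 g1.
have [h3 e3] := vL1D (Re c) (Im c) f2 f1.
have [h4 e4] := vL1D 1 1 h3 g2.
have r1 z : Re (c * f z + g z) = 1 * (Re c * Re (f z) + - Im c * Im (f z)) + 1 * Re (g z).
  by rewrite Re_addc Re_mulc !mul1r mulNr.
have r2 z : Im (c * f z + g z) = 1 * (Re c * Im (f z) + Im c * Re (f z)) + 1 * Im (g z).
  by rewrite Im_addc Im_mulc !mul1r.
split.
  split; [have := h2|have := h4]; congr vL1; apply/funext => z; [exact/esym/r1|exact/esym/r2].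
apply: eqc.
  rewrite Re_addc Re_mulc [X in _ = X - _ + _]/= -mulNr -e1 -[X in _ = X + _]mul1r -[X in _ = _ + X]mul1r -e2.
  by congr fine; apply: eq_integral => t _; rewrite r1.
rewrite Im_addc Im_mulc -e3 -[X in _ = X + _]mul1r -[X in _ = _ + X]mul1r -e4.
by congr fine; apply: eq_integral => t _; rewrite r2.
Qed.

Lemma cI_invariant n (V : 'cV[R[i]]_n -> 'cV[R[i]]_n) (f : 'cV[R[i]]_n -> R[i]) :
  (forall G, vmeas G -> (forall z, 0 <= G z)%E -> vint (fun w => G (V w)) = vint G) ->
  vcont f -> cI (fun w => f (V w)) = cI f.
Proof.
move=> iV /vcont_vmeas[m1 m2]; apply: eqc; congr fine.
  exact: (vint_invariant iV m1).
exact: (vint_invariant iV m2).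
Qed.

Lemma cI_average n (V : R -> 'cV[R[i]]_n -> 'cV[R[i]]_n) (f : 'cV[R[i]]_n -> R[i]) :
  (forall s G, vmeas G -> (forall z, 0 <= G z)%E -> vint (fun w => G (V s w)) = vint G) ->
  (forall j, measurable_fun setT (fun q : n.-tuple plane * measurableTypeR R =>
    Re (V q.2 (vec_of_plane q.1) j 0))) ->
  (forall j, measurable_fun setT (fun q : n.-tuple plane * measurableTypeR R =>
    Im (V q.2 (vec_of_plane q.1) j 0))) ->
  vcont f -> (forall z, ccont (fun s => f (V s z))) -> cL1 f ->
  cL1 (fun z => cint (- pi) pi (fun s => f (V s z))) /\
  cI (fun z => cint (- pi) pi (fun s => f (V s z))) = twopi * cI f.
Proof.
move=> iV mV1 mV2 cf cV [f1 f2].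
have [m1 m2] := measurable_vcont mV1 mV2 cf.
have int_cont (h : R -> R) : continuous h -> leb.-integrable I (fun s => (h s)%:E).
  move=> ch; apply: continuous_compact_integrable; first exact: segment_compact.
  by apply: continuous_subspaceT.
have [h1 e1] := vint_average iV m1 (fun z => int_cont _ (cV z).1) f1.
have [h2 e2] := vint_average iV m2 (fun z => int_cont _ (cV z).2) f2.
split; first by split.
rewrite twopiE; apply: eqc; rewrite ?Re_mulc ?Im_mulc mul0r ?subr0 ?addr0; [exact: e1|exact: e2].
Qed.

End ComplexVectorIntegral.

Section HeadCoefficients.
Context {R : realType}.
Local Notation leb := (@lebesgue_measure R).
Local Notation plane := (measurableTypeR R * measurableTypeR R)%type.
Variables (n : nat) (psi : R -> R).
Hypothesis hpsi : admissible_weight n psi.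
Variable m : nat.
Implicit Types (z w : 'cV[R[i]]_m.+1).

Definition vwt z : R := wt psi (sqnorm z).

Lemma fock_weightE z : fock_weight psi z = vwt z.
Proof. by rewrite /vwt /wt ger0_norm// sqnorm_ge0. Qed.

Lemma vcont_vwt : vcont (fun z => (vwt z)%:C).
Proof.
have -> : (fun z => (vwt z)%:C) = (fun a => (wt psi (Re a))%:C) \o (fun z => cdot z z).
  by apply/funext => z /=; rewrite cdot_sqnorm.
apply: vcont_comp; last first.
  rewrite /cdot; apply: vcont_sum => j; apply: vcontM; first exact: vcont_coord.
  by apply: vcontJ; exact: vcont_coord.
move=> a e e0; have cw := continuous_wt hpsi (x := Re a).
move/cvgrPdist_lt: cw => /(_ _ e0) /nbhs_ballP[d /= d0 Hd]; exists d => // b ab.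
have : normc ((wt psi (Re b))%:C - (wt psi (Re a))%:C) < e; last exact.
rewrite -rmorphB normcR distrC; apply: Hd; rewrite /ball/= distrC.
by rewrite -Re_oppc -Re_addc; apply: le_lt_trans (normc_geRe _) _.
Qed.

(* [gam k] is the integral of [|z_0|^2k e^-psi(|z|^2)] with respect to [mu_Cn]. *)
Definition gam k : R := m`!%:R * (k`!%:R / (k + m)`!%:R) * moment psi (k + m).

Lemma gam_gt0 k : 0 < gam k.
Proof. by rewrite /gam !mulr_gt0 ?invr_gt0 ?ltr0n ?fact_gt0 ?(moment_gt0 hpsi). Qed.

Lemma vint_head_wt k :
  vint (fun z => ((normc (z ord0 0) ^+ 2) ^+ k * vwt z)%:E) =
  (pi ^+ m.+1 / m`!%:R * gam k)%:E.
Proof.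
have := vint_head_moment m k (measurable_wt hpsi) (fun s => _).
move=> H; rewrite /vwt; under eq_vint do rewrite EFinM.
rewrite H; last by move=> s; rewrite lee_fin wt_ge0.
rewrite (integral_moment hpsi) -EFinM; congr _%:E; rewrite /gam.
set a := pi ^+ _; have : m`!%:R != 0 :> R by rewrite pnatr_eq0 -lt0n fact_gt0.
move=> h; clearbody a; move: (_ / _) (moment _ _) => b c; field; exact: h.
Qed.

Definition head_wt k z : R[i] := ((normc (z ord0 0) ^+ 2) ^+ k * vwt z)%:C.

Lemma vL1_head_wt k : vL1 (fun z => (normc (z ord0 0) ^+ 2) ^+ k * vwt z).
Proof.
have c : vcont (fun z => head_wt k z).
  have -> : head_wt k = (fun z => ((normc (z ord0 0))%:C ^+ 2) ^+ k * (vwt z)%:C).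
    by apply/funext => z; rewrite /head_wt rmorphM -!rmorphXn.
  apply: vcontM; last exact: vcont_vwt.
  by do 2!apply: vcontX; apply: vcont_norm; exact: vcont_coord.
have [mh _] := vcont_vmeas c.
apply/integrableP; split; first exact: mh.
rewrite [ltLHS](_ : _ = (pi ^+ m.+1 / m`!%:R * gam k)%:E) ?ltry//.
rewrite -vint_head_wt; apply: eq_integral => t _.
by rewrite gee0_abs// lee_fin mulr_ge0 ?wt_ge0// exprn_ge0// sqr_ge0.
Qed.

Lemma cI_head_wt k : cL1 (head_wt k) /\ cI (head_wt k) = (pi ^+ m.+1 / m`!%:R * gam k)%:C.
Proof.
have h := vL1_head_wt k; split.
  split; first exact: h.
  exact: integrable0.
apply: eqc; first by rewrite /= /Rintegral [X in fine X]vint_head_wt.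
by rewrite /cI/= /Rintegral integral0.
Qed.

Lemma gam_integral k : ((m.+1.-1)`!%:R / pi ^+ m.+1) * (pi ^+ m.+1 / m`!%:R * gam k) = gam k.
Proof.
have h : m`!%:R != 0 :> R by rewrite pnatr_eq0 -lt0n fact_gt0.
have h' : pi ^+ m.+1 != 0 :> R by rewrite expf_neq0// gt_eqF// pi_gt0.
move: (pi ^+ _) h' => a a0; rewrite /=; move: (gam k) => c; field; by rewrite a0 h.
Qed.

Lemma measurable_rot2 (a b : R -> R[i]) : ccont a -> ccont b -> forall j,
  measurable_fun setT (fun q : m.+1.-tuple plane * measurableTypeR R =>
    Re (rot2 (a q.2) (b q.2) (vec_of_plane q.1) j 0)) /\
  measurable_fun setT (fun q : m.+1.-tuple plane * measurableTypeR R =>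
    Im (rot2 (a q.2) (b q.2) (vec_of_plane q.1) j 0)).
Proof.
have key (c : R -> R[i]) j : ccont c ->
  measurable_fun setT (fun q : m.+1.-tuple plane * measurableTypeR R => Re (c q.2 * vec_of_plane q.1 j 0)) /\
  measurable_fun setT (fun q : m.+1.-tuple plane * measurableTypeR R => Im (c q.2 * vec_of_plane q.1 j 0)).
  move=> [c1 c2].
  have m1 : measurable_fun setT (fun q : m.+1.-tuple plane * measurableTypeR R => Re (c q.2)).
    exact: (measurableT_comp (continuous_measurable_fun c1) measurable_snd).
  have m2 : measurable_fun setT (fun q : m.+1.-tuple plane * measurableTypeR R => Im (c q.2)).
    exact: (measurableT_comp (continuous_measurable_fun c2) measurable_snd).
  have m3 : measurable_fun setT (fun q : m.+1.-tuple plane * measurableTypeR R => Re (vec_of_plane q.1 j 0)).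
    exact: (measurableT_comp (@measurable_Re_vec R _ j) measurable_fst).
  have m4 : measurable_fun setT (fun q : m.+1.-tuple plane * measurableTypeR R => Im (vec_of_plane q.1 j 0)).
    exact: (measurableT_comp (@measurable_Im_vec R _ j) measurable_fst).
  split; [under [X in measurable_fun _ X]funext do rewrite Re_mulc|
          under [X in measurable_fun _ X]funext do rewrite Im_mulc].
    by apply: measurable_funB; apply: measurable_funM.
  by apply: measurable_funD; apply: measurable_funM.
move=> ca cb j.
case: (unliftP ord0 j) => [k|] ->.
  have [h1 h2] := key b (lift ord0 k) cb.
  split; [have := h1|have := h2]; congr measurable_fun; apply/funext => q;
    by rewrite /rot2 vconsS !mxE.
have [h1 h2] := key a ord0 ca.
split; [have := h1|have := h2]; congr measurable_fun; apply/funext => q;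
  by rewrite /rot2 vcons0.
Qed.

Lemma vwt_rot2 a b z : normc a = 1 -> normc b = 1 -> vwt (rot2 a b z) = vwt z.
Proof.
move=> a1 b1; rewrite /vwt; congr wt.
by rewrite sqnorm_vcons sqnorm_scale Normc.normcM a1 b1 mul1r expr1n mul1r -sqnorm_vcons vcons_eta.
Qed.

Lemma cI_rot2 (a b : R -> R[i]) f : ccont a -> ccont b ->
  (forall s, normc (a s) = 1) -> (forall s, normc (b s) = 1) -> vcont f ->
  (forall z, ccont (fun s => f (rot2 (a s) (b s) z))) -> cL1 f ->
  cL1 (fun z => cint (- pi) pi (fun s => f (rot2 (a s) (b s) z))) /\
  cI (fun z => cint (- pi) pi (fun s => f (rot2 (a s) (b s) z))) = twopi * cI f.
Proof.
move=> ca cb a1 b1 cf cV fL.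
apply: (cI_average (V := fun s => rot2 (a s) (b s))) => //.
- by move=> s G mG G0; exact: vint_rot2.
- by move=> j; have [] := measurable_rot2 ca cb j.
- by move=> j; have [] := measurable_rot2 ca cb j.
Qed.

Lemma entire_head (g : 'cV[R[i]]_m.+1 -> R[i]) : lhol g -> entire (fun a => g (vcons a 0)).
Proof.
move=> [_ hg]; have := hg 0 (vcons 1 0); congr entire; apply/funext => a; congr g.
apply/colP => j; case: (unliftP ord0 j) => [i|] ->;
  by rewrite !mxE ?unlift_none ?liftK/= ?mxE add0r ?mulr0 ?mulr1.
Qed.

Let mul_shuffle (K : comRingType) (x A B C E : K) : x * (A * (B * C * E)) = x * (C * E) * (A * B).
Proof. by ring. Qed.

Let mul_shuffle2 (K : comRingType) (x a B E Z : K) :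
  x * (B * E) * (x * (a * Z)) = x * x * a * (Z * B * E).
Proof. by ring. Qed.

(* The average over rotations of the tail replaces [g] by its restriction to the
   first axis, and the one over rotations of the head extracts the Taylor
   coefficient of that restriction. *)
Lemma head_coef g k : lhol g ->
  let f z := g z * conj (z ord0 0) ^+ k * (vwt z)%:C in
  cL1 f -> integral_Cn f = coef (fun a => g (vcons a 0)) k * (gam k)%:C.
Proof.
move=> lg f fL; have [cg hg] := lg.
pose h a := g (vcons a 0).
have eh : entire h by exact: (entire_head lg).
have cf : vcont f.
  apply: vcontM; last exact: vcont_vwt.
  by apply: vcontM => //; apply: vcontX; apply: vcontJ; exact: vcont_coord.
have ch := entire_cctn eh.
pose P z := conj (z ord0 0) ^+ k * (vwt z)%:C.
(* Rotating the tail describes a circle in a complex line through [vcons (z ord0 0) 0]; the average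
   of [g] over it is its zeroth coefficient, the value at that centre. *)
have rot1 s z : rot2 1 (cis s) z = vcons (z ord0 0) 0 + (1 * cis s) *: vcons 0 (vtail z).
  rewrite /rot2 mul1r; apply/colP => j; case: (unliftP ord0 j) => [i|] ->.
    by rewrite !mxE !liftK/= !mxE add0r mul1r.
  by rewrite !mxE !unlift_none/= mul1r mulr0 addr0.
have n1 : normc (1 : R[i]) = 1 by exact: Normc.normc1.
have fE1 s z : f (rot2 1 (cis s) z) =
    P z * (g (vcons (z ord0 0) 0 + (1 * cis s) *: vcons 0 (vtail z)) / cis s ^+ 0).
  rewrite /f vwt_rot2 ?normc_cis// -rot1 {2}/rot2 vcons0 mul1r expr0 divr1 -mulrA mulrC; reflexivity.
pose G z a := g (vcons (z ord0 0) 0 + a *: vcons 0 (vtail z)).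
have eG z : entire (G z) by exact: hg.
have cG z : ccont (fun s => G z (1 * cis s) / cis s ^+ 0).
  by apply: ccont_circleC; exact: entire_cctn.
have [L1 E1] : cL1 (fun z => twopi * (h (z ord0 0) * P z)) /\
    cI (fun z => twopi * (h (z ord0 0) * P z)) = twopi * cI f.
  have := cI_rot2 (a := fun=> 1) (b := cis) (f := f) (ccont_cst _) ccont_cis (fun=> n1) (@normc_cis R) cf _ fL.
  have AE : (fun z => cint (- pi) pi (fun s => f (rot2 1 (cis s) z))) =
     (fun z => twopi * (h (z ord0 0) * P z)).
    apply/funext => z; under [X in cint _ _ X]funext do rewrite fE1.
    rewrite (cintZ _ _ _ (cG z)) coef_circleC// coef0// expr0 mulr1.
    rewrite mulrCA [P z * _]mulrC; congr (twopi * (g _ * P z)).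
    by rewrite scale0r addr0.
  rewrite AE; apply=> z; under [X in ccont X]funext do rewrite fE1.
  by apply: ccontM; [exact: ccont_cst|exact: cG].
pose f2 z := twopi * (h (z ord0 0) * P z).
have cf2 : vcont f2.
  apply: vcontM; first exact: vcont_cst.
  apply: vcontM; first by apply: (vcont_comp ch); exact: vcont_coord.
  apply: vcontM; last exact: vcont_vwt.
  by apply: vcontX; apply: vcontJ; exact: vcont_coord.
(* Rotating the head multiplies the conjugate power by [cis s ^- k], so the average is the Cauchy
   integral of the [k]-th coefficient of [h]. *)
have fE2 s z : f2 (rot2 (cis s) 1 z) = twopi * P z * (h (z ord0 0 * cis s) / cis s ^+ k).
  have -> : h (z ord0 0 * cis s) / cis s ^+ k = h (cis s * z ord0 0) * conj (cis s) ^+ k.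
    by rewrite cisJ exprVn mulrC [z _ _ * _]mulrC mulrC.
  rewrite /f2 /P vwt_rot2 ?normc_cis// {1 2}/rot2 !vcons0 conjM exprMn.
  exact: mul_shuffle.
(* The summand 0 gives the integrand the shape [c * f + g] of [cI_lin]. *)
have [L2 E2] : cL1 (fun z => twopi * twopi * coef h k * head_wt k z + 0) /\
    cI (fun z => twopi * twopi * coef h k * head_wt k z + 0) = twopi * cI f2.
  have := cI_rot2 (a := cis) (b := fun=> 1) (f := f2) ccont_cis (ccont_cst _) (@normc_cis R) (fun=> n1) cf2 _ L1.
  have AE : (fun z => cint (- pi) pi (fun s => f2 (rot2 (cis s) 1 z))) =
     (fun z => twopi * twopi * coef h k * head_wt k z + 0).
    apply/funext => z; under [X in cint _ _ X]funext do rewrite fE2.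
    rewrite cintZ ?coef_circleC//; last exact: ccont_circleC.
    rewrite addr0 /P /head_wt rmorphM rmorphXn/= -mulc_conjc exprMn.
    exact: mul_shuffle2.
  rewrite AE; apply=> z; under [X in ccont X]funext do rewrite fE2.
  by apply: ccontM; [exact: ccont_cst|exact: ccont_circleC].
have [w1 w2] := cI_head_wt k.
have z1 : cL1 (fun _ : 'cV[R[i]]_m.+1 => 0) by split; exact: integrable0.
have z2 : cI (fun _ : 'cV[R[i]]_m.+1 => 0) = 0.
  by apply: eqc; rewrite /cI/= /Rintegral integral0.
have [_ E3] := cI_lin (twopi * twopi * coef h k) w1 z1.
have E4 : cI f = coef h k * (pi ^+ m.+1 / m`!%:R * gam k)%:C.
  apply: (mulfI (mulf_neq0 twopi_neq0 twopi_neq0)).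
  rewrite -[LHS]mulrA -E1 -E2 E3 z2 addr0 w2. exact: (esym (mulrA _ _ _)).
rewrite (integral_CnE fL) E4 mulrCA; congr (_ * _).
by rewrite -rmorphM gam_integral.
Qed.

End HeadCoefficients.

(** * Power series and the kernel *)

Section RapidSeries.
Context {R : realType}.
Implicit Types (c : nat -> R) (u w z : R[i]).

(** Passing to the limit in an estimate for partial sums: their errors are of the form
    [T / 2 ^+ N]. *)
Lemma le_of_half_powers (x y T : R) : (forall N, x <= y + T / 2 ^+ N) -> x <= y.
Proof.
move=> h; apply/ler_addgt0Pl => e e0; rewrite addrC.
pose N := Num.truncn (`|T| / e).
have hN : `|T| / e < 2 ^+ N.+1.
  apply: lt_le_trans (truncnS_gt _) _.
  by rewrite -natrX ler_nat ltnW// ltn_expl.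
apply: le_trans (h N.+1) _; rewrite lerD2l ler_pdivrMr ?exprn_gt0//.
move: hN; rewrite ltr_pdivrMr// => hN; rewrite mulrC.
exact: le_trans (ler_norm _) (ltW hN).
Qed.

Lemma half_powers_cvg (a : nat -> R) l B : (forall N, `|l - a N| <= B / 2 ^+ N) -> a @ \oo --> l.
Proof.
move=> h; apply/cvgrPdist_lt => e e0; exists (Num.truncn (B / e)).+1 => // N /= MN.
apply: le_lt_trans (h N) _; rewrite ltr_pdivrMr ?exprn_gt0// [ltRHS]mulrC -ltr_pdivrMr//.
apply: lt_le_trans (truncnS_gt _) _; rewrite -natrX ler_nat.
by apply: leq_trans MN _; exact/ltnW/ltn_expl.
Qed.

Lemma normc_sum_le (I : Type) (s : seq I) (F : I -> R[i]) :
  normc (\sum_(i <- s) F i) <= \sum_(i <- s) normc (F i).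
Proof.
elim: s => [|i s IH]; first by rewrite !big_nil Normc.normc0.
by rewrite !big_cons; apply: le_trans (le_normcD _ _) _; rewrite lerD2l.
Qed.

(** The bound telescopes, because [K / 2 ^+ k] is the difference of [2 * K / 2 ^+ k] and
    [2 * K / 2 ^+ k.+1]. *)
Lemma half_powers_sum (a : nat -> R) K : (forall k, a k <= K / 2 ^+ k) ->
  forall N j, \sum_(N <= k < N + j) a k <= 2 * K / 2 ^+ N - 2 * K / 2 ^+ (N + j).
Proof.
move=> h N; elim=> [|j IH]; first by rewrite addn0 big_geq// subrr.
rewrite addnS big_nat_recr ?leq_addr//=.
apply: le_trans (lerD IH (h _)) _.
by rewrite exprS invfM; set q := (2 ^+ (N + j))^-1; lra.
Qed.

Lemma series_half_tail (a : nat -> R) K : (forall k, `|a k| <= K / 2 ^+ k) ->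
  forall N, `|limn (fun n => \sum_(0 <= k < n) a k) - \sum_(0 <= k < N) a k| <= 2 * K / 2 ^+ N.
Proof.
move=> h.
have K0 : 0 <= K by have := h 0%N; rewrite expr0 divr1; exact: le_trans.
have fin N j : `|\sum_(0 <= k < N + j) a k - \sum_(0 <= k < N) a k| <= 2 * K / 2 ^+ N.
  rewrite [in X in X - _](big_cat_nat (n := N))// ?leq_addr//= addrAC subrr add0r.
  apply: le_trans (ler_norm_sum _ _ _) _; apply: le_trans (half_powers_sum h N j) _.
  by rewrite gerBl divr_ge0 ?exprn_ge0// mulr_ge0.
have cv : cvgn (fun n => \sum_(0 <= k < n) a k).
  apply: (@normed_cvg _ _ a).
  apply: (@series_le_cvg _ _ (geometric K 2^-1)) => [k|k|k|].
  - exact: normr_ge0.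
  - by rewrite /geometric/= mulr_ge0// exprn_ge0.
  - by rewrite /geometric/= exprVn; exact: h.
  - by apply: is_cvg_geometric_series; rewrite ger0_norm//; lra.
move=> N; apply/ler_addgt0Pl => e e0.
have /cvgrPdist_lt /(_ _ e0) [M _ HM] := cv.
have := HM (N + M)%N; rewrite /= leq_addl => /(_ isT) H.
rewrite -(subrK (\sum_(0 <= k < N + M) a k) (limn _)) -addrA.
by apply: le_trans (ler_normD _ _) _; apply: lerD; [exact: ltW H|exact: fin].
Qed.

(** Nonnegative coefficients of a power series with infinite radius of convergence. *)
Definition rapid c := (forall k, 0 <= c k) /\
  forall r, 0 < r -> exists2 K, 0 <= K & forall k, c k <= K * r ^+ k.

Definition psum c N u : R[i] := \sum_(0 <= k < N) (c k)%:C * u ^+ k.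

Definition pser c u : R[i] :=
  limn (fun N => Re (psum c N u)) +i* limn (fun N => Im (psum c N u)).

(** Decay at the rate [1 / (2 * r)] leaves a factor [2 ^- k] on the disc of radius [r]. *)
Lemma rapid_bound c r : rapid c -> 0 < r -> exists2 K, 0 <= K &
  forall u k, normc u <= r -> normc ((c k)%:C * u ^+ k) <= K / 2 ^+ k.
Proof.
move=> [c0 cr] r0; have r2 : 0 < (2 * r)^-1 by rewrite invr_gt0 mulr_gt0.
have [K K0 HK] := cr _ r2.
exists K => // u k ur; rewrite Normc.normcM normcR normcX ger0_norm//.
have uk : normc u ^+ k <= r ^+ k by apply: lerXn2r => //; rewrite nnegrE ?normc_ge0// ltW.
apply: le_trans (ler_pM (c0 k) (exprn_ge0 _ (normc_ge0 _)) (HK k) uk) _.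
by rewrite -mulrA -exprMn invfM mulfVK ?gt_eqF// exprVn.
Qed.

Lemma pser_tail c r : rapid c -> 0 < r -> exists2 B, 0 <= B &
  forall u N, normc u <= r -> normc (pser c u - psum c N u) <= B / 2 ^+ N.
Proof.
move=> rc r0; have [K K0 HK] := rapid_bound rc r0.
exists (4 * K); first by rewrite mulr_ge0.
move=> u N ur.
have ReS n : Re (psum c n u) = \sum_(0 <= k < n) Re ((c k)%:C * u ^+ k).
  exact: (big_morph (@complex.Re R) (@Re_addc R) (erefl _)).
have ImS n : Im (psum c n u) = \sum_(0 <= k < n) Im ((c k)%:C * u ^+ k).
  exact: (big_morph (@complex.Im R) (@Im_addc R) (erefl _)).
have t1 := series_half_tail (a := fun k => Re ((c k)%:C * u ^+ k))
  (fun k => le_trans (normc_geRe _) (HK u k ur)) N.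
have t2 := series_half_tail (a := fun k => Im ((c k)%:C * u ^+ k))
  (fun k => le_trans (normc_geIm _) (HK u k ur)) N.
apply: le_trans (normc_le_ReIm _) _.
rewrite !Re_addc !Im_addc !Re_oppc !Im_oppc /= ReS ImS (funext ReS) (funext ImS).
by apply: le_trans (lerD t1 t2) _; rewrite -mulrDl; lra.
Qed.

Lemma rapid_deriv c : rapid c -> rapid (fun k => k.+1%:R * c k.+1).
Proof.
move=> [c0 cr]; split=> [k|r r0]; first by rewrite mulr_ge0.
have [K K0 HK] := cr (r / 2) (divr_gt0 r0 (ltr0n _ 2)).
exists (K * r) => [|k]; first by rewrite mulr_ge0// ltW.
have h : k.+1%:R <= 2 ^+ k.+1 :> R by rewrite -natrX ler_nat ltnW// ltn_expl.
apply: le_trans (ler_pM (ler0n _ _) (c0 _) h (HK k.+1)) _.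
by rewrite mulrCA -exprMn mulrCA divff// mulr1 exprS mulrA.
Qed.

Let pow_taylor_step0 (K : comRingType) (u z : K) :
  u ^+ 1 - z ^+ 1 - 1%:R * z ^+ 0 * (u - z) =
  u * (u ^+ 0 - z ^+ 0 - 0%:R * z ^+ 0 * (u - z)) + 0%:R * z ^+ 0 * (u - z) ^+ 2.
Proof. by ring. Qed.

Let pow_taylor_step (K : comRingType) (u z : K) k :
  u * u ^+ k.+1 - z * z ^+ k.+1 - k.+2%:R * z ^+ k.+1 * (u - z) =
  u * (u ^+ k.+1 - z ^+ k.+1 - k.+1%:R * z ^+ k * (u - z)) + k.+1%:R * z ^+ k * (u - z) ^+ 2.
Proof. by rewrite !exprS; ring. Qed.

(** A crude bound on the second-order remainder, by induction on [k]; the factor [(2 * r) ^+ k] is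
    harmless against rapidly decreasing coefficients. *)
Lemma pow_taylor u z r k : 1 <= r -> normc u <= r -> normc z <= r ->
  normc (u ^+ k - z ^+ k - k%:R * z ^+ k.-1 * (u - z)) <= (2 * r) ^+ k * normc (u - z) ^+ 2.
Proof.
move=> r1 ur zr; have r0 : 0 <= r by exact: le_trans r1.
elim: k => [|k IH].
  by rewrite !mul0r subrr subr0 Normc.normc0 mul1r sqr_ge0.
have -> : u ^+ k.+1 - z ^+ k.+1 - k.+1%:R * z ^+ k * (u - z) =
    u * (u ^+ k - z ^+ k - k%:R * z ^+ k.-1 * (u - z)) + k%:R * z ^+ k.-1 * (u - z) ^+ 2.
  case: k {IH} => [|k]; first exact: pow_taylor_step0.
  exact: pow_taylor_step.
apply: le_trans (le_normcD _ _) _; rewrite !Normc.normcM -[normc (u - z) * _]expr2.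
set d := normc (u - z) ^+ 2 in IH *; have d0 : 0 <= d by rewrite sqr_ge0.
have h1 : normc u * normc (u ^+ k - z ^+ k - k%:R * z ^+ k.-1 * (u - z)) <= r * ((2 * r) ^+ k * d).
  by apply: ler_pM; rewrite ?normc_ge0.
have kr : normc (k%:R : R[i]) = k%:R by rewrite -(rmorph_nat (real_complex R)) normcR ger0_norm.
have h2 : normc k%:R * normc (z ^+ k.-1) <= 2 ^+ k * r ^+ k.
  rewrite kr normcX; apply: ler_pM; rewrite ?exprn_ge0 ?normc_ge0//.
    by rewrite -natrX ler_nat ltnW// ltn_expl.
  apply: le_trans (_ : r ^+ k.-1 <= _); first by apply: lerXn2r; rewrite ?nnegrE ?normc_ge0.
  by apply: ler_weXn2l => //; exact: leq_pred.
apply: le_trans (lerD h1 (ler_wpM2r d0 h2)) _.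
rewrite -exprMn exprS; set x := (2 * r) ^+ k; have x0 : 0 <= x by rewrite exprn_ge0// mulr_ge0.
rewrite mulrA -mulrDl; apply: ler_wpM2r => //.
by nra.
Qed.

Let decomp (K : comRingType) (F G H x y w v : K) :
  F - G - H * v = (x - y - w * v) + ((F - x) - (G - y) - (H - w) * v).
Proof. by ring. Qed.

(** The derivative is the termwise one: [pow_taylor] bounds the remainder of every partial sum by
    the same multiple of the squared increment, and the truncation tends to infinity. *)
Lemma pser_entire c : rapid c -> entire (pser c).
Proof.
move=> rc z; pose c' k := k.+1%:R * c k.+1.
exists (pser c' z) => e e0.
pose r := normc z + 1.
have r1 : 1 <= r by rewrite lerDr normc_ge0.
have r0 : 0 < r by exact: lt_le_trans r1.
have r20 : 0 < 2 * r by rewrite mulr_gt0.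
have [B B0 HB] := pser_tail rc r0.
have [B' B'0 HB'] := pser_tail (rapid_deriv rc) r0.
have [K K0 HK] := rapid_bound rc r20.
exists (Num.min 1 (e / (2 * K + 1))) => [|w].
  by rewrite lt_min ltr01 divr_gt0// ltr_wpDl// mulr_ge0.
rewrite lt_min => /andP[d1 d2]; set d := normc (w - z) in d1 d2 *.
have dn : 0 <= d by exact: normc_ge0.
have zr : normc z <= r by rewrite lerDl.
have wr : normc w <= r.
  by rewrite -(subrK z w) addrC; apply: le_trans (le_normcD _ _) _; rewrite lerD2l ltW.
apply: (@le_trans _ _ (2 * K * d ^+ 2)); last first.
  rewrite expr2 mulrA; apply: ler_wpM2r => //.
  move: d2; rewrite ltr_pdivlMr; last by rewrite ltr_wpDl// mulr_ge0.
  by nra.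
apply: (@le_of_half_powers _ _ (2 * B + B' * d)) => N.
(* Differentiating the first [N.+1] terms kills the constant one, so the derived partial sum has [N]
   terms. *)
have E : psum c N.+1 w - psum c N.+1 z - psum c' N z * (w - z) =
    \sum_(0 <= k < N.+1) (c k)%:C * (w ^+ k - z ^+ k - k%:R * z ^+ k.-1 * (w - z)).
  have -> : psum c' N z * (w - z) =
      \sum_(0 <= k < N.+1) (c k)%:C * (k%:R * z ^+ k.-1 * (w - z)).
    rewrite big_nat_recl// !mul0r mulr0 add0r /psum mulr_suml; apply: eq_bigr => k _.
    by rewrite /c' rmorphM/= rmorph_nat [k.+1%:R * _]mulrC -!mulrA.
  rewrite /psum -!sumrB; apply: eq_bigr => k _; by rewrite !mulrBr.
have H1 : normc (psum c N.+1 w - psum c N.+1 z - psum c' N z * (w - z)) <= 2 * K * d ^+ 2.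
  rewrite E; apply: le_trans (normc_sum_le _ _) _.
  have h k : normc ((c k)%:C * (w ^+ k - z ^+ k - k%:R * z ^+ k.-1 * (w - z))) <= (K * d ^+ 2) / 2 ^+ k.
    have cr := rc.1 k.
    have := HK (2 * r)%:C k; rewrite normcR ger0_norm ?(ltW r20)// lexx => /(_ isT).
    rewrite !Normc.normcM normcX !normcR !ger0_norm ?(ltW r20)// => h1.
    apply: le_trans (ler_wpM2l cr (pow_taylor k r1 wr zr)) _.
    by rewrite mulrA -/d [leRHS]mulrAC; apply: ler_wpM2r => //; rewrite sqr_ge0.
  have := half_powers_sum h 0 N.+1; rewrite add0n expr0 divr1 => /le_trans; apply.
  by rewrite -[leRHS]mulrA gerBl divr_ge0 ?exprn_ge0// !mulr_ge0 ?sqr_ge0.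
have -> : pser c w - pser c z - pser c' z * (w - z) =
   (psum c N.+1 w - psum c N.+1 z - psum c' N z * (w - z)) +
   ((pser c w - psum c N.+1 w) - (pser c z - psum c N.+1 z) - (pser c' z - psum c' N z) * (w - z)).
  exact: decomp.
apply: le_trans (le_normcD _ _) _; apply: lerD => //.
apply: le_trans (normc_triB _ _) _; rewrite [leRHS]mulrDl; apply: lerD.
  apply: le_trans (normc_triB _ _) _.
  have le2 : (2 ^+ N.+1)^-1 <= (2 ^+ N)^-1 :> R.
    by rewrite lef_pV2 ?posrE ?exprn_gt0// ler_weXn2l// ler1n.
  apply: le_trans (lerD (HB w N.+1 wr) (HB z N.+1 zr)) _.
  rewrite -mulr2n -[leLHS]mulr_natl -[leRHS]mulrA; apply: ler_wpM2l => //; exact: ler_wpM2l.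
rewrite Normc.normcM [leRHS]mulrAC -/d; apply: ler_wpM2r => //; exact: HB'.
Qed.

End RapidSeries.

(** * The kernel as an entire series *)

Section KernelSeries.
Context {R : realType}.
Variables (n : nat) (psi : R -> R).
Hypothesis hpsi : admissible_weight n psi.
Variable m : nat.

(* The kernel is the series of [<z, p>^k / gam k]. *)
Definition kcoef k : R := (gam psi m k)^-1.

Lemma kcoef_gt0 k : 0 < kcoef k.
Proof. by rewrite invr_gt0 (gam_gt0 hpsi). Qed.

Lemma bin_le_exp2 i j : ('C(i, j) <= 2 ^ i)%N.
Proof.
elim: i j => [|i IH] [|j]; rewrite ?bin0 ?bin0n ?expn_gt0//.
by rewrite binS expnS mul2n -addnn leq_add.
Qed.

(** In this form the coefficient is easy to bound, and [m!] times the binomial is the falling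
    factorial in [fock_kernel]. *)
Lemma kcoefE k : kcoef k = 'C(k + m, m)%:R / moment psi (k + m).
Proof.
have h j : j`!%:R != 0 :> R by rewrite pnatr_eq0 -lt0n fact_gt0.
have := bin_fact (leq_addl k m); rewrite addnK => /(congr1 (fun x => x%:R : R)).
rewrite !natrM /kcoef /gam !invfM invrK => <-.
move: (h m) (h k) (moment_gt0 hpsi (k + m)); set a := m`!%:R; set b := k`!%:R.
move: (moment _ _) ('C(_, _)%:R) => c x a0 b0 c0; field.
by rewrite a0 b0 gt_eqF.
Qed.

Lemma rapid_kcoef : rapid kcoef.
Proof.
split=> [k|r r0]; first exact/ltW/kcoef_gt0.
(* Growth of the moments at rate [2 / r]: the 2 compensates the binomial, at most [2 ^+ (k + m)],
   and [1 / r] yields the decay [r ^+ k]. *)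
have M0 : 0 < 2 / r by rewrite divr_gt0.
have [c c0 hc] := moment_growth hpsi M0.
exists (r ^+ m / c) => [|k]; first by rewrite divr_ge0 ?exprn_ge0// ltW.
rewrite kcoefE ler_pdivrMr ?(moment_gt0 hpsi)//.
apply: (@le_trans _ _ (2 ^+ (k + m))); first by rewrite -natrX ler_nat bin_le_exp2.
apply: le_trans (_ : r ^+ m / c * r ^+ k * (c * (2 / r) ^+ (k + m)) <= _).
  rewrite expr_div_n !exprD.
  have rm : r ^+ m != 0 by rewrite expf_neq0// gt_eqF.
  have rk : r ^+ k != 0 by rewrite expf_neq0// gt_eqF.
  have cn : c != 0 by rewrite gt_eqF.
  move: (r ^+ m) (r ^+ k) (2 ^+ k) (2 ^+ m) rm rk => a b x y a0 b0.
  by rewrite le_eqVlt; apply/orP; left; apply/eqP; field; rewrite a0 b0 cn.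
by apply: ler_wpM2l (hc _); rewrite mulr_ge0 ?divr_ge0 ?exprn_ge0// ltW.
Qed.

Lemma fock_kernelE (p z : 'cV[R[i]]_m.+1) :
  fock_kernel psi p z = pser kcoef (cdot z p).
Proof.
rewrite /fock_kernel /=; set u := cdot z p; set f : nat -> R[i]^o := fun N => _.
have h j : j`!%:R != 0 :> R[i] by rewrite pnatr_eq0 -lt0n fact_gt0.
(* The sum in the kernel starts at index [m], so its partial sums are those of [psum] shifted by
   [m]. *)
have fE N : f (N + m)%N = m`!%:R * psum kcoef N u.
  rewrite /f /psum -{1}[m]add0n big_addn addnK mulr_sumr; apply: eq_bigr => k _.
  rewrite addnK mulrA; congr (_ * _); rewrite kcoefE rmorphM/= fmorphV rmorph_nat mulrA.
  by rewrite -natrM mulnC bin_ffact.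
suff : f @ \oo --> (m`!%:R * pser kcoef u : R[i]^o).
  by move=> /(@cvg_lim _ (@norm_hausdorff _ _)) ->; rewrite mulrA mulVf ?mul1r.
apply/cvgrPdist_lt => e e0.
have eE : e = (Re e)%:C by move: e0; rewrite ltcE => /andP[/eqP + _]; case: (e) => ? ? /= ->.
have e0' : 0 < Re e by move: e0; rewrite ltcE => /andP[].
have r0 : 0 < normc u + 1 by rewrite ltr_wpDl// normc_ge0.
have [B B0 HB] := pser_tail rapid_kcoef r0.
pose M := (Num.truncn (m`!%:R * B / Re e)).+1.
exists (M + m)%N => // N /= MN; rewrite -(subnK (leq_trans (leq_addl M m) MN)) fE -mulrBr.
rewrite -[X in X < _]/((normc (m`!%:R * (pser kcoef u - psum kcoef (N - m) u)))%:C).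
rewrite [ltRHS]eE ltcR Normc.normcM -(rmorph_nat (real_complex R)) normcR ger0_norm//.
have ur : normc u <= normc u + 1 by rewrite lerDl.
apply: le_lt_trans (ler_wpM2l (ler0n _ _) (HB u (N - m)%N ur)) _.
rewrite mulrA ltr_pdivrMr ?exprn_gt0// [ltRHS]mulrC -ltr_pdivrMr//.
apply: lt_le_trans (truncnS_gt _) _; rewrite -/M -natrX ler_nat.
apply: leq_trans (_ : N - m <= _)%N; first by rewrite leq_subRL// 1?addnC// (leq_trans _ MN)// leq_addl.
exact/ltnW/ltn_expl.
Qed.

End KernelSeries.

Section RealSeries.
Context {R : realType}.
Implicit Types (c : nat -> R) (u : R[i]).

Definition rser c (x : R) : R := Re (pser c x%:C).

Lemma psumR c N (x : R) : psum c N x%:C = (\sum_(0 <= k < N) c k * x ^+ k)%:C.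
Proof. by rewrite rmorph_sum; apply: eq_bigr => k _; rewrite rmorphM rmorphXn. Qed.

Lemma pserR c (x : R) : pser c x%:C = (rser c x)%:C.
Proof.
apply: eqc => //; rewrite /pser /= (_ : (fun _ => _) = (fun=> 0)) ?lim_cst//.
by apply/funext => N; rewrite psumR.
Qed.

Lemma rser_tail c x : rapid c -> exists2 B, 0 <= B & forall N,
  `|rser c x - \sum_(0 <= k < N) c k * x ^+ k| <= B / 2 ^+ N.
Proof.
move=> rc; have r0 : 0 < `|x| + 1 by rewrite ltr_wpDl.
have [B B0 HB] := pser_tail rc r0; exists B => // N.
by have := HB x%:C N; rewrite pserR psumR -rmorphB !normcR lerDl ler01; apply.
Qed.

Lemma ler_psum c N M x : (forall k, 0 <= c k) -> 0 <= x -> (N <= M)%N ->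
  \sum_(0 <= k < N) c k * x ^+ k <= \sum_(0 <= k < M) c k * x ^+ k.
Proof.
move=> c0 x0 NM; rewrite [leRHS](big_cat_nat (n := N))//= lerDl sumr_ge0// => k _.
by rewrite mulr_ge0// exprn_ge0.
Qed.

Lemma psum_le_rser c N x : rapid c -> 0 <= x -> \sum_(0 <= k < N) c k * x ^+ k <= rser c x.
Proof.
move=> rc x0; have [B B0 HB] := rser_tail x rc.
apply: (@le_of_half_powers _ _ _ B) => j.
apply: le_trans (ler_psum rc.1 x0 (leq_addl j N)) _.
have := HB (j + N)%N; rewrite distrC ler_distl => /andP[_ h]; apply: le_trans h _.
rewrite lerD2l ler_wpM2l// lef_pV2 ?posrE ?exprn_gt0// ler_weXn2l ?ler1n// leq_addr//.
Qed.

Lemma normc_psum_le c N u x : rapid c -> normc u <= x -> normc (psum c N u) <= rser c x.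
Proof.
move=> rc ux; have x0 : 0 <= x by apply: le_trans ux; exact: normc_ge0.
apply: le_trans (psum_le_rser N rc x0).
apply: le_trans (normc_sum_le _ _) _; apply: ler_sum => k _.
rewrite Normc.normcM normcR normcX ger0_norm ?rc.1//; apply: ler_wpM2l; first exact: rc.1.
by apply: lerXn2r; rewrite ?nnegrE ?normc_ge0.
Qed.

Lemma normc_pser_le c u x : rapid c -> normc u <= x -> normc (pser c u) <= rser c x.
Proof.
move=> rc ux; have r0 : 0 < normc u + 1 by rewrite ltr_wpDl// normc_ge0.
have [B B0 HB] := pser_tail rc r0; apply: (@le_of_half_powers _ _ _ B) => N.
rewrite -(subrK (psum c N u) (pser c u)) addrC; apply: le_trans (le_normcD _ _) _.
by apply: lerD; [exact: normc_psum_le|apply: HB; rewrite lerDl].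
Qed.

Lemma pser_conj c u : rapid c -> pser c (conj u) = conj (pser c u).
Proof.
move=> rc; have r0 : 0 < normc u + 1 by rewrite ltr_wpDl// normc_ge0.
have [B B0 HB] := pser_tail rc r0; apply/eqP; rewrite -subr_eq0 -normc_eq0 eq_le normc_ge0 andbT.
apply: (@le_of_half_powers _ _ _ (B + B)) => N; rewrite add0r.
have e : psum c N (conj u) = conj (psum c N u).
  rewrite /psum (big_morph conj (@conjD R) (rmorph0 conj)); apply: eq_bigr => k _.
  by rewrite conjM conjX conj_real.
rewrite -(subrK (psum c N (conj u)) (pser c (conj u))) -addrA {2}e -conjB.
apply: le_trans (le_normcD _ _) _; rewrite normc_conjc mulrDl [normc (psum c N u - _)]normcB.
by apply: lerD; apply: HB; rewrite ?normc_conjc lerDl.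
Qed.

(** Only the linear term is kept, the other terms being nondecreasing. When [c 1] is positive, the
    series is strictly increasing in [x]. *)
Lemma rser_lin c x y : rapid c -> 0 <= x -> x <= y -> c 1%N * (y - x) <= rser c y - rser c x.
Proof.
move=> rc x0 xy; have [B B0 HB] := rser_tail x rc; have [B' B'0 HB'] := rser_tail y rc.
apply: (@le_of_half_powers _ _ _ (B + B')) => N.
have le2 (D : R) : 0 <= D -> D / 2 ^+ N.+2 <= D / 2 ^+ N.
  by move=> D0; apply: ler_wpM2l => //; rewrite lef_pV2 ?posrE ?exprn_gt0// ler_weXn2l ?ler1n// ltnW.
have h : c 1%N * (y - x) <= \sum_(0 <= k < N.+2) c k * y ^+ k - \sum_(0 <= k < N.+2) c k * x ^+ k.
  rewrite -sumrB big_nat_recl// big_nat_recl// !expr0 subrr add0r !expr1 -mulrBr lerDl.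
  apply: sumr_ge0 => k _; rewrite -mulrBr mulr_ge0 ?rc.1// subr_ge0 lerXn2r// ?nnegrE//.
  exact: le_trans xy.
have := HB' N.+2; have := HB N.+2; rewrite !ler_distl => /andP[_ h1] /andP[h2 _].
have := le2 _ B0; have := le2 _ B'0; rewrite mulrDl.
move: (rser c y) (rser c x) (\sum_(0 <= k < _) _) (\sum_(0 <= k < _) _) (B / _) (B' / _) (B / _) (B' / _) h h1 h2.
by move=> *; lra.
Qed.

Lemma rser_gt0 c x : rapid c -> 0 < c 0%N -> 0 <= x -> 0 < rser c x.
Proof.
move=> rc c0 x0; apply: lt_le_trans (psum_le_rser 1 rc x0).
by rewrite big_nat1 expr0 mulr1.
Qed.

Lemma rser0 c : rapid c -> rser c 0 = c 0%N.
Proof.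
move=> rc; have [B B0 HB] := rser_tail 0 rc; apply/eqP.
rewrite -subr_eq0 -normr_eq0 eq_le normr_ge0 andbT.
apply: (@le_of_half_powers _ _ _ B) => N; rewrite add0r.
have := HB N.+1; rewrite big_nat_recl// expr0 mulr1 big1 ?addr0; last first.
  by move=> k _; rewrite exprS mul0r mulr0.
move/le_trans; apply; rewrite ler_wpM2l// lef_pV2 ?posrE ?exprn_gt0// ler_weXn2l ?ler1n//.
Qed.

(* Cauchy-Schwarz with the weights [2^-(k + 1)]. *)
Lemma sqr_sum_le (x : nat -> R) N :
  (\sum_(0 <= k < N) x k) ^+ 2 <= \sum_(0 <= k < N) 2 ^+ k.+1 * x k ^+ 2.
Proof.
elim: N x => [|N IH] x; first by rewrite !big_nil expr0n.
rewrite !big_nat_recl//; have h := IH (fun k => x k.+1).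
have -> : \sum_(0 <= k < N) 2 ^+ k.+2 * x k.+1 ^+ 2 = 2 * \sum_(0 <= k < N) 2 ^+ k.+1 * x k.+1 ^+ 2.
  by rewrite mulr_sumr; apply: eq_bigr => k _; rewrite exprS mulrA.
move: h; rewrite /=; set a := \sum_(0 <= k < N) x k.+1; set b := \sum_(0 <= k < N) _ => h.
by have := sqr_ge0 (x 0%N - a); rewrite expr1; nra.
Qed.

End RealSeries.

(** * A square-integrable majorant of the truncated kernels *)

Section KernelMajorant.
Context {R : realType}.
Local Notation plane := (measurableTypeR R * measurableTypeR R)%type.
Variables (n : nat) (psi : R -> R).
Hypothesis hpsi : admissible_weight n psi.
Variable m : nat.
Implicit Types (w : 'cV[R[i]]_m.+1).
Local Notation kc := (kcoef psi m).

(** Bounds the kernel series and all its partial sums at arguments of modulus at most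
    [r * normc (w ord0 0)]. *)
Definition kmaj (r : R) w : R := rser kc (r * normc (w ord0 0)).

Lemma vcont_kmaj r : vcont (fun w => ((kmaj r w) ^+ 2 * vwt psi w)%:C).
Proof.
have -> : (fun w => ((kmaj r w) ^+ 2 * vwt psi w)%:C) =
    (fun w => (pser kc \o (fun w => r%:C * (normc (w ord0 0))%:C)) w ^+ 2 * (vwt psi w)%:C).
  by apply/funext => w /=; rewrite -rmorphM pserR -rmorphXn -rmorphM.
apply: vcontM; last exact: (vcont_vwt hpsi).
apply: vcontX; apply: vcont_comp; first exact/entire_cctn/pser_entire/(rapid_kcoef hpsi).
by apply: vcontM; [exact: vcont_cst|apply: vcont_norm; exact: vcont_coord].
Qed.

(** Monotone convergence along partial sums. [sqr_sum_le] replaces the square of a sum by a sum of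
    squares, which avoids the cross terms at the cost of factors [2 ^+ k.+1]. *)
Lemma vL1_kmaj r : 0 <= r -> vL1 (fun w => (kmaj r w) ^+ 2 * vwt psi w).
Proof.
move=> r0; have rk := rapid_kcoef hpsi m.
have [mh _] := vcont_vmeas (vcont_kmaj r).
pose x k w : R := kc k * (r * normc (w ord0 0)) ^+ k.
pose S N w : R := \sum_(0 <= k < N) x k w.
pose f N w : \bar R := ((S N w) ^+ 2 * vwt psi w)%:E.
have x0 k w : 0 <= x k w by rewrite mulr_ge0 ?rk.1// exprn_ge0// mulr_ge0// normc_ge0.
have S0 N w : 0 <= S N w by apply: sumr_ge0.
have w0 w : 0 <= vwt psi w by exact: wt_ge0.
have f0 N w : (0 <= f N w)%E by rewrite lee_fin mulr_ge0// sqr_ge0.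
have mf N : vmeas (f N).
  have c : vcont (fun w => ((S N w) ^+ 2 * vwt psi w)%:C).
    have -> : (fun w => ((S N w) ^+ 2 * vwt psi w)%:C) =
       (fun w => (psum kc N (r%:C * (normc (w ord0 0))%:C)) ^+ 2 * (vwt psi w)%:C).
      by apply/funext => w /=; rewrite -rmorphM psumR -rmorphXn -rmorphM.
    apply: vcontM; last exact: (vcont_vwt hpsi).
    apply: vcontX; apply: vcont_sum => k; apply: vcontM; first exact: vcont_cst.
    by apply: vcontX; apply: vcontM; [exact: vcont_cst|apply: vcont_norm; exact: vcont_coord].
  by have [] := vcont_vmeas c.
have fnd w : nondecreasing_seq (f ^~ w).
  move=> N M NM; rewrite lee_fin; apply: ler_wpM2r => //.
  rewrite lerXn2r ?nnegrE//; apply: ler_psum => //; first exact: rk.1.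
  by rewrite mulr_ge0// normc_ge0.
have flim w : f ^~ w @ \oo --> ((kmaj r w) ^+ 2 * vwt psi w)%:E.
  have [B B0 HB] := rser_tail (r * normc (w ord0 0)) rk.
  have c := half_powers_cvg HB.
  apply: cvg_EFin; first exact: nearW.
  by apply: cvgM; [rewrite expr2; under eq_fun do rewrite expr2; apply: cvgM; exact: c|exact: cvg_cst].
(* The [k]-th square integrates to a multiple of [kc k ^+ 2 * gam k], which is [kc k], so the bounds
   sum to the series itself at [2 * r ^+ 2]. *)
pose A : R := pi ^+ m.+1 / m`!%:R * (2 * rser kc (2 * r ^+ 2)).
have bound N : (vint (f N) <= A%:E)%E.
  pose a k : R := 2 ^+ k.+1 * (kc k ^+ 2 * (r ^+ 2) ^+ k).
  have a0 k : 0 <= a k.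
    apply: mulr_ge0; first exact: exprn_ge0.
    by apply: mulr_ge0; [exact: sqr_ge0|exact/exprn_ge0/sqr_ge0].
  pose g k w : \bar R := ((a k)%:E * ((normc (w ord0 0) ^+ 2) ^+ k * vwt psi w)%:E)%E.
  have mg k : vmeas (g k).
    apply: measurable_funeM; exact: measurable_int (vL1_head_wt hpsi m k).
  have g0 k w : (0 <= g k w)%E by rewrite /g -EFinM lee_fin mulr_ge0// mulr_ge0// exprn_ge0// sqr_ge0.
  apply: (@le_trans _ _ (vint (fun w => \sum_(0 <= k < N) g k w))%E).
    apply: ge0_le_integral => //.
    - exact: mf.
    - by apply: emeasurable_sum => k; exact: mg.
    - move=> t _; move: (vec_of_plane t) => w.
      rewrite /f (eq_bigr (fun k => (a k * ((normc (w ord0 0) ^+ 2) ^+ k * vwt psi w))%:E)); last by [].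
      rewrite sumEFin lee_fin.
      apply: le_trans (ler_wpM2r (w0 w) (sqr_sum_le (x ^~ w) N)) _.
      rewrite mulr_suml le_eqVlt; apply/orP; left; apply/eqP; apply: eq_bigr => k _.
      rewrite /a /x !exprMn ?[(_ ^+ 2) ^+ k]exprAC.
      move: (2 ^+ k.+1) (kc k) (r ^+ k) (normc _ ^+ k) (vwt _ _) => e1 e2 e3 e4 e5; ring.
  have := @ge0_integral_sum _ _ R (lebesgue_Cn m.+1) setT measurableT _
    (fun k t => g k (vec_of_plane t)) mg (fun k t _ => g0 k _) (index_iota 0 N).
  rewrite /vint => ->.
  rewrite (eq_bigr (fun k => (pi ^+ m.+1 / m`!%:R * (2 * (kc k * (2 * r ^+ 2) ^+ k)))%:E)); last first.
    move=> k _; rewrite ge0_integralZl//.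
      rewrite -/(vint (fun w => ((normc (w ord0 0) ^+ 2) ^+ k * vwt psi w)%:E)).
      rewrite (vint_head_wt hpsi) -EFinM; congr _%:E; rewrite /a [(2 * r ^+ 2) ^+ k]exprMn exprS.
      have := gam_gt0 hpsi m k; rewrite /kcoef; move: (gam psi m k) => y y0.
      have {}y0 : y != 0 by rewrite gt_eqF.
      move: (pi ^+ _ / _) (2 ^+ k) ((r ^+ 2) ^+ k) => e1 e2 e3; field; exact: y0.
    - exact: measurable_int (vL1_head_wt hpsi m k).
    - by move=> t _; rewrite lee_fin mulr_ge0// exprn_ge0// sqr_ge0.
    - by rewrite lee_fin.
  rewrite sumEFin lee_fin -mulr_sumr; apply: ler_wpM2l; first by rewrite divr_ge0// exprn_ge0// pi_ge0.
  rewrite -mulr_sumr; apply: ler_wpM2l => //.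
  by apply: psum_le_rser => //; rewrite mulr_ge0// sqr_ge0.
apply/integrableP; split; first exact: mh.
apply: (@le_lt_trans _ _ A%:E); last exact: ltry.
have -> : (\int[lebesgue_Cn m.+1]_t `|(kmaj r (vec_of_plane t) ^+ 2 * vwt psi (vec_of_plane t))%:E| =
   \int[lebesgue_Cn m.+1]_t limn (fun N => f N (vec_of_plane t)))%E.
  apply: eq_integral => t _; rewrite (cvg_lim _ (flim _)); last exact: ereal_hausdorff.
  by rewrite gee0_abs// lee_fin mulr_ge0// sqr_ge0.
have C := @cvg_monotone_convergence _ _ _ (lebesgue_Cn m.+1) setT measurableT
  (fun N t => f N (vec_of_plane t)) mf (fun N t _ => f0 N _) (fun t _ => fnd _).
have <- := cvg_lim (@ereal_hausdorff R) C.
apply: lime_le; first exact: cvgP C.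
by apply: nearW => N; exact: bound.
Qed.

End KernelMajorant.

(** * The Fock space *)

Section FockBasics.
Context {R : realType}.
Variables (n : nat) (psi : R -> R).
Hypothesis hpsi : admissible_weight n psi.
Variable m : nat.
Implicit Types (w z p : 'cV[R[i]]_m.+1) (g h : 'cV[R[i]]_m.+1 -> R[i]).
Local Notation vwt := (vwt psi).
Local Notation kc := (kcoef psi m).

Definition vsq g z : R := normc (g z) ^+ 2 * vwt z.

Definition ip g h z : R[i] := g z * conj (h z) * (vwt z)%:C.

Let vwt0 z : 0 <= vwt z.
Proof. exact: wt_ge0. Qed.

Lemma vsq_ge0 g z : 0 <= vsq g z.
Proof. by rewrite mulr_ge0// sqr_ge0. Qed.

Lemma vcont_vsq g : vcont g -> vcont (fun z => (vsq g z)%:C).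
Proof.
move=> cg; have -> : (fun z => (vsq g z)%:C) = (fun z => (normc (g z))%:C ^+ 2 * (vwt z)%:C).
  by apply/funext => z; rewrite -rmorphXn -rmorphM.
by apply: vcontM; [apply: vcontX; exact: vcont_norm|exact: (vcont_vwt hpsi)].
Qed.

Let vmeas_vsq g : vcont g -> vmeas (fun z => (vsq g z)%:E).
Proof. by move=> cg; have [] := vcont_vmeas (vcont_vsq cg). Qed.

Lemma vL1_vsqP g : vcont g -> vL1 (vsq g) <-> (vint (fun z => (vsq g z)%:E) < +oo)%E.
Proof.
move=> cg; have e : vint (fun z => (vsq g z)%:E) = vint (fun z => `|(vsq g z)%:E|)%E.
  by apply: eq_vint => z; rewrite gee0_abs// lee_fin vsq_ge0.
rewrite e; split=> [/integrableP[]//|h]; apply/integrableP; split=> //; exact: vmeas_vsq.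
Qed.

Lemma fockP g : fock psi g <-> holomorphic g /\ vL1 (vsq g).
Proof.
suff e : holomorphic g -> (\int[mu_Cn m.+1]_t (normc (g (vec_of_plane t)) ^+ 2 *
     fock_weight psi (vec_of_plane t))%:E = (m`!%:R / pi ^+ m.+1)%:E * vint (fun z => (vsq g z)%:E))%E.
  have c0 : 0 < m`!%:R / pi ^+ m.+1 :> R by rewrite divr_gt0 ?ltr0n ?fact_gt0 ?exprn_gt0 ?pi_gt0.
  rewrite /fock; split=> -[hg]; have [cg _] := holomorphic_lhol hg; rewrite (e hg) => H; split=> //.
    apply/(vL1_vsqP cg); move: H; have : (0 <= vint (fun z => (vsq g z)%:E))%E.
      by apply: integral_ge0 => t _; rewrite lee_fin vsq_ge0.
    by case: (vint _) => [r|//|//] _; rewrite ?ltry// gt0_muley ?ltxx// lte_fin.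
  apply: lte_mul_pinfty; rewrite ?lee_fin ?ltW//.
  by apply/(vL1_vsqP cg).
move=> hg; have [cg _] := holomorphic_lhol hg.
rewrite -(ge0_mu_int (vmeas_vsq cg)); last by move=> z; rewrite lee_fin vsq_ge0.
by apply: eq_integral => t _; rewrite fock_weightE.
Qed.

Lemma normc_ip g h z : normc (ip g h z) <= vsq g z + vsq h z.
Proof.
rewrite !Normc.normcM normc_conjc normcR ger0_norm// -mulrDl; apply: ler_wpM2r => //.
have := normc_ge0 (g z); have := normc_ge0 (h z); have := sqr_ge0 (normc (g z) - normc (h z)).
by move: (normc _) (normc _) => a b; nra.
Qed.

Lemma vcont_ip g h : vcont g -> vcont h -> vcont (ip g h).
Proof.
move=> cg ch; apply: vcontM; last exact: (vcont_vwt hpsi).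
by apply: vcontM => //; exact: vcontJ.
Qed.

Lemma cL1_ip g h : vcont g -> vcont h -> vL1 (vsq g) -> vL1 (vsq h) -> cL1 (ip g h).
Proof.
move=> cg ch g1 h1; apply: (cL1_le (g := fun z => 1 * vsq g z + 1 * vsq h z)).
- exact: vcont_ip.
- by have [] := vL1D 1 1 g1 h1.
- by move=> z; rewrite !mul1r; exact: normc_ip.
Qed.

Lemma fock_innerE g h : fock_inner psi g h = integral_Cn (ip g h).
Proof.
rewrite /fock_inner; congr integral_Cn; apply/funext => z.
by rewrite fock_weightE.
Qed.

Lemma fock_vcont g : fock psi g -> vcont g.
Proof. by move=> /fockP[/holomorphic_lhol[]]. Qed.

Lemma fock_cL1 g h : fock psi g -> fock psi h -> cL1 (ip g h).
Proof.
move=> fg fh; have cg := fock_vcont fg; have ch := fock_vcont fh.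
by apply: cL1_ip => //; [case/fockP: fg|case/fockP: fh].
Qed.

Lemma fock_lin c g h : fock psi g -> fock psi h -> fock psi (fun z => c * g z + h z).
Proof.
move=> fg fh; have [hg g1] := (fockP _).1 fg; have [hh h1] := (fockP _).1 fh.
apply/fockP; split; first exact: holomorphicD.
have cv : vcont (fun z => c * g z + h z).
  by apply: vcontD; [apply: vcontM; [exact: vcont_cst|exact: fock_vcont]|exact: fock_vcont].
have [L _] := vL1D (2 * normc c ^+ 2) 2 g1 h1.
apply: (vL1_le (vmeas_vsq cv) L) => z.
rewrite ger0_norm ?vsq_ge0// /vsq.
have -> : 2 * normc c ^+ 2 * (normc (g z) ^+ 2 * vwt z) + 2 * (normc (h z) ^+ 2 * vwt z) =
    (2 * normc c ^+ 2 * normc (g z) ^+ 2 + 2 * normc (h z) ^+ 2) * vwt z.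
  by move: (normc c) (normc (g z)) (normc (h z)) (vwt z) => x y t v; ring.
apply: ler_wpM2r => //.
apply: (@le_trans _ _ ((normc c * normc (g z) + normc (h z)) ^+ 2)).
  apply: lerXn2r; rewrite ?nnegrE ?normc_ge0//; first by rewrite addr_ge0 ?mulr_ge0 ?normc_ge0.
  by apply: le_trans (le_normcD _ _) _; rewrite Normc.normcM.
move: (normc c) (normc (g z)) (normc (h z)) => x y t.
rewrite -subr_ge0 [leRHS](_ : _ = (x * y - t) ^+ 2) ?sqr_ge0//; ring.
Qed.

Lemma fock_inner_lin c g h k : fock psi g -> fock psi h -> fock psi k ->
  fock_inner psi (fun z => c * g z + h z) k = c * fock_inner psi g k + fock_inner psi h k.
Proof.
move=> fg fh fk; rewrite !fock_innerE.
have Lg := fock_cL1 fg fk; have Lh := fock_cL1 fh fk.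
have [L e] := cI_lin c Lg Lh.
have -> : ip (fun z => c * g z + h z) k = (fun z => c * ip g k z + ip h k z).
  by apply/funext => z; rewrite /ip !mulrDl !mulrA.
by rewrite (integral_CnE L) (integral_CnE Lg) (integral_CnE Lh) e mulrDr mulrCA.
Qed.

Lemma fock_innerC g h : fock psi g -> fock psi h -> fock_inner psi h g = conj (fock_inner psi g h).
Proof.
move=> fg fh; rewrite !fock_innerE.
have Lg := fock_cL1 fg fh; have Lh := fock_cL1 fh fg.
rewrite (integral_CnE Lg) (integral_CnE Lh) conjM conj_real; congr (_ * _).
have e z : ip h g z = conj (ip g h z).
  by rewrite /ip !conjM conjCK conj_real [h z * _]mulrC.
apply: eqc; rewrite ?Re_conjE ?Im_conjE.
  by congr fine; apply: eq_integral => t _; rewrite e Re_conjE.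
have := RintegralZl (-1) measurableT Lg.2; rewrite mulN1r => <-.
by congr fine; apply: eq_integral => t _; rewrite e Im_conjE mulN1r.
Qed.

Lemma fock_inner_ge0 g : 0 <= Re (fock_inner psi g g).
Proof.
rewrite fock_innerE /integral_Cn /=; apply: Rintegral_ge0 => t _.
by rewrite /ip mulc_conjc -rmorphM /= mulr_ge0// sqr_ge0.
Qed.

End FockBasics.

Section DominatedVectorIntegral.
Context {R : realType} {n : nat}.
Implicit Types (f g : 'cV[R[i]]_n -> R[i]).

Let real_dct (f_ : nat -> 'cV[R[i]]_n -> R) (f G : 'cV[R[i]]_n -> R) :
  (forall N, vmeas (fun z => (f_ N z)%:E)) -> vmeas (fun z => (f z)%:E) ->
  (forall z, f_ ^~ z @ \oo --> f z) -> vL1 G -> (forall N z, `|f_ N z| <= G z) ->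
  (\int[lebesgue_Cn n]_t f_ N (vec_of_plane t))%R @[N --> \oo] -->
    (\int[lebesgue_Cn n]_t f (vec_of_plane t))%R.
Proof.
move=> mf_ mf cf GL fG.
have h1 : {ae lebesgue_Cn n, forall t, setT t ->
    (fun N => (f_ N (vec_of_plane t))%:E) @ \oo --> (f (vec_of_plane t))%:E}.
  by apply: aeW => t _; apply: cvg_EFin; [exact: nearW|exact: cf].
have h2 : {ae lebesgue_Cn n, forall t N, setT t ->
    (`|(f_ N (vec_of_plane t))%:E| <= (G (vec_of_plane t))%:E)%E}.
  by apply: aeW => t N _; exact: fG.
have [iF _ C] := dominated_convergence measurableT mf_ mf h1 GL h2.
apply: fine_cvg; rewrite fineK //; exact: (integrable_fin_num measurableT iF).
Qed.

Lemma cI_dct (f_ : nat -> 'cV[R[i]]_n -> R[i]) f (G : 'cV[R[i]]_n -> R) (B : 'cV[R[i]]_n -> R) :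
  (forall N, vcont (f_ N)) -> vcont f ->
  (forall N z, normc (f z - f_ N z) <= B z / 2 ^+ N) ->
  vL1 G -> (forall N z, normc (f_ N z) <= G z) ->
  (fun N => Re (cI (f_ N))) @ \oo --> Re (cI f) /\ (fun N => Im (cI (f_ N))) @ \oo --> Im (cI f).
Proof.
move=> cf_ cf fB GL fG; have [m1 m2] := vcont_vmeas cf.
split.
- apply: (@real_dct (fun N z => Re (f_ N z)) (fun z => Re (f z)) G) => // [N|z|N z].
  + by have [] := vcont_vmeas (cf_ N).
  + apply: (@half_powers_cvg _ _ _ (B z)) => N.
    by rewrite -Re_oppc -Re_addc; apply: le_trans (normc_geRe _) (fB N z).
  + by apply: le_trans (normc_geRe _) (fG N z).
- apply: (@real_dct (fun N z => Im (f_ N z)) (fun z => Im (f z)) G) => // [N|z|N z].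
  + by have [] := vcont_vmeas (cf_ N).
  + apply: (@half_powers_cvg _ _ _ (B z)) => N.
    by rewrite -Im_oppc -Im_addc; apply: le_trans (normc_geIm _) (fB N z).
  + by apply: le_trans (normc_geIm _) (fG N z).
Qed.

End DominatedVectorIntegral.

(** * The reproducing property *)

Section Reproducing.
Context {R : realType}.
Variables (n : nat) (psi : R -> R).
Hypothesis hpsi : admissible_weight n psi.
Variable m : nat.
Implicit Types (w z p : 'cV[R[i]]_m.+1) (g h : 'cV[R[i]]_m.+1 -> R[i]).
Local Notation W := (vwt psi).
Local Notation kc := (kcoef psi m).
Local Notation rk := (rapid_kcoef hpsi m).

Let vwt0 z : 0 <= W z.
Proof. exact: wt_ge0. Qed.

Lemma vint_vsq_isometry V g : vec_isometry V -> vcont g -> vL1 (vsq psi (fun w => g (V w))) <-> vL1 (vsq psi g).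
Proof.
move=> iV cg; have cG : vcont (fun w => g (V w)) by apply: vcont_compV => //; exact: isom_cont.
rewrite (vL1_vsqP hpsi cG) (vL1_vsqP hpsi cg).
have [ms _] := vcont_vmeas (vcont_vsq hpsi cg).
rewrite -(isom_vint iV ms); last by move=> z; rewrite lee_fin vsq_ge0.
have -> // : (fun w => (vsq psi g (V w))%:E) = (fun w => (vsq psi (fun w => g (V w)) w)%:E).
by apply/funext => w; rewrite /vsq /vwt (isom_norm iV).
Qed.

(** After the isometry that moves [p] to the first axis, the kernel is a series in the head
    coordinate alone, and [kmaj] dominates it. *)
Lemma kernel_fock p : fock psi (fock_kernel psi p).
Proof.
have -> : fock_kernel psi p = (fun z => pser kc (cdot z p)).
  by apply/funext => z; rewrite (fock_kernelE hpsi).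
have hk : holomorphic (fun z => pser kc (cdot z p)).
  by apply: holomorphic_comp_cdot; exact: (pser_entire rk).
have [ck _] := holomorphic_lhol hk.
apply/(fockP hpsi); split=> //.
have [V [l [iV Vl cV]]] := vec_isometry_head p.
apply: (vint_vsq_isometry iV ck).1.
have cG : vcont (fun w => pser kc (cdot (V w) p)).
  by apply: (@vcont_compV _ _ _ V (fun z => pser kc (cdot z p))) => //; exact: isom_cont.
have [mG _] := vcont_vmeas (vcont_vsq hpsi cG).
apply: (vL1_le mG (vL1_kmaj hpsi m (normc_ge0 l))) => w.
rewrite ger0_norm ?vsq_ge0// /vsq; apply: ler_wpM2r => //.
have h : normc (pser kc (cdot (V w) p)) <= kmaj psi (normc l) w.
  by rewrite cV; apply: (normc_pser_le rk); rewrite Normc.normcM normc_conjc.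
by apply: lerXn2r; rewrite ?nnegrE ?normc_ge0// (le_trans _ h)// normc_ge0.
Qed.

Lemma kernel_vcont p : vcont (fock_kernel psi p).
Proof. exact: (fock_vcont hpsi (kernel_fock p)). Qed.

Let shuffle3 (K : comRingType) (g a b v : K) : g * (a * b) * v = a * (g * b * v).
Proof. by ring. Qed.

Let conj_psum l N (u : R[i]) :
  conj (psum kc N.+1 (conj l * u)) = (kc N)%:C * l ^+ N * conj u ^+ N + conj (psum kc N (conj l * u)).
Proof.
rewrite /psum big_nat_recr//= conjD addrC; congr (_ + _).
by rewrite conjM conj_real conjX conjM conjCK exprMn mulrA.
Qed.

Lemma fock_reproducing g p : fock psi g -> fock_inner psi g (fock_kernel psi p) = g p.
Proof.
move=> fg; have fK := kernel_fock p.
have [hg g2] := (fockP hpsi g).1 fg; have [cg eg] := holomorphic_lhol hg.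
have cK := kernel_vcont p.
have [V [l [iV Vl cV]]] := vec_isometry_head p.
pose G w := g (V w).
have cG : vcont G by apply: vcont_compV => //; exact: isom_cont.
have lG : lhol G.
  split=> // z v; have := eg (V z) (V v); congr entire; apply/funext => a.
  by rewrite /G (isom_lin iV).
have GL : vL1 (vsq psi G) by exact: ((vint_vsq_isometry iV cg).2 g2).
(* The integrand in the rotated variables, with the kernel truncated after [N] terms; [F] is the
   full one. *)
pose f N w := G w * conj (psum kc N (conj l * w ord0 0)) * (W w)%:C.
pose F w := G w * conj (pser kc (conj l * w ord0 0)) * (W w)%:C.
pose phi k w := G w * conj (w ord0 0) ^+ k * (W w)%:C.
have cW := vcont_vwt hpsi (m := m).
have cphi k : vcont (phi k).
  by apply: vcontM => //; apply: vcontM => //; apply: vcontX; apply: vcontJ; exact: vcont_coord.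
have phiL k : cL1 (phi k).
  have [L _] := vL1D 1 1 GL (vL1_head_wt hpsi m k).
  apply: (cL1_le (cphi k) L) => w; rewrite !mul1r.
  rewrite !Normc.normcM normcX normc_conjc normcR ger0_norm// -mulrDl; apply: ler_wpM2r => //.
  rewrite -exprM mulnC exprM.
  have := sqr_ge0 (normc (G w) - normc (w ord0 0) ^+ k).
  have := exprn_ge0 k (normc_ge0 (w ord0 0)); have := normc_ge0 (G w).
  by move: (normc (G w)) (_ ^+ k) => a b; nra.
pose h a := G (vcons a 0).
have eh : entire h by exact: (entire_head lG).
have fE N w : f N.+1 w = (kc N)%:C * l ^+ N * phi N w + f N w.
  rewrite /f conj_psum mulrDr mulrDl /phi; congr (_ + _); exact: shuffle3.
(* Each term contributes [kc k * gam k = 1] times the [k]-th Taylor term of [h] at [l]. *)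
have fI N : cL1 (f N) /\ integral_Cn (f N) = \sum_(0 <= k < N) coef h k * l ^+ k.
  elim: N => [|N [IH1 IH2]].
    have -> : f 0%N = fun=> 0.
      by apply/funext => w; rewrite /f /psum big_nil rmorph0 mulr0 mul0r.
    have z1 : cL1 (fun _ : 'cV[R[i]]_m.+1 => 0 : R[i]) by split; exact: integrable0.
    split=> //; rewrite (integral_CnE z1) big_nil; apply/eqP; rewrite mulf_eq0; apply/orP; right.
    by apply/eqP; apply: eqc; rewrite /cI/= /Rintegral integral0.
  have [L E] := cI_lin ((kc N)%:C * l ^+ N) (phiL N) IH1.
  rewrite (funext (fE N)); split=> //.
  rewrite (integral_CnE L) E mulrDr -(integral_CnE IH1) IH2 mulrCA -(integral_CnE (phiL N)).
  rewrite (head_coef hpsi lG (phiL N)) big_nat_recr//= addrC; congr (_ + _).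
  have gk : (kc N)%:C * (gam psi m N)%:C = 1.
    by rewrite -rmorphM mulVf ?rmorph1// gt_eqF// (gam_gt0 hpsi).
  by rewrite -/h -mulrA [l ^+ N * _]mulrC mulrA [(kc N)%:C * _]mulrCA gk mulr1.
have FE : F = (fun w => ip psi g (fock_kernel psi p) (V w)).
  by apply/funext => w; rewrite /ip (fock_kernelE hpsi) cV /vwt (isom_norm iV).
have cI_F : cI F = cI (ip psi g (fock_kernel psi p)).
  by rewrite FE; apply: (cI_invariant (isom_vint iV)); exact: (vcont_ip hpsi cg cK).
have cF : vcont F.
  rewrite FE; apply: vcont_compV; [exact: isom_cont|exact: (vcont_ip hpsi cg cK)].
have cf N : vcont (f N).
  apply: vcontM => //; apply: vcontM => //; apply: vcontJ; apply: vcont_sum => k.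
  apply: vcontM; first exact: vcont_cst.
  by apply: vcontX; apply: vcontM; [exact: vcont_cst|exact: vcont_coord].
(* The dominating function comes from [a * b <= a ^+ 2 + b ^+ 2], with [a] the modulus of [G] and
   [b] the majorant of the kernel. *)
have [DL _] := vL1D 1 1 GL (vL1_kmaj hpsi m (normc_ge0 l)).
have fD N w : normc (f N w) <= 1 * vsq psi G w + 1 * (kmaj psi (normc l) w ^+ 2 * W w).
  rewrite !mul1r !Normc.normcM normc_conjc normcR ger0_norm// -mulrDl; apply: ler_wpM2r => //.
  have nl : normc (conj l * w ord0 0) <= normc l * normc (w ord0 0).
    by rewrite Normc.normcM normc_conjc.
  have := normc_psum_le N rk nl; rewrite -/(kmaj psi (normc l) w) => le1.
  have := normc_ge0 (psum kc N (conj l * w ord0 0)); have := normc_ge0 (G w).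
  have := sqr_ge0 (normc (G w) - kmaj psi (normc l) w).
  by move: (normc (G w)) (normc _) (kmaj _ _ _) le1 => a b c; nra.
have /choice[B HB] : forall w, exists B : R, forall N, normc (F w - f N w) <= B / 2 ^+ N.
  move=> w; have r0 : 0 < normc (conj l * w ord0 0) + 1 by rewrite ltr_wpDl// normc_ge0.
  have [B B0 HB] := pser_tail rk r0; exists (normc (G w) * B * W w) => N.
  have -> : F w - f N w = G w * conj (pser kc (conj l * w ord0 0) - psum kc N (conj l * w ord0 0)) * (W w)%:C.
    by rewrite conjB mulrBr mulrBl.
  rewrite !Normc.normcM normc_conjc normcR ger0_norm// [leRHS]mulrAC; apply: ler_wpM2r => //.
  by rewrite -[leRHS]mulrA; apply: ler_wpM2l; [exact: normc_ge0|apply: HB; rewrite lerDl].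
have [c1 c2] := cI_dct cf cF (fun N w => HB w N) DL fD.
rewrite (fock_innerE psi) (integral_CnE (fock_cL1 hpsi fg fK)) -cI_F.
have -> : g p = h l by rewrite /h /G Vl.
have [B' HB'] := taylorC l eh.
set c := _ / _; have sE N : (c%:C * cI (f N.+1)) = \sum_(k < N.+1) coef h k * l ^+ k.
  by have [L E] := fI N.+1; rewrite -(integral_CnE L) E big_mkord.
(* These sums tend to [h l] by Taylor's theorem and to the inner product by dominated convergence;
   uniqueness of the limit concludes. *)
pose s N := \sum_(k < N.+1) coef h k * l ^+ k.
have ReE (z : R[i]) : Re (c%:C * z) = c * Re z by rewrite Re_mulc /= mul0r subr0.
have ImE (z : R[i]) : Im (c%:C * z) = c * Im z by rewrite Im_mulc /= mul0r addr0.
have r1 : (fun N => Re (s N)) @ \oo --> Re (h l).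
  apply: (@half_powers_cvg _ _ _ B') => N.
  by rewrite -Re_oppc -Re_addc; apply: le_trans (normc_geRe _) (HB' N).
have r2 : (fun N => Im (s N)) @ \oo --> Im (h l).
  apply: (@half_powers_cvg _ _ _ B') => N.
  by rewrite -Im_oppc -Im_addc; apply: le_trans (normc_geIm _) (HB' N).
have q1 : (fun N => Re (s N)) @ \oo --> c * Re (cI F).
  have -> : (fun N => Re (s N)) = (fun N => c * Re (cI (f N.+1))).
    by apply/funext => N; rewrite -ReE sE.
  apply: cvgM; first exact: cvg_cst.
  by have := c1; rewrite -cvg_shiftS.
have q2 : (fun N => Im (s N)) @ \oo --> c * Im (cI F).
  have -> : (fun N => Im (s N)) = (fun N => c * Im (cI (f N.+1))).
    by apply/funext => N; rewrite -ImE sE.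
  apply: cvgM; first exact: cvg_cst.
  by have := c2; rewrite -cvg_shiftS.
apply: eqc; rewrite ?ReE ?ImE.
  exact: (cvg_unique (@norm_hausdorff _ _) q1 r1).
exact: (cvg_unique (@norm_hausdorff _ _) q2 r2).
Qed.

End Reproducing.

(** * Co-isometries *)

Section CoisometryIdentity.
Context {R : realType}.
Variables (n : nat) (psi : R -> R).
Hypothesis hpsi : admissible_weight n psi.
Variable m : nat.
Implicit Types (w z p : 'cV[R[i]]_m.+1) (f g : 'cV[R[i]]_m.+1 -> R[i]).
Local Notation kc := (kcoef psi m).
Local Notation K := (@fock_kernel R m.+1 psi).
Local Notation rk := (rapid_kcoef hpsi m).

Lemma fock_kernelC p z : conj (K p z) = K z p.
Proof. by rewrite !(fock_kernelE hpsi) [cdot p z]cdotC (pser_conj _ rk). Qed.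

Lemma fock_innerZ c f g : fock psi f -> fock psi g ->
  fock_inner psi (fun z => c * f z) g = c * fock_inner psi f g.
Proof.
move=> Ff Fg; have e : (fun z => c * f z) = (fun z => (c - 1) * f z + f z).
  by apply/funext => z; rewrite mulrBl mul1r subrK.
by rewrite e (fock_inner_lin hpsi (c - 1) Ff Ff Fg) mulrBl mul1r subrK.
Qed.

Let polar (c x y u v : R[i]) : Re (c * conj (c * x + conj y) + conj (c * y + v)) =
  normc c ^+ 2 * Re x + 2 * Re (c * y) + Re v.
Proof.
have -> : c * conj (c * x + conj y) + conj (c * y + v) =
   c * conj c * conj x + (c * y + conj (c * y)) + conj v.
  rewrite !conjD conjM conjCK mulrDr !mulrA -!addrA; congr (_ + (_ + _)).
rewrite mulc_conjc !Re_addc !Re_conjE [Re (_%:C * _)]Re_mulc [Im _%:C]/= mul0r subr0 Re_conjE.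
by congr (_ + _ + _); rewrite mulrDl !mul1r.
Qed.

Lemma fock_polar c f g : fock psi f -> fock psi g ->
  Re (fock_inner psi (fun z => c * f z + g z) (fun z => c * f z + g z)) =
  normc c ^+ 2 * Re (fock_inner psi f f) + 2 * Re (c * fock_inner psi f g) + Re (fock_inner psi g g).
Proof.
move=> Ff Fg; have Fh := fock_lin hpsi c Ff Fg.
rewrite (fock_inner_lin hpsi c Ff Fg Fh).
rewrite (fock_innerC hpsi Fh Ff) (fock_innerC hpsi Fh Fg).
rewrite !(fock_inner_lin hpsi) // (fock_innerC hpsi Ff Fg).
exact: (polar c (fock_inner psi f f) (fock_inner psi f g) (fock_inner psi g g)).
Qed.

Lemma fock_isometry_inner (T : ('cV[R[i]]_m.+1 -> R[i]) -> 'cV[R[i]]_m.+1 -> R[i]) :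
  (forall f, fock psi f -> fock psi (T f)) ->
  (forall c f g, fock psi f -> fock psi g -> T (fun z => c * f z + g z) = (fun z => c * T f z + T g z)) ->
  (forall f, fock psi f -> fock_norm psi (T f) = fock_norm psi f) ->
  forall f g, fock psi f -> fock psi g -> fock_inner psi (T f) (T g) = fock_inner psi f g.
Proof.
move=> TF Tlin Tn f g Ff Fg.
have sq h : fock psi h -> Re (fock_inner psi (T h) (T h)) = Re (fock_inner psi h h).
  move=> Fh; have := Tn h Fh; rewrite /fock_norm => /(congr1 (fun x => x ^+ 2)).
  by rewrite !sqr_sqrtr ?(fock_inner_ge0 psi).
(* Comparing the norms of [c * f + g] and of its image; [c = 1] and [c = 'i] then give the real and
   the imaginary part. *)
have key c : Re (c * fock_inner psi (T f) (T g)) = Re (c * fock_inner psi f g).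
  have := sq _ (fock_lin hpsi c Ff Fg); rewrite (Tlin _ _ _ Ff Fg).
  rewrite (fock_polar c (TF _ Ff) (TF _ Fg)) (fock_polar c Ff Fg) (sq _ Ff) (sq _ Fg).
  by move=> /addIr/addrI/(mulfI (_ : 2 != 0 :> R)); apply; rewrite pnatr_eq0.
apply: eqc; first by have := key 1; rewrite !mul1r.
by have := key 'i; rewrite !Re_mulc /= !mul0r !mul1r !sub0r => /oppr_inj.
Qed.

(** Both sides are inner products of kernels at [w] and [z], the left one after applying [T] to each
    of them. *)
Lemma coisometry_kernel U (G : 'cV[R[i]]_m.+1 -> 'cV[R[i]]_m.+1) :
  bounded_on_fock psi (weighted_composition U G) ->
  coisometry_on_fock psi (weighted_composition U G) ->
  forall w z, conj (U w) * U z * K (G w) (G z) = K w z.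
Proof.
set S := weighted_composition U G => -[SF _ _] [T [TF adj] Tn] w z.
have FK p : fock psi (K p) := kernel_fock hpsi p.
have FS p : fock psi (S (K p)) by exact: SF.
have rep g p : fock psi g -> fock_inner psi g (K p) = g p by exact: (fock_reproducing hpsi).
have Tval f x : fock psi f -> T f x = fock_inner psi f (S (K x)).
  move=> Ff; rewrite -(rep (T f) x (TF _ Ff)) (fock_innerC hpsi (FK x) (TF _ Ff)).
  by rewrite -adj// -(fock_innerC hpsi (FS x) Ff).
(* [fock_adjoint] only states the duality relation; linearity of [T] on the space is read off from
   the formula [Tval]. *)
have Tlin c f g : fock psi f -> fock psi g -> T (fun z => c * f z + g z) = (fun z => c * T f z + T g z).
  move=> Ff Fg; apply/funext => x.
  rewrite (Tval _ _ (fock_lin hpsi c Ff Fg)) (Tval _ _ Ff) (Tval _ _ Fg).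
  exact: (fock_inner_lin hpsi c Ff Fg (FS x)).
have TK y x : T (K y) x = conj (U y) * K (G y) x.
  rewrite (Tval _ _ (FK y)) (fock_innerC hpsi (FS x) (FK y)) (rep _ _ (FS x)).
  by rewrite /S /weighted_composition conjM fock_kernelC.
have := fock_isometry_inner TF Tlin Tn (FK w) (FK z).
rewrite (rep _ _ (FK w)) => <-.
have FT y : fock psi (T (K y)) by exact: TF.
have -> : fock_inner psi (T (K w)) (T (K z)) = conj (U w) * fock_inner psi (K (G w)) (T (K z)).
  rewrite -(fock_innerZ _ (FK (G w)) (FT z)); congr fock_inner; apply/funext => x; exact: TK.
rewrite (fock_innerC hpsi (FT z) (FK (G w))) (rep _ _ (FT z)) TK conjM conjCK fock_kernelC.
exact/esym/mulrA.
Qed.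

End CoisometryIdentity.

(** * The weight and its constants *)

Section UnitaryWeight.
Context {R : realType}.
Variables (n : nat) (psi : R -> R).
Hypothesis hpsi : admissible_weight n psi.
Variable m : nat.
Implicit Types (w z p : 'cV[R[i]]_m.+1).
Local Notation kc := (kcoef psi m).
Local Notation K := (@fock_kernel R m.+1 psi).
Local Notation rk := (rapid_kcoef hpsi m).

Lemma kcoef0 : kc 0%N = (moment psi m)^-1.
Proof. by rewrite (kcoefE hpsi) add0n binn mul1r. Qed.

Lemma fock_kernel_diag p : K p p = (rser kc (sqnorm p))%:C.
Proof. by rewrite (fock_kernelE hpsi) cdot_sqnorm pserR. Qed.

Lemma fock_kernel0l z : K 0 z = (kc 0%N)%:C.
Proof. by rewrite (fock_kernelE hpsi) cdot0r -[0]/(0%:C) pserR (rser0 rk). Qed.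

Lemma fock_kernel0r p : K p 0 = (kc 0%N)%:C.
Proof. by rewrite (fock_kernelE hpsi) cdot0l -[0]/(0%:C) pserR (rser0 rk). Qed.

Lemma fock_norm_kernel p : fock_norm psi (K p) = Num.sqrt (rser kc (sqnorm p)).
Proof. by rewrite /fock_norm (fock_reproducing hpsi p (kernel_fock hpsi p)) fock_kernel_diag. Qed.

Lemma rser_inj (x y : R) : 0 <= x -> 0 <= y -> rser kc x = rser kc y -> x = y.
Proof.
have k1 := kcoef_gt0 hpsi m 1.
have lt a b : 0 <= a -> a < b -> rser kc a < rser kc b.
  move=> a0 ab; rewrite -subr_gt0; apply: lt_le_trans (rser_lin rk a0 (ltW ab)).
  by rewrite mulr_gt0// subr_gt0.
have nlt a b : 0 <= a -> rser kc a = rser kc b -> ~~ (a < b).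
  by move=> a0 e; apply/negP => /(lt _ _ a0); rewrite e ltxx.
move=> x0 y0 e; apply/eqP; rewrite eq_le !leNgt.
by rewrite (nlt _ _ x0 e) (nlt _ _ y0 (esym e)).
Qed.

(** The algebra of the final formula, with [a] and [b] for [conj (U p)] and [U p], [u] for [U z],
    [v] for [conj (U 0)], [k] for the value of [K_0], [s] for the norm of [K_p] and [x] for
    [K_p z]. *)
Let weight_field (F : fieldType) (a b u v k s x : F) :
  s != 0 -> a * b * k = s * s -> b * v = 1 -> a * u * k = x -> u = (v * s)^-1 * (x / s).
Proof.
move=> s0 e1 e2 <-; have v0 : v != 0.
  by apply/eqP => v0; move: e2; rewrite v0 mulr0 => /esym/eqP; rewrite oner_eq0.
apply: (mulfI (mulf_neq0 v0 (mulf_neq0 s0 s0))).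
have -> : v * (s * s) * ((v * s)^-1 * (a * u * k / s)) = a * u * k by field; rewrite v0 s0.
by rewrite -e1 -[RHS]mul1r -e2; ring.
Qed.

Lemma kernel_identity_weight U (C : 'M[R[i]]_m.+1) (D : 'cV[R[i]]_m.+1) :
  C \in unitmx ->
  (forall w z, conj (U w) * U z * K (C *m w - D) (C *m z - D) = K w z) ->
  let p := invmx C *m D in
  let beta := (conj (U 0) * (fock_norm psi (K p))%:C)^-1 in
  [/\ forall z, U z = beta * (K p z / (fock_norm psi (K p))%:C),
      normc beta = Num.sqrt (moment psi m) & eucl p = eucl D].
Proof.
move=> uC E p beta.
have Gp : C *m p - D = 0 by rewrite /p mulKVmx// subrr.
set N := rser kc (sqnorm p); set s := Num.sqrt N.
have k0 : 0 < kc 0%N := kcoef_gt0 hpsi m 0.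
have N0 : 0 < N := rser_gt0 rk k0 (sqnorm_ge0 p).
have s0 : 0 < s by rewrite sqrtr_gt0.
have ns : fock_norm psi (K p) = s := fock_norm_kernel p.
have Ep z : conj (U p) * U z * (kc 0%N)%:C = K p z by rewrite -[RHS]E Gp fock_kernel0l.
have k0c : (kc 0%N)%:C != 0 :> R[i] by exact: realc_neq0.
have s0c : s%:C != 0 :> R[i] by exact: realc_neq0.
have e0 : conj (U p) * U 0 = 1.
  by apply: (mulIf k0c); rewrite Ep fock_kernel0r mul1r.
have e1 : U p * conj (U 0) = 1.
  by have /(congr1 conj) := e0; rewrite conjM conjCK rmorph1.
have ss : s ^+ 2 = N by rewrite sqr_sqrtr ?ltW.
have e2 : conj (U p) * U p * (kc 0%N)%:C = s%:C * s%:C.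
  by rewrite Ep fock_kernel_diag -rmorphM -expr2 ss.
have n2 : normc (U p) ^+ 2 * kc 0%N = N.
  by apply: complexI; rewrite rmorphM /= -mulc_conjc [U p * _]mulrC e2 -rmorphM -expr2 ss.
have mom : 0 < moment psi m by exact: (moment_gt0 hpsi).
split.
- by move=> z; rewrite /beta ns; apply: (weight_field s0c e2 e1 (Ep z)).
(* Since [conj (U 0)] is the inverse of [U p], [beta] is [U p / s]; then [n2] evaluates its squared
   modulus as [1 / kc 0], the moment of index [m]. *)
- have Up0 : U p != 0.
    by apply: contraTneq (oner_neq0 R[i]) => Up; rewrite negbK -e1 Up mul0r.
  have U0 : conj (U 0) = (U p)^-1 by apply: (mulfI Up0); rewrite e1 divff.
  rewrite /beta ns normc_inv Normc.normcM U0 normc_inv normcR gtr0_norm// invfM invrK.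
  apply/eqP; rewrite -(@eqrXn2 _ 2)// ?sqrtr_ge0// ?divr_ge0 ?normc_ge0 ?(ltW s0)//.
  by rewrite exprMn exprVn ss sqr_sqrtr ?ltW// -n2 kcoef0 invfM invrK mulrA mulfV ?mul1r// sqrf_eq0 normc_eq0.
- rewrite /eucl; congr Num.sqrt; apply: (rser_inj (sqnorm_ge0 _) (sqnorm_ge0 _)).
  (* At the origin the identity gives [|U 0|^2 * rser kc |D|^2 = kc 0]. Multiplying by [|U p|^2],
     the inverse of [|U 0|^2], turns the right-hand side into [N] by [n2]. *)
  have := E 0 0; rewrite mulmx0 sub0r fock_kernel0l fock_kernel_diag.
  have -> : sqnorm (- D) = sqnorm D by rewrite /sqnorm cdotN.
  rewrite [_ * U 0]mulrC mulc_conjc -rmorphM => /complexI eD.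
  have ab : normc (U p) ^+ 2 * normc (U 0) ^+ 2 = 1.
    by rewrite -exprMn -(normc_conjc (U 0)) -Normc.normcM e1 Normc.normc1 expr1n.
  have f : normc (U p) ^+ 2 * (normc (U 0) ^+ 2 * rser kc (sqnorm D)) = N.
    rewrite eD; exact: n2.
  rewrite mulrA ab mul1r in f; exact: esym f.
Qed.

End UnitaryWeight.

Theorem theorem3p6 (R : realType) (n : nat) (psi : R -> R)
    (C : 'M[R[i]]_n) (D : 'cV[R[i]]_n) (U : 'cV[R[i]]_n -> R[i]) :
  (0 < n)%N ->
  admissible_weight n psi ->
  C \in unitmx ->
  opnorm C <= 1 ->
  holomorphic U ->
  bounded_on_fock psi (weighted_composition U (fun z => C *m z - D)) ->
  coisometry_on_fock psi (weighted_composition U (fun z => C *m z - D)) ->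
  let p := invmx C *m D in
  let K := fock_kernel psi p in
  let beta := ((U 0)^* * (fock_norm psi K)%:C)^-1 in
  [/\ forall z, U z = beta * (K z / (fock_norm psi K)%:C),
      Normc.normc beta = Num.sqrt (moment psi n.-1) &
      eucl p = eucl D].
Proof.
case: n C D U => [//|m] C D U _ hpsi uC _ _ hb hc.
exact: (kernel_identity_weight hpsi uC (coisometry_kernel hpsi hb hc)).
Qed.
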